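(* Consider the full qubit model at $\theta=(0,0,r)$ with $0\le r<1$, and let $G=\begin{pmatrix}\tilde G&g\\ g^T&s\end{pmatrix}$ be a real symmetric positive definite $3\times3$ matrix ($\tilde G$ $2\times2$, $g\in\mathbb{R}^2$, $s\in\mathbb{R}$). Then the quantum Cramér–Rao bound equals the RLD bound: $$C_{(0,0,r)}(G)=C^R_{(0,0,r)}(G)=\mathrm{tr}\,G-r^2s+2r\sqrt{\det\tilde G}.$$ That is, every sequence of estimators $M^n$ on $(\mathbb{C}^2)^{\otimes n}$ asymptotically unbiased at $(0,0,r)$ satisfies $\liminf_n n\,\mathrm{tr}\,GV_{(0,0,r)}(M^n)\ge\mathrm{tr}\,G-r^2s+2r\sqrt{\det\tilde G}$, and there exists an asymptotically unbiased sequence with $\lim_n n\,\mathrm{tr}\,GV_{(0,0,r)}(M^n)=\mathrm{tr}\,G-r^2s+2r\sqrt{\det\tilde G}$.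
   Context: Full qubit model: $\rho_\theta=\frac12I+\sum_{i=1}^3\theta^i\sigma_i$ on $\mathbb{C}^2$, $\|\theta\|<1$, with $\sigma_1=\frac12\begin{pmatrix}0&1\\1&0\end{pmatrix}$, $\sigma_2=\frac12\begin{pmatrix}0&-i\\i&0\end{pmatrix}$, $\sigma_3=\frac12\begin{pmatrix}1&0\\0&-1\end{pmatrix}$. RLD Fisher matrix $\tilde J_\theta$ and RLD bound $C^R_\theta(G)=\mathrm{tr}\sqrt G\,\mathrm{Re}(\tilde J_\theta^{-1})\sqrt G+\mathrm{tr}|\sqrt G\,\mathrm{Im}(\tilde J_\theta^{-1})\sqrt G|$, where $\partial_j\rho_\theta=\rho_\theta\tilde L_{\theta;j}$, $\tilde J_{\theta;j,k}=\mathrm{Tr}\,\rho_\theta\tilde L_{\theta;k}\tilde L_{\theta;j}^*$, $\mathrm{Re}W=(W+\bar W)/2$, $\mathrm{Im}W=(W-\bar W)/(2i)$, $|A|=(A^*A)^{1/2}$. An estimator for $n$ copies is a POVM $M^n$ on $(\mathbb{C}^2)^{\otimes n}$ with outcomes $\hat\theta\in\mathbb{R}^3$; $E^j_\theta(M^n)=\int\hat\theta^j\mathrm{Tr}\,M^n(d\hat\theta)\rho_\theta^{\otimes n}$, $A^j_{\theta;k}(M^n)=\partial_kE^j_\theta(M^n)$, $V^{k,j}_\theta(M^n)=\int(\hat\theta^k-\theta^k)(\hat\theta^j-\theta^j)\mathrm{Tr}\,M^n(d\hat\theta)\rho_\theta^{\otimes n}$. The sequence is asymptotically unbiased at $\theta$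 if $E_\theta(M^n)\to\theta$ and $A_\theta(M^n)\to I$. The quantum Cramér–Rao bound $C_\theta(G)$ is the infimum over asymptotically unbiased sequences of $\liminf_n n\,\mathrm{tr}\,GV_\theta(M^n)$. *)

(* Defs.v *)
(* MathComp + MathComp-Analysis (R : realType), complex numbers R[i]
   from mathcomp-real-closed, tensor powers of matrices from real_closed.mxtens. *)
From HB Require Import structures.
From mathcomp Require Import all_boot all_order all_algebra.
From mathcomp Require Import all_classical all_reals all_analysis.
From mathcomp.real_closed Require Import complex mxtens.
Import Order.TTheory GRing.Theory Num.Theory.
Import numFieldNormedType.Exports.

Set Implicit Arguments.
Unset Strict Implicit.
Unset Printing Implicit Defensive.

Local Open Scope complex_scope.
Local Open Scope ring_scope.
Local Open Scope classical_set_scope.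

Section QubitModel.
Variable R : realType.
Local Notation C := (R[i]).

(* ---------- complex matrices ---------- *)
(* conjugate transpose *)
Definition adjmx {m n} (A : 'M[C]_(m, n)) : 'M[C]_(n, m) :=
  (map_mx (fun z : C => z^*) A)^T.

(* positive semidefinite (hermitian and v^* A v >= 0) complex matrix *)
Definition psdC d (A : 'M[C]_d) : Prop :=
  adjmx A = A /\ forall v : 'cV[C]_d, 0 <= (adjmx v *m A *m v) 0 0.

(* Pauli-type matrices with the 1/2 normalisation of the paper *)
Definition sigma1 : 'M[C]_2 :=
  \matrix_(i < 2, j < 2) (if i == j then 0 else (2^-1 : R)%:C).
Definition sigma2 : 'M[C]_2 :=
  \matrix_(i < 2, j < 2)
    (if i == j then 0
     else if (i == 0 :> nat) then (Complex 0 (- 2^-1)) else (Complex 0 (2^-1))).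
Definition sigma3 : 'M[C]_2 :=
  \matrix_(i < 2, j < 2)
    (if i == j then (if (i == 0 :> nat) then (2^-1 : R)%:C else (- 2^-1 : R)%:C)
     else 0).
Definition sigma (i : 'I_3) : 'M[C]_2 :=
  if i == 0 :> nat then sigma1 else if i == 1 :> nat then sigma2 else sigma3.

(* the full qubit model  rho_theta = 1/2 I + sum_i theta^i sigma_i *)
Definition rho (th : 'rV[R]_3) : 'M[C]_2 :=
  (2^-1 : R)%:C *: 1%:M + \sum_(i < 3) (th 0 i)%:C *: sigma i.

(* n-fold tensor power rho_theta^{(x) n} on (C^2)^{(x) n} *)
Definition rho_n (th : 'rV[R]_3) (n : nat) : 'M[C]_(2 ^ n) := rho th ^t n.

(* ---------- outcome space R^3 (Borel = product sigma-algebra) ---------- *)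
Definition Omega := (R * R * R)%type.
Definition ovec (x : Omega) : 'rV[R]_3 :=
  \row_(i < 3) nth 0 [:: x.1.1; x.1.2; x.2] i.

(* POVM on C^d with outcomes in R^3 *)
Record POVM (d : nat) := {
  povm :> set Omega -> 'M[C]_d;
  povm_psd : forall A, measurable A -> psdC (povm A);
  povm_total : povm setT = 1%:M;
  povm_sigma_additive : forall i j,
    semi_sigma_additive (fun A => (complex.Re (povm A i j))%:E) /\
    semi_sigma_additive (fun A => (complex.Im (povm A i j))%:E) }.

Definition default_law : probability Omega R := @dirac _ Omega ((0:R), (0:R), (0:R)) R.

(* the outcome distribution  A |-> Tr M(A) rho  (as a probability measure) *)
Definition law d (M : POVM d) (r : 'M[C]_d) : probability Omega R :=
  match pselect (exists P : probability Omega R,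
           forall A, measurable A -> P A = (complex.Re (\tr (M A *m r)))%:E) with
  | left H => projT1 (cid H)
  | right _ => default_law
  end.

(* E_theta(M^n) *)
Definition Ehat n (M : POVM (2 ^ n)) (th : 'rV[R]_3) : 'rV[R]_3 :=
  \row_(j < 3) fine (\int[law M (rho_n th n)]_x (ovec x 0 j)%:E)%E.

(* A_theta(M^n)^j_k = d_k E^j_theta(M^n) *)
Definition Amat n (M : POVM (2 ^ n)) (th : 'rV[R]_3) : 'M[R]_3 :=
  \matrix_(j < 3, k < 3) derive (fun t => Ehat M t 0 j) th (delta_mx 0 k).

(* tr G V_theta(M^n) = int (x-theta) G (x-theta)^T  Tr M(dx) rho_theta^{(x)n} *)
Definition qform (G : 'M[R]_3) (u : 'rV[R]_3) : R := (u *m G *m u^T) 0 0.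
Definition trGV n (M : POVM (2 ^ n)) (th : 'rV[R]_3) (G : 'M[R]_3) : \bar R :=
  (\int[law M (rho_n th n)]_x (qform G (ovec x - th))%:E)%E.

(* asymptotic unbiasedness at theta0 (with the regularity needed for
   E_theta(M^n) and its partial derivatives at theta0 to exist) *)
Definition asym_unbiased (M : forall n, POVM (2 ^ n)) (th0 : 'rV[R]_3) : Prop :=
  (\forall n \near \oo,
     (exists2 e : R, 0 < e & forall th : 'rV[R]_3, `|th - th0| < e ->
        forall j : 'I_3, (law (M n) (rho_n th n)).-integrable setT
                           (fun x => (ovec x 0 j)%:E)) /\
     (forall j k : 'I_3,
        derivable (fun t => Ehat (M n) t 0 j) th0 (delta_mx 0 k))) /\
  (forall j : 'I_3, (fun n => Ehat (M n) th0 0 j) @ \oo --> th0 0 j) /\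
  (forall j k : 'I_3, (fun n => Amat (M n) th0 j k) @ \oo --> ((j == k)%:R : R)).

(* ---------- real matrices ---------- *)
Definition psdR d (A : 'M[R]_d) : Prop :=
  A^T = A /\ forall v : 'rV[R]_d, 0 <= (v *m A *m v^T) 0 0.
Definition posdefR d (A : 'M[R]_d) : Prop :=
  A^T = A /\ forall v : 'rV[R]_d, v != 0 -> 0 < (v *m A *m v^T) 0 0.

(* the (unique) positive semidefinite square root of a psd matrix *)
Definition msqrt d (A : 'M[R]_d) : 'M[R]_d :=
  match pselect (exists B : 'M[R]_d, psdR B /\ B *m B = A) with
  | left H => projT1 (cid H)
  | right _ => 0
  end.

(* |X| = (X^* X)^{1/2}, for a real matrix X *)
Definition absmx d (X : 'M[R]_d) : 'M[R]_d := msqrt (X^T *m X).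

(* ---------- RLD quantities ---------- *)
(* d_j rho_theta = sigma_j (the model is affine in theta) *)
Definition drho (j : 'I_3) : 'M[C]_2 := sigma j.
(* RLD: d_j rho = rho L_j, i.e. L_j = rho^{-1} d_j rho (rho invertible, |theta|<1) *)
Definition Ltilde (th : 'rV[R]_3) (j : 'I_3) : 'M[C]_2 := invmx (rho th) *m drho j.
Definition Jtilde (th : 'rV[R]_3) : 'M[C]_3 :=
  \matrix_(j < 3, k < 3) \tr (rho th *m Ltilde th k *m adjmx (Ltilde th j)).
(* Re W = (W + conj W)/2 and Im W = (W - conj W)/(2i), as real matrices *)
Definition ReM m n (W : 'M[C]_(m, n)) : 'M[R]_(m, n) := map_mx (@complex.Re R) W.
Definition ImM m n (W : 'M[C]_(m, n)) : 'M[R]_(m, n) := map_mx (@complex.Im R) W.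

Definition CR_bound (th : 'rV[R]_3) (G : 'M[R]_3) : R :=
  let sG := msqrt G in
  let Ji := invmx (Jtilde th) in
  \tr (sG *m ReM Ji *m sG) + \tr (absmx (sG *m ImM Ji *m sG)).

(* ---------- the point (0,0,r) and the block decomposition of G ---------- *)
Definition theta_r (r : R) : 'rV[R]_3 := \row_(i < 3) (if i == 2 :> nat then r else 0).
Definition Gtilde (G : 'M[R]_3) : 'M[R]_2 :=
  \matrix_(i < 2, j < 2) G (widen_ord (leqnSn 2) i) (widen_ord (leqnSn 2) j).
Definition Gs (G : 'M[R]_3) : R := G ord_max ord_max.

End QubitModel.

(* Main.v *)
Require Import Defs.
From HB Require Import structures.
From mathcomp Require Import all_boot all_order all_algebra.
From mathcomp Require Import zify ring lra.
From mathcomp Require Import all_classical all_reals all_analysis measurable_realfun.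
From mathcomp.real_closed Require Import complex mxtens.
Import Order.TTheory GRing.Theory Num.Theory.
Import numFieldNormedType.Exports.
Set Implicit Arguments.
Unset Strict Implicit.
Unset Printing Implicit Defensive.
Local Open Scope ring_scope.
Local Open Scope classical_set_scope.

(** Lower bound.  Write J_k for the collective operator of the RLD L_k, so that
rho^(x)n J_k = d_k rho^(x)n.  Factor G = c^* c with complex rows c_a and put
Y_a = (1/n) sum_k y_(a,k) J_k.  For every u the operator
Q(u) = sum_a (c_a.u - Y_a^* ) rho^(x)n (c_a.u - Y_a^* )^* is positive and equals
(u G u^T) rho^(x)n - sum_j u_j F_j + Gam, where F_j is a real combination of the d_k rho^(x)n.
Integrating Tr M(dx) Q(x - theta) >= 0 bounds tr G V below by a linear function of the matrix A;
when A tends to the identity and y_a is the image of conj c_a under the inverse RLD Fisher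
matrix, n times this function tends to the RLD bound.

Attainment.  Rotate the x-y plane so that Gtilde becomes diag(l1, l2).  Measure successively the
three collective spins by Gaussian-like instruments of width p (Kraus operators
f(m - J) with f(m) = C(p, m) / sqrt C(2p, p)), first the z axis with p ~ sqrt n, then the
first transverse axis with p ~ 2 n r sqrt (l2 / l1), then the second one sharply.  By su(2)
covariance each instrument only damps the other spins by an explicit factor, so after rescaling
the outcomes are exactly unbiased and their covariance is explicit. *)

(** * Collective operators on tensor powers *)

(** [Q(u)] is positive for each fixed [u], while the argument needs [u = x - theta] under an
    integral over an arbitrary POVM. To allow this, the entries of [M] receive bounded densities
    with respect to the outcome law at [theta]: since [r < 1], the state is bounded below by a
    positive multiple of the identity, so the law dominates the trace of [M]. The same densities
    turn the mean, near [theta], into a finite sum of polynomials in the parameter with fixed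
    coefficients, and no derivative has to be exchanged with an integral. The rows c_a must be
    complex: real rows would see only the real part of the inverse Fisher matrix, whereas 2 r
    sqrt(det Gtilde) comes from its imaginary part. In the attainment, a first transverse instrument
    of width p ~ W n costs l1 W / 2 in its own noise and 2 l2 r^2 / W in disturbance of the second
    spin, whose square picks up part of the squared z spin, of order n^2. The minimum over W is 2 r
    sqrt(l1 l2), at W = 2 r sqrt(l2 / l1). The z instrument only needs p large, for damping close to
    1, and p / n small, for negligible noise. *)

Section TensorAlgebra.
Variable F : comNzRingType.

Lemma tensmxDl m n p q (A B : 'M[F]_(m, n)) (D : 'M[F]_(p, q)) :
  (A + B) *t D = A *t D + B *t D.
Proof. by apply/matrixP=> i j; rewrite !mxE mulrDl. Qed.

Lemma tensmxDr m n p q (A B : 'M[F]_(m, n)) (D : 'M[F]_(p, q)) :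
  D *t (A + B) = D *t A + D *t B.
Proof. by apply/matrixP=> i j; rewrite !mxE mulrDr. Qed.

Lemma tensmxZl m n p q a (A : 'M[F]_(m, n)) (D : 'M[F]_(p, q)) :
  (a *: A) *t D = a *: (A *t D).
Proof. by apply/matrixP=> i j; rewrite !mxE mulrA. Qed.

Lemma tensmxZr m n p q a (A : 'M[F]_(m, n)) (D : 'M[F]_(p, q)) :
  D *t (a *: A) = a *: (D *t A).
Proof. by apply/matrixP=> i j; rewrite !mxE mulrCA. Qed.

Lemma tensmxBl m n p q (A B : 'M[F]_(m, n)) (D : 'M[F]_(p, q)) :
  (A - B) *t D = A *t D - B *t D.
Proof. by apply/matrixP=> i j; rewrite !mxE mulrBl. Qed.

Lemma tensmxBr m n p q (A B : 'M[F]_(m, n)) (D : 'M[F]_(p, q)) :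
  D *t (A - B) = D *t A - D *t B.
Proof. by apply/matrixP=> i j; rewrite !mxE mulrBr. Qed.

Lemma tensmx11 m n : (1%:M : 'M[F]_m) *t (1%:M : 'M[F]_n) = 1%:M.
Proof.
apply/matrixP=> i j; case: (mxtens_indexP i) => i0 i1.
case: (mxtens_indexP j) => j0 j1; rewrite tensmxE !mxE -natrM mulnb.
by rewrite (can_eq (@mxtens_indexK m n)) xpair_eqE.
Qed.

Lemma mxtrace_tens m n (A : 'M[F]_m) (B : 'M[F]_n) : \tr (A *t B) = \tr A * \tr B.
Proof. by rewrite /mxtrace mulr_sum; apply: eq_bigr => i _; rewrite mxE. Qed.

Lemma ntensmxSr d (A : 'M[F]_d) k : A ^t k.+2 = A *t A ^t k.+1.
Proof. by []. Qed.

Lemma ntensmx_mul d (A B : 'M[F]_d) k : A ^t k *m B ^t k = (A *m B) ^t k.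
Proof.
case: k => [|k]; first by rewrite !ntensmx0 mul1mx.
elim: k => [//|k IH].
by rewrite !ntensmxSr tensmx_mul IH.
Qed.

Lemma ntensmx_id d k : (1%:M : 'M[F]_d) ^t k = 1%:M.
Proof.
case: k => [//|k]; elim: k => [//|k IH].
by rewrite !ntensmxSr IH tensmx11.
Qed.

Lemma mxtrace_ntens d (A : 'M[F]_d) k : \tr (A ^t k) = \tr A ^+ k.
Proof.
case: k => [|k]; first by rewrite ntensmx0 mxtrace1 expr0.
elim: k => [//|k IH].
by rewrite ntensmxSr mxtrace_tens IH -exprS.
Qed.

(** The collective operator: the sum over the factors of [A] on that factor and the identity
    elsewhere. The index counts factors minus one, so that the base case is [A] itself and
    dimensions match those of [A ^t k.+1] by conversion. *)
Fixpoint tsum d (A : 'M[F]_d) k : 'M[F]_(d ^ k.+1) :=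
  if k is k'.+1 then A *t 1%:M + 1%:M *t tsum A k' else A.

Lemma tsumS d (A : 'M[F]_d) k : tsum A k.+1 = A *t 1%:M + 1%:M *t tsum A k.
Proof. by []. Qed.

Lemma tsumD d (A B : 'M[F]_d) k : tsum (A + B) k = tsum A k + tsum B k.
Proof.
elim: k => [//|k IH]; rewrite !tsumS IH tensmxDl tensmxDr.
by rewrite -!addrA; congr (_ + _); rewrite addrCA.
Qed.

Lemma tsumZ d a (A : 'M[F]_d) k : tsum (a *: A) k = a *: tsum A k.
Proof.
by elim: k => [//|k IH]; rewrite !tsumS IH tensmxZl tensmxZr scalerDr.
Qed.

(** Operators on distinct factors commute, so only commutators within one factor survive. This
    carries the su(2) relations of the qubit to the collective spins. *)
Lemma tsum_comm d (A B : 'M[F]_d) k :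
  tsum A k *m tsum B k - tsum B k *m tsum A k = tsum (A *m B - B *m A) k.
Proof.
elim: k => [//|k IH]; rewrite !tsumS !mulmxDl !mulmxDr !tensmx_mul.
rewrite !mul1mx !mulmx1 -IH tensmxBl tensmxBr.
set a := _ *t 1%:M; set b := A *t tsum B k; set c := B *t tsum A k.
set e := 1%:M *t _; set f := _ *t 1%:M; set g := 1%:M *t _.
apply/matrixP=> i j; rewrite !mxE.
by move: (a i j) (b i j) (c i j) (e i j) (f i j) (g i j) => *; ring.
Qed.

Lemma tsum_conj d (U A V : 'M[F]_d) k : U *m V = 1%:M ->
  tsum (U *m A *m V) k = U ^t k.+1 *m tsum A k *m V ^t k.+1.
Proof.
move=> UV; elim: k => [//|k IH]; rewrite !tsumS IH !ntensmxSr mulmxDr mulmxDl.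
rewrite !tensmx_mul !mulmx1 UV.
have e := ntensmx_mul U V k.+1; rewrite UV ntensmx_id in e.
by congr (_ *t _ + _); exact: esym e.
Qed.

Lemma tr_tens_add m n (V : 'M[F]_m) (W : 'M[F]_n) A B : \tr V = 1 -> \tr W = 1 ->
  \tr (V *t W *m (A *t 1%:M + 1%:M *t B)) = \tr (V *m A) + \tr (W *m B).
Proof.
move=> trV trW; rewrite mulmxDr !tensmx_mul !mulmx1 mxtraceD !mxtrace_tens trV trW.
by rewrite mulr1 mul1r.
Qed.

Lemma tr_tens_add2 m n (V : 'M[F]_m) (W : 'M[F]_n) A B A' B' :
  \tr V = 1 -> \tr W = 1 ->
  \tr (V *t W *m ((A *t 1%:M + 1%:M *t B) *m (A' *t 1%:M + 1%:M *t B'))) =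
  \tr (V *m (A *m A')) + \tr (W *m (B *m B')) +
  (\tr (V *m A) * \tr (W *m B') + \tr (V *m A') * \tr (W *m B)).
Proof.
move=> trV trW; rewrite mulmxDl !mulmxDr !tensmx_mul !mulmx1 !mul1mx !mxtraceD.
rewrite !mxtrace_tens trV trW mulr1 mul1r.
by ring.
Qed.

Section Moments.
Variables (d : nat) (W : 'M[F]_d).
Hypothesis trW : \tr W = 1.

Let trWk k : \tr (W ^t k) = 1.
Proof. by rewrite mxtrace_ntens trW expr1n. Qed.

Lemma tr_tsum A k : \tr (W ^t k.+1 *m tsum A k) = k.+1%:R * \tr (W *m A).
Proof.
elim: k => [|k IH]; first by rewrite mul1r.
rewrite tsumS ntensmxSr (tr_tens_add A (tsum A k) trW (trWk k.+1)).
by rewrite IH [in RHS]mulrS mulrDl mul1r.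
Qed.

(** The [k.+1] pairs of equal factors give the moment of [A *m B]; the [k.+1 * k] ordered pairs of
    distinct factors split into products, the state being a product. *)
Lemma tr_tsum2 A B k : \tr (W ^t k.+1 *m (tsum A k *m tsum B k)) =
  k.+1%:R * \tr (W *m (A *m B)) + (k.+1 * k)%:R * (\tr (W *m A) * \tr (W *m B)).
Proof.
elim: k => [|k IH]; first by rewrite mul1r muln0 mul0r addr0.
rewrite !tsumS ntensmxSr.
rewrite (tr_tens_add2 A (tsum A k) B (tsum B k) trW (trWk k.+1)).
rewrite IH !tr_tsum.
set x := \tr (W *m A); set y := \tr (W *m B); set z := \tr _.
by rewrite !natrM -!natr1; ring.
Qed.

End Moments.

End TensorAlgebra.

(** * Adjoints and positivity of complex matrices *)

Section ComplexMatrices.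
Variable R : realType.
Local Notation C := R[i].

Lemma adjmxE m n (A : 'M[C]_(m, n)) i j : adjmx A i j = (A j i)^*.
Proof. by rewrite !mxE. Qed.

Lemma adjmxK m n (A : 'M[C]_(m, n)) : adjmx (adjmx A) = A.
Proof. by apply/matrixP=> i j; rewrite !adjmxE conjCK. Qed.

Lemma adjmxD m n (A B : 'M[C]_(m, n)) : adjmx (A + B) = adjmx A + adjmx B.
Proof. by apply/matrixP=> i j; rewrite !mxE rmorphD. Qed.

Lemma adjmxZ m n a (A : 'M[C]_(m, n)) : adjmx (a *: A) = a^* *: adjmx A.
Proof. by apply/matrixP=> i j; rewrite !mxE rmorphM. Qed.

Lemma adjmxN m n (A : 'M[C]_(m, n)) : adjmx (- A) = - adjmx A.
Proof. by apply/matrixP=> i j; rewrite !mxE rmorphN. Qed.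

Lemma adjmxB m n (A B : 'M[C]_(m, n)) : adjmx (A - B) = adjmx A - adjmx B.
Proof. by rewrite adjmxD adjmxN. Qed.

Lemma adjmxM m n p (A : 'M[C]_(m, n)) (B : 'M[C]_(n, p)) :
  adjmx (A *m B) = adjmx B *m adjmx A.
Proof. by rewrite /adjmx map_mxM trmx_mul. Qed.

Lemma adjmx1 n : adjmx (1%:M : 'M[C]_n) = 1%:M.
Proof. by rewrite /adjmx map_mx1 trmx1. Qed.

Lemma adjmx_sum m n (I : finType) (A : I -> 'M[C]_(m, n)) :
  adjmx (\sum_i A i) = \sum_i adjmx (A i).
Proof.
elim/big_ind2: _ => [|? ? ? ? <- <-|//]; last exact: adjmxD.
by apply/matrixP=> i j; rewrite !mxE rmorph0.
Qed.

Lemma adjmx_tens m n p q (A : 'M[C]_(m, n)) (B : 'M[C]_(p, q)) :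
  adjmx (A *t B) = adjmx A *t adjmx B.
Proof. by apply/matrixP=> i j; rewrite !mxE rmorphM. Qed.

Lemma adjmx_ntens d (A : 'M[C]_d) k : adjmx (A ^t k) = adjmx A ^t k.
Proof.
case: k => [|k]; first by rewrite !ntensmx0 adjmx1.
elim: k => [//|k IH].
by rewrite !ntensmxSr -IH -adjmx_tens.
Qed.

Lemma adjmx_tsum d (A : 'M[C]_d) k : adjmx (tsum A k) = tsum (adjmx A) k.
Proof.
elim: k => [//|k IH]; rewrite !tsumS -IH -[in RHS](adjmx1 d) -[in RHS](adjmx1 (d ^ k.+1)).
by rewrite -!adjmx_tens -adjmxD.
Qed.

Lemma ReD (x y : C) : complex.Re (x + y) = complex.Re x + complex.Re y.
Proof. by case: x y => [a b] []. Qed.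

Lemma ImD (x y : C) : complex.Im (x + y) = complex.Im x + complex.Im y.
Proof. by case: x y => [a b] []. Qed.

Lemma ReN (x : C) : complex.Re (- x) = - complex.Re x.
Proof. by case: x. Qed.

Lemma ReM' (x y : C) :
  complex.Re (x * y) = complex.Re x * complex.Re y - complex.Im x * complex.Im y.
Proof. by case: x y => [a b] []. Qed.

Lemma ImM' (x y : C) :
  complex.Im (x * y) = complex.Re x * complex.Im y + complex.Im x * complex.Re y.
Proof. by case: x y => [a b] []. Qed.

Lemma ReJ (x : C) : complex.Re x^* = complex.Re x.
Proof. by case: x. Qed.

Lemma ImJ (x : C) : complex.Im x^* = - complex.Im x.
Proof. by case: x. Qed.

Lemma Re_sum (I : Type) (s : seq I) (P : pred I) (f : I -> C) :
  complex.Re (\sum_(i <- s | P i) f i) = \sum_(i <- s | P i) complex.Re (f i).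
Proof. by apply: (big_morph _ ReD). Qed.

Lemma ge0C (x : C) : 0 <= x -> (0 <= complex.Re x) * (complex.Im x = 0).
Proof. by rewrite lecE => /andP[/eqP h1 h2]. Qed.

Lemma mulJ_ge0 (x : C) : 0 <= x^* * x.
Proof. by rewrite mulrC; exact: mulcJ_ge0. Qed.

Lemma addmxE m n (A B : 'M[C]_(m, n)) i j : (A + B) i j = A i j + B i j.
Proof. exact: mxE. Qed.

Lemma scalemxE m n a (A : 'M[C]_(m, n)) i j : (a *: A) i j = a * A i j.
Proof. exact: mxE. Qed.

Lemma psdC_mul_adj m n (B : 'M[C]_(m, n)) : psdC (B *m adjmx B).
Proof.
split=> [|v]; first by rewrite adjmxM adjmxK.
rewrite mulmxA -(mulmxA _ (adjmx B)) -[adjmx v *m B]adjmxK adjmxM adjmxK mxE.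
apply: sumr_ge0 => i _; rewrite adjmxE; exact: mulJ_ge0.
Qed.

Lemma psdC_conj m n (A : 'M[C]_m) (B : 'M[C]_(m, n)) :
  psdC A -> psdC (adjmx B *m A *m B).
Proof.
move=> [Ah Ap]; split=> [|v]; first by rewrite !adjmxM adjmxK Ah mulmxA.
by have := Ap (B *m v); rewrite adjmxM !mulmxA.
Qed.

Lemma adjmx_delta m n (i : 'I_m) (j : 'I_n) :
  adjmx (delta_mx i j : 'M[C]_(m, n)) = delta_mx j i.
Proof.
apply/matrixP=> k l; rewrite adjmxE !mxE [(l == i) && _]andbC.
by rewrite rmorph_nat.
Qed.

Lemma delta_form d (A : 'M[C]_d) (i j : 'I_d) :
  (adjmx (delta_mx i 0 : 'cV[C]_d) *m A *m (delta_mx j 0 : 'cV[C]_d)) 0 0 = A i j.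
Proof. by rewrite adjmx_delta -rowE -colE !mxE. Qed.

Lemma psdC_diag_ge0 d (A : 'M[C]_d) i : psdC A -> 0 <= A i i.
Proof. by move=> [_ /(_ (delta_mx i 0))]; rewrite delta_form. Qed.

Lemma psdC_trace_ge0 d (A : 'M[C]_d) : psdC A -> 0 <= \tr A.
Proof. by move=> Ap; apply: sumr_ge0 => i _; exact: psdC_diag_ge0. Qed.

Lemma trace_psdC_ge0 m n (A : 'M[C]_m) (B : 'M[C]_(m, n)) :
  psdC A -> 0 <= \tr (A *m (B *m adjmx B)).
Proof.
by move=> Ap; rewrite mulmxA mxtrace_mulC mulmxA; apply/psdC_trace_ge0/psdC_conj.
Qed.

(** This is what lets every single entry of a POVM be dominated by a scalar measure, the trace. *)
Lemma psdC_ReIm_le d (A : 'M[C]_d) i j : psdC A ->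
  `|complex.Re (A i j)| <= complex.Re (\tr A) /\
  `|complex.Im (A i j)| <= complex.Re (\tr A).
Proof.
move=> Ap; have [Ah Aq] := Ap.
have Ed k : 0 <= complex.Re (A k k) by case: (ge0C (psdC_diag_ge0 k Ap)).
have tr1 k : complex.Re (A k k) <= complex.Re (\tr A).
  rewrite /mxtrace Re_sum (bigD1 k) //= lerDl; exact: sumr_ge0.
have [->|ij] := eqVneq i j.
  rewrite (ge0C (psdC_diag_ge0 j Ap)) normr0 ger0_norm //; split=> //.
  exact: le_trans (Ed j) (tr1 j).
have tr2 : complex.Re (A i i) + complex.Re (A j j) <= complex.Re (\tr A).
  rewrite /mxtrace Re_sum (bigD1 i) //= lerD2l (bigD1 j) 1?eq_sym //= lerDl.
  exact: sumr_ge0.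
have Aji : A j i = (A i j)^* by rewrite -{1}Ah adjmxE.
(* The form at e_i + z e_j; with [z] equal to 1, -1, i, -i it bounds the real and the imaginary part
   from both sides by half the sum of the two diagonal entries. *)
have key (z : C) : z * z^* = 1 ->
    0 <= complex.Re (A i i) + complex.Re (A j j) + 2 * complex.Re (z * A i j).
  move=> zz; have := Aq (delta_mx i 0 + z *: delta_mx j 0).
  rewrite adjmxD adjmxZ mulmxDl !mulmxDr !mulmxDl -!scalemxAl -!scalemxAr.
  rewrite !addmxE !scalemxE !delta_form => /ge0C[+ _].
  rewrite Aji mulrA [z^* * z]mulrC zz mul1r !ReD.
  rewrite -rmorphM ReJ => h; lra.
have i1 : 'i%C * ('i%C)^* = 1 :> C by apply/eqP; rewrite eq_complex /=; apply/andP; split; apply/eqP; ring.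
have i2 : (- 'i%C) * (- 'i%C)^* = 1 :> C by rewrite rmorphN mulrNN.
have i3 : 1 * 1^* = 1 :> C by rewrite rmorph1 mulr1.
have i4 : (- 1) * (- 1)^* = 1 :> C by rewrite rmorphN mulrNN rmorph1 mulr1.
have h1 := key _ i1; have h2 := key _ i2; have h3 := key _ i3; have h4 := key _ i4.
move: h1 h2 h3 h4; rewrite !mulNr !mul1r !ReN !ReM' /= !mul0r !mul1r !sub0r => h1 h2 h3 h4.
by split; rewrite ler_norml; apply/andP; split; lra.
Qed.

End ComplexMatrices.

(** * Square roots of real positive semidefinite matrices *)

Section RealMatrices.
Variable R : realType.
Local Notation C := R[i].
Local Notation rc := (real_complex R).

Lemma poly_interp (F : fieldType) (s : seq F) (f : F -> F) :
  exists p : {poly F}, forall x, x \in s -> p.[x] = f x.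
Proof.
elim: s => [|y s [p hp]]; first by exists 0.
have [ys|ys] := boolP (y \in s).
  by exists p => x; rewrite inE => /orP[/eqP->|]; exact: hp.
pose q := \prod_(z <- s) ('X - z%:P).
have qy : q.[y] != 0 by rewrite -rootE root_prod_XsubC.
exists (p + ((f y - p.[y]) / q.[y]) *: q) => x.
rewrite inE hornerD hornerZ => /orP[/eqP->|xs]; first by rewrite mulfVK // addrC subrK.
have /rootP -> : root q x by rewrite root_prod_XsubC.
by rewrite mulr0 addr0 hp.
Qed.

Lemma raddmxE m n (A B : 'M[R]_(m, n)) i j : (A + B) i j = A i j + B i j.
Proof. exact: mxE. Qed.

Lemma trace_sqr_eq0 d (A : 'M[R]_d) : \tr (A^T *m A) = 0 -> A = 0.
Proof.
move=> trA; have : \sum_i \sum_j A j i ^+ 2 = 0.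
  rewrite -[RHS]trA /mxtrace; apply: eq_bigr => i _; rewrite mxE; apply: eq_bigr => j _.
  by rewrite mxE expr2.
move/eqP; rewrite psumr_eq0 => [/allP h|i _]; last by apply: sumr_ge0 => j _; exact: sqr_ge0.
apply/matrixP=> i j; rewrite mxE; have := h j (mem_index_enum _) => /=.
rewrite psumr_eq0 => [/allP /(_ i (mem_index_enum _)) /=|k _]; last exact: sqr_ge0.
by rewrite sqrf_eq0 => /eqP.
Qed.

Lemma sym_form_eq0 d (A : 'M[R]_d) : A^T = A ->
  (forall v : 'rV[R]_d, (v *m A *m v^T) 0 0 = 0) -> A = 0.
Proof.
move=> As h.
have e (i j : 'I_d) : ((delta_mx 0 i : 'rV[R]_d) *m A *m (delta_mx 0 j : 'rV[R]_d)^T) 0 0 = A i j.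
  by rewrite trmx_delta -rowE -colE !mxE.
apply/matrixP=> i j; rewrite mxE.
have := h (delta_mx 0 i + delta_mx 0 j).
rewrite linearD /= !mulmxDl !mulmxDr !raddmxE !e.
have := h (delta_mx 0 i); rewrite e => ->; have := h (delta_mx 0 j); rewrite e => ->.
have -> : A j i = A i j by rewrite -{1}As mxE.
lra.
Qed.

(** With D = A - B, commutation gives D (A + B) = 0, so the two positive forms D A D and D B D add
    up to zero and both vanish. Their difference is D^3, and a symmetric D with D^3 = 0 is zero. *)
Lemma psd_sqrt_uniq d (A B : 'M[R]_d) : psdR A -> psdR B -> A *m B = B *m A ->
  A *m A = B *m B -> A = B.
Proof.
move=> [As Ap] [Bs Bp] AB AA.
pose D := A - B; have Ds : D^T = D by rewrite /D linearB /= As Bs.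
have h0 : D *m A *m D + D *m B *m D = 0.
  rewrite -mulmxDl -mulmxDr /D mulmxDr !mulmxBl AA AB.
  by rewrite addrC addrA subrK subrr mul0mx.
have form M : psdR M -> forall v : 'rV[R]_d, 0 <= (v *m (D *m M *m D) *m v^T) 0 0.
  move=> [_ Mp] v; have := Mp (v *m D); rewrite trmx_mul Ds.
  by rewrite !mulmxA.
have sum0 (v : 'rV[R]_d) : (v *m (D *m A *m D) *m v^T) 0 0 + (v *m (D *m B *m D) *m v^T) 0 0 = 0 :> R.
  by rewrite -raddmxE -mulmxDl -mulmxDr h0 mulmx0 mul0mx mxE.
have DAD : D *m A *m D = 0.
  apply: sym_form_eq0; first by rewrite !trmx_mul Ds As mulmxA.
  move=> v; have := sum0 v; have := form _ (conj As Ap) v; have := form _ (conj Bs Bp) v; lra.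
have DBD : D *m B *m D = 0 by move: h0; rewrite DAD add0r.
have D3 : D *m D *m D = 0.
  have -> : D *m D *m D = D *m A *m D - D *m B *m D by rewrite -mulmxBl -mulmxBr.
  by rewrite DAD DBD subrr.
have D2 : D *m D = 0.
  by apply: trace_sqr_eq0; rewrite trmx_mul Ds !mulmxA D3 mul0mx mxtrace0.
apply/eqP; rewrite -subr_eq0; apply/eqP.
by apply: trace_sqr_eq0; rewrite Ds D2 mxtrace0.
Qed.

Lemma adjmx_map m n (A : 'M[R]_(m, n)) :
  adjmx (map_mx (real_complex R) A) = map_mx (real_complex R) A^T.
Proof. by apply/matrixP=> i j; rewrite !mxE; exact: conjc_real. Qed.

Lemma form_map d (A : 'M[R]_d) (v : 'rV[R]_d) :
  (adjmx (map_mx (real_complex R) v^T) *m map_mx (real_complex R) A *m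
    map_mx (real_complex R) v^T) 0 0 = ((v *m A *m v^T) 0 0)%:C%C.
Proof. by rewrite adjmx_map trmxK -!map_mxM mxE. Qed.

Lemma mapE m n (A : 'M[R]_(m, n)) i j : map_mx (real_complex R) A i j = (A i j)%:C%C.
Proof. exact: mxE. Qed.

(** At v = a + i b the cross terms cancel by symmetry of [A], leaving the real forms at [a] and
    [b]. *)
Lemma psdC_map d (A : 'M[R]_d) : psdR A <-> psdC (map_mx (real_complex R) A).
Proof.
split=> [[As Ap]|[As Ap]]; split.
- by rewrite adjmx_map As.
- move=> v; have [a [b ->]] : exists a b : 'rV[R]_d,
    v = map_mx (real_complex R) a^T + 'i%C *: map_mx (real_complex R) b^T.
    exists (map_mx (@complex.Re R) v)^T, (map_mx (@complex.Im R) v)^T.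
    by apply/matrixP=> i j; rewrite !mxE -complexE.
  rewrite adjmxD adjmxZ mulmxDl !mulmxDr !mulmxDl -!scalemxAl -!scalemxAr !addmxE !scalemxE.
  rewrite !form_map !adjmx_map !trmxK -!map_mxM !mapE.
  have -> : (b *m A *m a^T) 0 0 = (a *m A *m b^T) 0 0.
    have -> : b *m A *m a^T = (a *m A *m b^T)^T by rewrite !trmx_mul trmxK As mulmxA.
    by rewrite mxE.
  move: (Ap a) (Ap b); set x := (a *m A *m a^T) 0 0; set y := (b *m A *m b^T) 0 0.
  set z := (a *m A *m b^T) 0 0 => x0 y0.
  rewrite lecE /=; apply/andP; split; last by lra.
  by apply/eqP; ring.
- apply/matrixP=> i j; have := congr1 (fun M : 'M[C]_d => M i j) As.
  by rewrite adjmx_map !mxE => /(@complexI R).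
- by move=> v; have := Ap (map_mx (real_complex R) v^T); rewrite form_map ler0c.
Qed.

(** The spectral theorem is applied over the complex numbers, but the root must be real.
    Interpolating the square root on the eigenvalues by a real polynomial [p] makes it
    [horner_mx A p], which is real by construction. *)
Lemma psd_sqrt_exists d (A : 'M[R]_d.+1) : psdR A ->
  exists B : 'M[R]_d.+1, psdR B /\ B *m B = A.
Proof.
move=> Ap; have As := Ap.1.
pose AC := map_mx rc A; have ACp : psdC AC by apply/psdC_map.
have ACn : AC \is normalmx.
  by apply/normalmxP; rewrite -map_trmx -/(adjmx AC) ACp.1.
have /orthomx_spectralP eA := ACn.
set P := spectralmx AC in eA; set D := spectral_diag AC in eA.
have Pu : P \is unitarymx := spectral_unitarymx AC.
have Punit := spectral_unit AC; rewrite -/P in Punit.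
have iP : invmx P = adjmx P by rewrite invmx_unitary // -map_trmx.
have D0 i : 0 <= D 0 i.
  have -> : D 0 i = (adjmx (adjmx P) *m AC *m adjmx P) i i.
    rewrite adjmxK eA -iP -!mulmxA mulmxV // mulmx1 mulKVmx //.
    by rewrite !mxE eqxx mulr1n.
  exact/psdC_diag_ge0/psdC_conj.
have [p hp] := poly_interp [seq complex.Re (D 0 i) | i <- enum 'I_d.+1] (@Num.sqrt R).
have hp' i : p.[complex.Re (D 0 i)] = Num.sqrt (complex.Re (D 0 i)).
  by apply: hp; apply/mapP; exists i; rewrite ?mem_enum.
pose B := horner_mx A p.
have DE i : D 0 i = (complex.Re (D 0 i))%:C%C.
  by rewrite RRe_real // ger0_real.
have ACE : map_mx rc A = AC by [].
clearbody P D AC.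
have hor q : map_mx rc (horner_mx A q) =
    adjmx P *m diag_mx (\row_i (q.[complex.Re (D 0 i)])%:C%C) *m P.
  rewrite map_horner_mx ACE eA.
  have uc : horner_mx (invmx P *m diag_mx D *m P) (map_poly rc q) =
      invmx P *m horner_mx (diag_mx D) (map_poly rc q) *m P by exact: horner_mx_uconjC.
  have hd := horner_mx_diag D (map_poly rc q).
  rewrite uc hd iP.
  congr (_ *m diag_mx _ *m _); apply/rowP=> i; rewrite !mxE [in LHS]DE.
  by rewrite horner_map.
have dE : \row_i ((p * p).[complex.Re (D 0 i)])%:C%C = D.
  by apply/rowP=> i; rewrite mxE hornerM hp' -expr2 sqr_sqrtr ?(ge0C (D0 i)) // -DE.
have rcI : injective (map_mx rc : 'M[R]_d.+1 -> _).
  by move=> X Y /matrixP h; apply/matrixP=> i j; have := h i j; rewrite !mxE => /(@complexI R).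
exists B; split; first apply/psdC_map.
  rewrite hor.
  pose E := adjmx P *m diag_mx (\row_i (Num.sqrt (p.[complex.Re (D 0 i)]))%:C%C).
  suff -> : adjmx P *m diag_mx (\row_i (p.[complex.Re (D 0 i)])%:C%C) *m P = E *m adjmx E.
    exact: psdC_mul_adj.
  rewrite /E adjmxM adjmxK -!mulmxA; congr (_ *m _); rewrite mulmxA; congr (_ *m _).
  rewrite /adjmx map_diag_mx tr_diag_mx mulmx_diag; congr diag_mx.
  apply/rowP=> i; rewrite !mxE [X in _ * X]conjc_real -rmorphM /=; congr (_%:C)%C.
  by rewrite -expr2 sqr_sqrtr // hp' sqrtr_ge0.
apply: rcI; rewrite -[B *m B]/(B * B) -rmorphM.
rewrite hor.
by rewrite dE ACE eA iP.
Qed.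

Lemma msqrtP d (A : 'M[R]_d.+1) : psdR A -> psdR (msqrt A) /\ msqrt A *m msqrt A = A.
Proof.
move=> /psd_sqrt_exists h; rewrite /msqrt; case: pselect => // h'.
exact: (projT2 (cid h')).
Qed.

End RealMatrices.

(** * The RLD bound of the qubit model *)

Section SmallMatrices.
Variable F : comNzRingType.

Definition mx2 (a b c d : F) : 'M[F]_2 :=
  \matrix_(i, j) if i == 0 :> nat then (if j == 0 :> nat then a else b)
                 else if j == 0 :> nat then c else d.

Lemma ord2P (P : 'I_2 -> Prop) : P (Ordinal (isT : 0 < 2)%N) -> P (Ordinal (isT : 1 < 2)%N) ->
  forall i, P i.
Proof.
move=> h0 h1 [[|[|//]] h].
  by have -> : Ordinal h = Ordinal (isT : 0 < 2)%N by apply: val_inj.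
by have -> : Ordinal h = Ordinal (isT : 1 < 2)%N by apply: val_inj.
Qed.

Lemma sum2E (V : nmodType) (f : 'I_2 -> V) :
  \sum_i f i = f (Ordinal (isT : 0 < 2)%N) + f (Ordinal (isT : 1 < 2)%N).
Proof.
by rewrite !big_ord_recl big_ord0 addr0; congr (f _ + f _); apply: val_inj.
Qed.

Lemma mx2_mul a b c d a' b' c' d' : mx2 a b c d *m mx2 a' b' c' d' =
  mx2 (a * a' + b * c') (a * b' + b * d') (c * a' + d * c') (c * b' + d * d').
Proof. by apply/matrixP; do 2!elim/ord2P; rewrite !mxE sum2E !mxE. Qed.

Lemma mx2_add a b c d a' b' c' d' : mx2 a b c d + mx2 a' b' c' d' =
  mx2 (a + a') (b + b') (c + c') (d + d').
Proof. by apply/matrixP; do 2!elim/ord2P; rewrite !mxE. Qed.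

Lemma mx2_scale x a b c d : x *: mx2 a b c d = mx2 (x * a) (x * b) (x * c) (x * d).
Proof. by apply/matrixP; do 2!elim/ord2P; rewrite !mxE. Qed.

Lemma mx2_opp a b c d : - mx2 a b c d = mx2 (- a) (- b) (- c) (- d).
Proof. by apply/matrixP; do 2!elim/ord2P; rewrite !mxE. Qed.

Lemma mx2_1 : 1%:M = mx2 1 0 0 1.
Proof. by apply/matrixP; do 2!elim/ord2P; rewrite !mxE. Qed.

Lemma mx2_0 : 0 = mx2 0 0 0 0.
Proof. by apply/matrixP; do 2!elim/ord2P; rewrite !mxE. Qed.

Lemma mx2_tr a b c d : \tr (mx2 a b c d) = a + d.
Proof. by rewrite /mxtrace sum2E !mxE. Qed.

Definition mx3 (a b c d e f g h k : F) : 'M[F]_3 :=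
  \matrix_(i, j) nth 0 (nth [::] [:: [:: a; b; c]; [:: d; e; f]; [:: g; h; k]] i) j.

Lemma ord3P (P : 'I_3 -> Prop) : P (Ordinal (isT : 0 < 3)%N) ->
  P (Ordinal (isT : 1 < 3)%N) -> P (Ordinal (isT : 2 < 3)%N) -> forall i, P i.
Proof.
move=> h0 h1 h2 [[|[|[|//]]] h].
- by have -> : Ordinal h = Ordinal (isT : 0 < 3)%N by apply: val_inj.
- by have -> : Ordinal h = Ordinal (isT : 1 < 3)%N by apply: val_inj.
- by have -> : Ordinal h = Ordinal (isT : 2 < 3)%N by apply: val_inj.
Qed.

Lemma sum3E (V : nmodType) (f : 'I_3 -> V) : \sum_i f i =
  f (Ordinal (isT : 0 < 3)%N) + f (Ordinal (isT : 1 < 3)%N) + f (Ordinal (isT : 2 < 3)%N).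
Proof.
rewrite !big_ord_recl big_ord0 addr0 addrA.
by congr (f _ + f _ + f _); apply: val_inj.
Qed.

Lemma mx3_mul a b c d e f g h k a' b' c' d' e' f' g' h' k' :
  mx3 a b c d e f g h k *m mx3 a' b' c' d' e' f' g' h' k' =
  mx3 (a * a' + b * d' + c * g') (a * b' + b * e' + c * h') (a * c' + b * f' + c * k')
      (d * a' + e * d' + f * g') (d * b' + e * e' + f * h') (d * c' + e * f' + f * k')
      (g * a' + h * d' + k * g') (g * b' + h * e' + k * h') (g * c' + h * f' + k * k').
Proof. by apply/matrixP; do 2!elim/ord3P; rewrite !mxE sum3E !mxE. Qed.

Lemma mx3_1 : 1%:M = mx3 1 0 0 0 1 0 0 0 1.
Proof. by apply/matrixP; do 2!elim/ord3P; rewrite !mxE. Qed.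

Lemma mx3_scale x a b c d e f g h k :
  x *: mx3 a b c d e f g h k =
  mx3 (x * a) (x * b) (x * c) (x * d) (x * e) (x * f) (x * g) (x * h) (x * k).
Proof. by apply/matrixP; do 2!elim/ord3P; rewrite !mxE. Qed.

Lemma mx3_trmx a b c d e f g h k : (mx3 a b c d e f g h k)^T = mx3 a d g b e h c f k.
Proof. by apply/matrixP; do 2!elim/ord3P; rewrite !mxE. Qed.

Lemma mx3_tr a b c d e f g h k : \tr (mx3 a b c d e f g h k) = a + e + k.
Proof. by rewrite /mxtrace sum3E !mxE. Qed.

Lemma mx3E (A : 'M[F]_3) (o0 := Ordinal (isT : 0 < 3)%N) (o1 := Ordinal (isT : 1 < 3)%N)
  (o2 := Ordinal (isT : 2 < 3)%N) :
  A = mx3 (A o0 o0) (A o0 o1) (A o0 o2) (A o1 o0) (A o1 o1) (A o1 o2)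
          (A o2 o0) (A o2 o1) (A o2 o2).
Proof. by apply/matrixP; do 2!elim/ord3P; rewrite !mxE. Qed.

End SmallMatrices.

Section QubitRLD.
Variable R : realType.
Local Notation C := R[i].
Local Notation o0 := (Ordinal (isT : 0 < 3)%N).
Local Notation o1 := (Ordinal (isT : 1 < 3)%N).
Local Notation o2 := (Ordinal (isT : 2 < 3)%N).
Local Notation "x +i* y" := (Complex x y) : ring_scope.

Lemma mx2_adj (a b c d : C) : adjmx (mx2 a b c d) = mx2 a^* c^* b^* d^*.
Proof. by apply/matrixP; do 2!elim/ord2P; rewrite !mxE. Qed.

Lemma sigma_o0 : sigma R o0 = mx2 0 (2^-1 +i* 0) (2^-1 +i* 0) 0.
Proof. by apply/matrixP; do 2!elim/ord2P; rewrite !mxE. Qed.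

Lemma sigma_o1 : sigma R o1 = mx2 0 (0 +i* - 2^-1) (0 +i* 2^-1) 0.
Proof. by apply/matrixP; do 2!elim/ord2P; rewrite !mxE. Qed.

Lemma sigma_o2 : sigma R o2 = mx2 (2^-1 +i* 0) 0 0 (- 2^-1 +i* 0).
Proof. by apply/matrixP; do 2!elim/ord2P; rewrite !mxE. Qed.

Lemma rhoE (th : 'rV[R]_3) : rho th = mx2 (((1 + th 0 o2) / 2) +i* 0)
  ((th 0 o0 / 2) +i* (- (th 0 o1 / 2))) ((th 0 o0 / 2) +i* (th 0 o1 / 2))
  (((1 - th 0 o2) / 2) +i* 0).
Proof.
rewrite /rho sum3E sigma_o0 sigma_o1 sigma_o2 mx2_1 !mx2_scale !mx2_add.
by congr mx2; apply/eqP; rewrite eq_complex /=; apply/andP; split; apply/eqP; lra.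
Qed.

Lemma rho_rE (r : R) : rho (theta_r r) = mx2 (((1 + r) / 2) +i* 0) 0 0 (((1 - r) / 2) +i* 0).
Proof.
rewrite rhoE !mxE /=; congr mx2;
  by apply/eqP; rewrite eq_complex /=; apply/andP; split; apply/eqP; lra.
Qed.

Lemma invmx_eq (F : comUnitRingType) n (A B : 'M[F]_n) : A *m B = 1%:M -> invmx A = B.
Proof.
move=> AB; have [Au Bu] := mulmx1_unit AB.
by rewrite -[LHS]mulmx1 -AB mulKmx.
Qed.

Variable r : R.
Hypothesis r01 : 0 <= r < 1.

Let r1 : 1 - r != 0. Proof. by case/andP: r01 => ? ?; rewrite gt_eqF // subr_gt0. Qed.
Let r2 : 1 + r != 0. Proof. by case/andP: r01 => ? ?; rewrite gt_eqF // ltr_pwDl. Qed.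
Let r3 : 1 - r ^+ 2 != 0.
Proof. by case/andP: r01 => r0 r1'; rewrite gt_eqF // subr_gt0 expr_lt1. Qed.

Definition rho_inv : 'M[C]_2 := mx2 ((2 / (1 + r)) +i* 0) 0 0 ((2 / (1 - r)) +i* 0).

Lemma rho_mul_inv : rho (theta_r r) *m rho_inv = 1%:M.
Proof.
rewrite rho_rE mx2_mul mx2_1; congr mx2;
  apply/eqP; rewrite eq_complex /=; apply/andP; split; apply/eqP; try ring.
  by field.
by field.
Qed.

Lemma invmx_rho : invmx (rho (theta_r r)) = rho_inv.
Proof. exact: invmx_eq rho_mul_inv. Qed.

Lemma JtildeE : Jtilde (theta_r r) =
  mx3 ((1 - r ^+ 2)^-1 +i* 0) (0 +i* (r / (1 - r ^+ 2))) 0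
      (0 +i* - (r / (1 - r ^+ 2))) ((1 - r ^+ 2)^-1 +i* 0) 0
      0 0 ((1 - r ^+ 2)^-1 +i* 0).
Proof.
have e k : rho (theta_r r) *m Ltilde (theta_r r) k = sigma R k.
  by rewrite /Ltilde mulmxA invmx_rho rho_mul_inv mul1mx.
apply/matrixP=> j k; rewrite [LHS]mxE e /Ltilde invmx_rho.
elim/ord3P: j; elim/ord3P: k; rewrite [RHS]mxE /drho ?sigma_o0 ?sigma_o1 ?sigma_o2 /rho_inv mx2_mul
  mx2_adj mx2_mul mx2_tr /=;
  apply/eqP; rewrite eq_complex /=; apply/andP; split; apply/eqP; by field; rewrite ?r1 ?r2 ?r3.
Qed.

Definition Jinv : 'M[C]_3 :=
  mx3 1 (0 +i* - r) 0 (0 +i* r) 1 0 0 0 ((1 - r ^+ 2) +i* 0).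

Lemma Jtilde_inv : invmx (Jtilde (theta_r r)) = Jinv.
Proof.
apply: invmx_eq; rewrite JtildeE /Jinv mx3_mul mx3_1; congr mx3;
  apply/eqP; rewrite eq_complex /=; apply/andP; split; apply/eqP; try ring; by field.
Qed.

(** A real antisymmetric 3 x 3 matrix has eigenvalues 0 and plus or minus i nu. Hence Q = X^T X
    satisfies Q^2 = nu^2 Q, and Q / nu is its positive root; the trace of Q is 2 nu^2. *)
Lemma trace_absmx_antisym (X : 'M[R]_3) : X^T = - X ->
  \tr (absmx X) = 2 * Num.sqrt (\tr (X^T *m X) / 2).
Proof.
move=> Xa.
have Xij i j : X i j = - X j i by have := congr1 (fun M : 'M[R]_3 => M j i) Xa; rewrite !mxE.
have Xii i : X i i = 0 by have := Xij i i; lra.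
pose a := X o0 o1; pose b := X o0 o2; pose c := X o1 o2.
have XE : X = mx3 0 a b (- a) 0 c (- b) (- c) 0.
  by rewrite [LHS]mx3E !Xii -(Xij o1 o0) -(Xij o2 o0) -(Xij o2 o1).
pose Q := X^T *m X.
pose n2 := a ^+ 2 + b ^+ 2 + c ^+ 2.
have n2_ge0 : 0 <= n2 by rewrite /n2; nra.
have trQ : \tr Q = 2 * n2.
  by rewrite /Q XE mx3_trmx mx3_mul mx3_tr /n2; ring.
have QQ : Q *m Q = n2 *: Q.
  by rewrite /Q XE mx3_trmx !mx3_mul mx3_scale /n2; congr mx3; ring.
have Qpsd : psdR Q.
  split; first by rewrite /Q trmx_mul trmxK.
  move=> v; have -> : v *m Q *m v^T = (X *m v^T)^T *m (X *m v^T).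
    by rewrite /Q trmx_mul trmxK !mulmxA.
  rewrite mxE; apply: sumr_ge0 => i _; rewrite mxE -expr2; exact: sqr_ge0.
have [/= Bp BB] := msqrtP Qpsd; rewrite -/(absmx X) in Bp BB.
rewrite -/Q trQ; have -> : 2 * n2 / 2 = n2 by field.
have [n0|n0] := eqVneq n2 0.
  have B0 : absmx X = 0.
    apply: trace_sqr_eq0; rewrite Bp.1 BB -/Q trQ n0; ring.
  by rewrite n0 sqrtr0 mulr0 B0 mxtrace0.
have [s [sE s0 ss]] : exists s : R, [/\ Num.sqrt n2 = s, 0 < s & s ^+ 2 = n2].
  exists (Num.sqrt n2); split=> //; last exact: sqr_sqrtr.
  by rewrite sqrtr_gt0 lt_neqAle eq_sym n0.
have -> : absmx X = s^-1 *: Q.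
  apply: psd_sqrt_uniq => //.
  - split; first by rewrite linearZ /= Qpsd.1.
    move=> v; rewrite -scalemxAr -scalemxAl mxE.
    by apply: mulr_ge0; [rewrite invr_ge0 ltW | apply: Qpsd.2].
  - by rewrite -scalemxAr -scalemxAl -BB mulmxA.
  - rewrite -scalemxAr -scalemxAl QQ BB !scalerA -ss.
    rewrite -/Q -[LHS]scale1r; congr (_ *: Q); field; by rewrite gt_eqF.
rewrite mxtraceZ trQ sE -ss; field; by rewrite gt_eqF.
Qed.

(** The root of [G] never has to be known: it disappears from the first trace by cyclicity, and the
    second depends only on the trace of K^T G K G, where K is the antisymmetric imaginary part. *)
Lemma CR_boundE (G : 'M[R]_3) : posdefR G ->
  CR_bound (theta_r r) G =
  \tr G - r ^+ 2 * Gs G + 2 * r * Num.sqrt (\det (Gtilde G)).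
Proof.
move=> [Gsym Gpos].
have Gpsd : psdR G.
  split=> // v; have [->|v0] := eqVneq v 0; first by rewrite !mul0mx mxE.
  exact/ltW/Gpos.
have [/= Sp SS] := msqrtP Gpsd.
rewrite /CR_bound Jtilde_inv; set S := msqrt G in Sp SS *.
have ReJ : Defs.ReM Jinv = mx3 1 0 0 0 1 0 0 0 (1 - r ^+ 2).
  by apply/matrixP; do 2!elim/ord3P; rewrite !mxE.
have ImJ : Defs.ImM Jinv = mx3 0 (- r) 0 r 0 0 0 0 0.
  by apply/matrixP; do 2!elim/ord3P; rewrite !mxE.
have Gs01 : G o1 o0 = G o0 o1 by rewrite -[in LHS]Gsym mxE.
have detG : \det (Gtilde G) = G o0 o0 * G o1 o1 - G o0 o1 ^+ 2.
  rewrite (expand_det_row _ ord0) sum2E /cofactor !det_mx11 !mxE /=.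
  have w0 h : widen_ord h (Ordinal (isT : 0 < 2)%N) = o0 by apply: val_inj.
  have w1 h : widen_ord h (Ordinal (isT : 1 < 2)%N) = o1 by apply: val_inj.
  have -> : ord0 = Ordinal (isT : 0 < 2)%N by apply: val_inj.
  have l0 : lift (Ordinal (isT : 0 < 2)%N) 0 = Ordinal (isT : 1 < 2)%N by apply: val_inj.
  have l1 : lift (Ordinal (isT : 1 < 2)%N) 0 = Ordinal (isT : 0 < 2)%N by apply: val_inj.
  by rewrite l0 l1 !w0 !w1 Gs01 /=; ring.
have Gs2 : Gs G = G o2 o2 by rewrite /Gs; congr (G _ _); apply: val_inj.
have -> : \tr (S *m Defs.ReM Jinv *m S) = \tr G - r ^+ 2 * Gs G.
  rewrite mxtrace_mulC mulmxA SS ReJ Gs2 (mx3E G) mx3_mul !mx3_tr !mxE /=; ring.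
congr (_ + _).
set K := Defs.ImM Jinv; have KT : K^T = - K.
  by rewrite /K ImJ; apply/matrixP; do 2!elim/ord3P; rewrite !mxE ?oppr0 ?opprK.
rewrite trace_absmx_antisym; last by rewrite !trmx_mul Sp.1 KT mulmxA mulmxN mulNmx.
have -> : \tr ((S *m K *m S)^T *m (S *m K *m S)) = \tr (K^T *m G *m K *m G).
  have -> : (S *m K *m S)^T *m (S *m K *m S) = S *m (K^T *m G *m K *m S).
    by rewrite !trmx_mul Sp.1 -SS !mulmxA.
  by rewrite mxtrace_mulC -(mulmxA _ S S) SS.
(* [K] is [r] times the generator of rotations about the z axis, so only the transverse block of [G]
   enters. *)
have -> : \tr (K^T *m G *m K *m G) / 2 = r ^+ 2 * \det (Gtilde G).
  rewrite detG (mx3E G) KT /K ImJ mulNmx !mulNmx !mx3_mul linearN /= mx3_tr !mxE /= Gs01.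
  by field.
by rewrite sqrtrM ?sqr_ge0 // sqrtr_sqr ger0_norm ?mulrA //; case/andP: r01.
Qed.

End QubitRLD.

(** * Outcome laws and densities *)

Section SignedMeasures.
Context (d : measure_display) (T : measurableType d) (R : realType).

Definition sadd (f : set T -> R) := semi_sigma_additive (EFin \o f).

Lemma saddP f : sadd f <-> forall F : (set T)^nat, (forall i, measurable (F i)) ->
  trivIset setT F -> measurable (\bigcup_n F n) ->
  (fun n => \sum_(0 <= i < n) f (F i)) @ \oo --> f (\bigcup_n F n).
Proof.
split=> h F mF tF mUF; have := h F mF tF mUF.
  under eq_cvg => n do rewrite sumEFin.
  by move/fine_cvg.
move=> hF; rewrite /=; under eq_cvg => n do rewrite sumEFin.
by apply: cvg_EFin => //; near=> n.
Unshelve. all: by end_near. Qed.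

(** For a sequence of empty sets the partial sums n f(set0) converge, so their constant increment
    tends to zero. *)
Lemma sadd_set0 f : sadd f -> f set0 = 0.
Proof.
move=> /saddP/(_ (fun=> set0)); rewrite bigcup0 // => h.
have {}h := h (fun=> measurable0) (@trivIset_set0 _ _ _) measurable0.
have h1 : (fun n => \sum_(0 <= i < n.+1) f set0) @ \oo --> f set0.
  by have := h; rewrite -(cvg_shiftS _).
have h2 : (fun _ : nat => f set0) @ \oo --> f set0 - f set0.
  apply: cvg_trans (cvgB h1 h); apply: near_eq_cvg; near=> n.
  by rewrite fctE big_nat_recr //= addrC addKr.
have h3 : (fun _ : nat => f set0) @ \oo --> f set0 by exact: cvg_cst.
have h4 := cvg_unique (@norm_hausdorff _ _) h2 h3.
by rewrite -[LHS]h4 subrr.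
Unshelve. all: by end_near. Qed.

Lemma saddD f g : sadd f -> sadd g -> sadd (fun A => f A + g A).
Proof.
move=> /saddP hf /saddP hg; apply/saddP => F mF tF mUF.
under eq_cvg => n do rewrite big_split /=.
by apply: cvgD; [exact: hf | exact: hg].
Qed.

Lemma saddZ c f : sadd f -> sadd (fun A => c * f A).
Proof.
move=> /saddP hf; apply/saddP => F mF tF mUF.
under eq_cvg => n do rewrite -mulr_sumr.
by apply: cvgMr; exact: hf.
Qed.

Lemma sadd0 : sadd (fun=> 0).
Proof.
apply/saddP => F mF tF mUF; under eq_cvg => n do rewrite big1 //.
exact: cvg_cst.
Qed.

Lemma sadd_sum (I : Type) (s : seq I) (f : I -> set T -> R) :
  (forall i, sadd (f i)) -> sadd (fun A => \sum_(i <- s) f i A).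
Proof.
move=> h; elim: s => [|i s IH].
  by rewrite (_ : (fun _ => _) = fun=> 0); [exact: sadd0 | apply/funext => A; rewrite big_nil].
rewrite (_ : (fun _ => _) = fun A => f i A + \sum_(j <- s) f j A).
  exact: saddD.
by apply/funext => A; rewrite big_cons.
Qed.

(** Carrying [hf] in the term allows the charge structure to be attached to it canonically. *)
Definition sadd_charge (f : set T -> R) (hf : sadd f) : set T -> \bar R := EFin \o f.

Section ChargeInstance.
Variables (f : set T -> R) (hf : sadd f).

Let c0 : sadd_charge hf set0 = 0%E.
Proof. by rewrite /sadd_charge /= sadd_set0. Qed.

Let cfin : forall A, measurable A -> sadd_charge hf A \is a fin_num.
Proof. by []. Qed.

Let csa : semi_sigma_additive (sadd_charge hf).
Proof. exact: hf. Qed.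

HB.instance Definition _ := isCharge.Build d T R (sadd_charge hf) c0 cfin csa.

End ChargeInstance.

(** A measure has to be nonnegative on all sets, while [f] is controlled on measurable ones; the
    maximum with zero takes care of the others. *)
Definition sadd_prob (f : set T -> R) (hf : sadd f)
  (f0 : forall A, measurable A -> 0 <= f A) (f1 : f setT = 1) : set T -> \bar R :=
  fun A => (Num.max 0 (f A))%:E.

Section ProbabilityInstance.
Variables (f : set T -> R) (hf : sadd f).
Hypotheses (f0 : forall A, measurable A -> 0 <= f A) (f1 : f setT = 1).

Lemma sadd_probE A : measurable A -> sadd_prob hf f0 f1 A = (f A)%:E.
Proof. by move=> mA; rewrite /sadd_prob max_r // f0. Qed.

Let p0 : sadd_prob hf f0 f1 set0 = 0%E.
Proof. by rewrite sadd_probE // sadd_set0. Qed.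

Let pge0 A : (0 <= sadd_prob hf f0 f1 A)%E.
Proof. by rewrite lee_fin le_max lexx. Qed.

Let psa : semi_sigma_additive (sadd_prob hf f0 f1).
Proof.
move=> F mF tF mUF; rewrite sadd_probE //.
under eq_cvg => n do under eq_bigr => i _ do rewrite sadd_probE //.
exact: hf.
Qed.

HB.instance Definition _ := isMeasure.Build d T R (sadd_prob hf f0 f1) p0 pge0 psa.

Let pT : sadd_prob hf f0 f1 setT = 1%E.
Proof. by rewrite sadd_probE // f1. Qed.

HB.instance Definition _ := Measure_isProbability.Build d T R (sadd_prob hf f0 f1) pT.

End ProbabilityInstance.

Lemma sadd_probability (f : set T -> R) : sadd f ->
  (forall A, measurable A -> 0 <= f A) -> f setT = 1 ->
  exists P : probability T R, forall A, measurable A -> P A = (f A)%:E.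
Proof.
move=> hf f0 f1; exists (sadd_prob hf f0 f1 : probability T R) => A mA.
exact: sadd_probE.
Qed.

End SignedMeasures.

(** * Bounded Radon-Nikodym densities *)

Section Density.
Context (d : measure_display) (T : measurableType d) (R : realType).
Variable P : probability T R.

Lemma ae_ge0_density (g : T -> R) : P.-integrable setT (EFin \o g) ->
  (forall A, measurable A -> (0 <= \int[P]_(x in A) (g x)%:E)%E) ->
  {ae P, forall x, 0 <= g x}.
Proof.
move=> gi g0.
have mg : measurable_fun setT g.
  by apply/measurable_EFinP; exact: measurable_int gi.
pose D := [set x | g x < 0].
have mD : measurable D.
  rewrite -[D]setTI (_ : D = g @^-1` `]-oo, 0[%classic).
    exact: mg.
  by apply/seteqP; split=> x /=; rewrite in_itv.
have gD : P.-integrable D (EFin \o g) by apply: integrableS gi.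
have h : (\int[P]_(x in D) `|(EFin \o g) x| = 0)%E.
  apply/eqP; rewrite eq_le; apply/andP; split; last exact: integral_ge0.
  have -> : (\int[P]_(x in D) `|(EFin \o g) x| = \int[P]_(x in D) (- (EFin \o g) x))%E.
    apply: eq_integral => x; rewrite inE /D /= => gx.
    by rewrite ltr0_norm // EFinN.
  rewrite integralN; last exact: integrable_add_def gD.
  by rewrite oppe_le0; exact: g0.
have /(ae_eq_integral_abs P mD (measurable_int _ gD)) := h.
apply: filterS => x /= hx; rewrite leNgt; apply/negP => gx.
by have [gx0] := hx gx; rewrite gx0 ltxx in gx.
Qed.

Lemma bounded_integrable (g : T -> R) (K : R) : measurable_fun setT g ->
  (forall x, `|g x| <= K) -> P.-integrable setT (EFin \o g).
Proof.
move=> mg gK; apply: measurable_bounded_integrable => //.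
  exact: le_lt_trans (probability_le1 P measurableT) (ltry _).
exists K; split; first exact: num_real.
by move=> M KM x _; apply: le_trans (gK x) (ltW KM).
Qed.

(** The bound on [f] makes it absolutely continuous with respect to [P], and K + g and K - g have
    nonnegative integrals over all measurable sets, so |g| <= K almost everywhere. *)
Lemma bounded_density (f : set T -> R) (K : R) : sadd f ->
  (forall A, measurable A -> `|f A| <= K * fine (P A)) ->
  exists g : T -> R, [/\ measurable_fun setT g, forall x, `|g x| <= K &
    forall A, measurable A -> (\int[P]_(x in A) (g x)%:E = (f A)%:E)%E].
Proof.
move=> hf fK.
have K0 : 0 <= K.
  have := fK setT measurableT; have -> : P setT = 1%E by exact: probability_setT.
  by rewrite mulr1; apply: le_trans.
pose nu : {charge set T -> \bar R} := sadd_charge hf.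
have nuP : nu `<< P.
  apply/null_content_dominatesP => A mA PA0; have := fK A mA.
  by rewrite PA0 mulr0 normr_le0 => /eqP h; rewrite /nu /= /sadd_charge /= h.
pose g0 := fine \o (Radon_Nikodym nu P).
have g0E : EFin \o g0 = Radon_Nikodym nu P.
  by apply/funext => x; rewrite /= fineK // Radon_Nikodym_fin_num.
have g0i : P.-integrable setT (EFin \o g0) by rewrite g0E; exact: Radon_Nikodym_integrable.
have g0f A : measurable A -> (\int[P]_(x in A) (g0 x)%:E = (f A)%:E)%E.
  move=> mA; rewrite -[RHS]/(nu A) (Radon_Nikodym_integral nuP mA) -g0E.
  exact: eq_integral.
have mg0 : measurable_fun setT g0 by apply/measurable_EFinP; exact: measurable_int g0i.
have intc (s : R) : P.-integrable setT (EFin \o cst s).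
  by apply: (@bounded_integrable _ `|s|) => //; exact: measurable_cst.
have aeK (s : R) : s = 1 \/ s = -1 -> {ae P, forall x, 0 <= K + s * g0 x}.
  move=> s1.
  have h1 : P.-integrable setT (EFin \o (fun x => K + s * g0 x)).
    apply: (@eq_integrable _ _ _ P setT measurableT (fun x => (cst K x)%:E + (s%:E * (g0 x)%:E))%E) => //.
    by apply: integrableD => //; [exact: intc | exact: integrableZl].
  apply: ae_ge0_density => // A mA.
  have -> : (\int[P]_(x in A) (K + s * g0 x)%:E = (K * fine (P A) + s * f A)%:E)%E.
    have iA := integrableS measurableT mA (@subsetT _ A).
    under eq_integral do rewrite EFinD EFinM.
    rewrite integralD //; [|exact: iA (intc K)|by apply: integrableZl => //; exact: iA].
    rewrite integral_cst // integralZl //; last exact: iA.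
    rewrite g0f // EFinD !EFinM; congr (_ * _ + _)%E.
    by apply/esym/fineK; exact: fin_num_measure.
  rewrite lee_fin; have := fK A mA; rewrite ler_norml => /andP[].
  by case: s1 => ->; lra.
(* Truncation turns the almost sure bound into one at every point without changing any integral. *)
pose g x := Num.max (- K) (Num.min K (g0 x)).
exists g; split.
- apply: measurable_maxr; first exact: measurable_cst.
  by apply: measurable_minr => //; exact: measurable_cst.
- by move=> x; rewrite ler_norml /g le_max lexx /= ge_max ge_min lexx /= andbT; lra.
- move=> A mA; rewrite -g0f //; apply: ae_eq_integral => //.
  + apply/measurable_EFinP; apply: measurable_funTS; apply: measurable_maxr; first exact: measurable_cst.
    by apply: measurable_minr => //; exact: measurable_cst.
  + by apply/measurable_EFinP; exact: measurable_funTS.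
  + apply: filterS2 (aeK 1 (or_introl erefl)) (aeK (-1) (or_intror erefl)) => x h1 h2 _.
    rewrite /g /= min_r; last by lra.
    by rewrite max_r //; lra.
Qed.

Lemma density_change (Q : probability T R) (g : T -> R) (K : R) (h : T -> R) :
  measurable_fun setT g -> (forall x, `|g x| <= K) ->
  (forall A, measurable A -> Q A = \int[P]_(x in A) (g x)%:E)%E ->
  Q.-integrable setT (EFin \o h) ->
  (\int[Q]_x (h x)%:E = \int[P]_x (h x * g x)%:E)%E.
Proof.
move=> mg gK QE hi.
have gi := bounded_integrable mg gK.
have QP : Q `<< P.
  apply/null_content_dominatesP => A mA PA0; rewrite QE //.
  by apply: null_set_integral => //; apply: measurable_funTS; exact: measurable_int gi.
have e := Radon_Nikodym_change_of_variables QP measurableT hi.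
rewrite -e; apply: ae_eq_integral => //.
- apply: emeasurable_funM; first exact: measurable_int hi.
  by apply: measurable_int; exact: Radon_Nikodym_integrable.
- apply/measurable_EFinP; apply: measurable_funM => //.
  by apply/measurable_EFinP; exact: measurable_int hi.
have QP' : charge_of_finite_measure Q `<< P by [].
have ae1 : ae_eq P setT (Radon_Nikodym (charge_of_finite_measure Q) P) (EFin \o g).
  apply: integral_ae_eq => //.
  - exact: Radon_Nikodym_integrable.
  - exact: measurable_int gi.
  - move=> E _ mE; rewrite -Radon_Nikodym_integral // /=; exact: QE.
by apply: filterS ae1 => x /(_ I) /= -> _; rewrite EFinM.
Qed.

End Density.

(** * The law of a POVM and the densities of its entries *)

Section Law.
Variable R : realType.
Local Notation C := R[i].

Definition pval d (M : POVM R d) (B : 'M[C]_d) (A : set (Omega R)) : R :=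
  complex.Re (\tr (M A *m B)).

Lemma pvalE d (M : POVM R d) B A : pval M B A = \sum_i \sum_j
  (complex.Re (B j i) * complex.Re (M A i j) + (- complex.Im (B j i)) * complex.Im (M A i j)).
Proof.
rewrite /pval /mxtrace Re_sum; apply: eq_bigr => i _.
rewrite mxE Re_sum; apply: eq_bigr => j _; rewrite ReM'; ring.
Qed.

Lemma sadd_pval d (M : POVM R d) B : sadd (pval M B).
Proof.
rewrite (_ : pval M B = fun A => \sum_i \sum_j (complex.Re (B j i) * complex.Re (M A i j) +
  (- complex.Im (B j i)) * complex.Im (M A i j))); last by apply/funext => A; exact: pvalE.
apply: sadd_sum => i; apply: sadd_sum => j; have [h1 h2] := povm_sigma_additive M i j.
by apply: saddD; apply: saddZ.
Qed.

(** Positivity is recorded as a factorisation because this form passes to tensor powers at once and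
    makes the trace against an effect visibly nonnegative. *)
Definition state d (B : 'M[C]_d) := (exists V : 'M[C]_d, B = V *m adjmx V) /\ \tr B = 1.

Lemma pval_ge0 d (M : POVM R d) B A : (exists V : 'M[C]_d, B = V *m adjmx V) ->
  measurable A -> 0 <= pval M B A.
Proof.
by move=> [V ->] mA; have [] := ge0C (trace_psdC_ge0 V (povm_psd M mA)).
Qed.

(** [law] is defined by choice with a default; for a state, [pval] is nonnegative, additive and of
    mass one, so the probability exists and the default branch is excluded. *)
Lemma lawE d (M : POVM R d) B A : state B -> measurable A ->
  law M B A = (pval M B A)%:E.
Proof.
move=> [BV trB] mA; rewrite /law; case: pselect => [h|]; first exact: (projT2 (cid h)).
case; apply: sadd_probability; first exact: sadd_pval.
  by move=> A' mA'; exact: pval_ge0.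
by rewrite povm_total mul1mx trB.
Qed.

Lemma state_ntens d (B : 'M[C]_d) n : state B -> state (B ^t n).
Proof.
move=> [[V ->] trB]; split.
  by exists (V ^t n); rewrite adjmx_ntens ntensmx_mul.
by rewrite mxtrace_ntens trB expr1n.
Qed.

Lemma pval_add d (M : POVM R d) B B' A : pval M (B + B') A = pval M B A + pval M B' A.
Proof. by rewrite /pval mulmxDr mxtraceD ReD. Qed.

Lemma pval_sum d (M : POVM R d) (I : finType) (B : I -> 'M[C]_d) A :
  pval M (\sum_i B i) A = \sum_i pval M (B i) A.
Proof.
apply: (big_morph (fun B => pval M B A)) => [B1 B2|]; first exact: pval_add.
by rewrite /pval mulmx0 mxtrace0.
Qed.

Section EntryDensities.
Variables (d : nat) (M : POVM R d) (rho0 : 'M[C]_d) (K : R).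
Hypothesis rho0s : state rho0.
Hypothesis rho0K : forall A, measurable A -> complex.Re (\tr (M A)) <= K * pval M rho0 A.
Let P := law M rho0.

(* Density of [pval M B], given densities [mR], [mI] of the real and imaginary entries of [M]. *)
Definition dens (mR mI : 'I_d -> 'I_d -> Omega R -> R) (B : 'M[C]_d) (x : Omega R) : R :=
  \sum_i \sum_j (complex.Re (B j i) * mR i j x + (- complex.Im (B j i)) * mI i j x).

Lemma entry_density : exists mR mI : 'I_d -> 'I_d -> Omega R -> R,
  [/\ forall i j, measurable_fun setT (mR i j) /\ measurable_fun setT (mI i j),
      forall i j x, `|mR i j x| <= K /\ `|mI i j x| <= K &
      forall i j A, measurable A ->
        (\int[P]_(x in A) (mR i j x)%:E = (complex.Re (M A i j))%:E)%E /\
        (\int[P]_(x in A) (mI i j x)%:E = (complex.Im (M A i j))%:E)%E].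
Proof.
have PK A : measurable A -> complex.Re (\tr (M A)) <= K * fine (P A).
  by move=> mA; rewrite /P lawE //; exact: rho0K.
have hR i j : exists g : Omega R -> R, [/\ measurable_fun setT g, forall x, `|g x| <= K &
    forall A, measurable A -> (\int[P]_(x in A) (g x)%:E = (complex.Re (M A i j))%:E)%E].
  apply: bounded_density; first by have [] := povm_sigma_additive M i j.
  move=> A mA; apply: le_trans (PK A mA).
  by have [] := psdC_ReIm_le i j (povm_psd M mA).
have hI i j : exists g : Omega R -> R, [/\ measurable_fun setT g, forall x, `|g x| <= K &
    forall A, measurable A -> (\int[P]_(x in A) (g x)%:E = (complex.Im (M A i j))%:E)%E].
  apply: bounded_density; first by have [] := povm_sigma_additive M i j.
  move=> A mA; apply: le_trans (PK A mA).
  by have [] := psdC_ReIm_le i j (povm_psd M mA).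
exists (fun i j => projT1 (cid (hR i j))), (fun i j => projT1 (cid (hI i j))).
split=> i j.
- by case: (projT2 (cid (hR i j))) => ? _ _; case: (projT2 (cid (hI i j))).
- by move=> x; case: (projT2 (cid (hR i j))) => _ h _; case: (projT2 (cid (hI i j))) => _ h' _.
- move=> A mA; case: (projT2 (cid (hR i j))) => _ _ h.
  by case: (projT2 (cid (hI i j))) => _ _ h'; split; [exact: h | exact: h'].
Qed.

Variables mR mI : 'I_d -> 'I_d -> Omega R -> R.
Hypothesis mm : forall i j, measurable_fun setT (mR i j) /\ measurable_fun setT (mI i j).
Hypothesis mK : forall i j x, `|mR i j x| <= K /\ `|mI i j x| <= K.
Hypothesis mE : forall i j A, measurable A ->
        (\int[P]_(x in A) (mR i j x)%:E = (complex.Re (M A i j))%:E)%E /\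
        (\int[P]_(x in A) (mI i j x)%:E = (complex.Im (M A i j))%:E)%E.

Lemma measurable_dens B : measurable_fun setT (dens mR mI B).
Proof.
apply: measurable_sum => i; apply: measurable_sum => j.
by have [h1 h2] := mm i j; apply: measurable_funD; apply: measurable_funM => //; exact: measurable_cst.
Qed.

Lemma dens_bounded B : exists K', forall x, `|dens mR mI B x| <= K'.
Proof.
exists (\sum_i \sum_j (`|complex.Re (B j i)| * K + `|complex.Im (B j i)| * K)) => x.
apply: le_trans (ler_norm_sum _ _ _) _; apply: ler_sum => i _.
apply: le_trans (ler_norm_sum _ _ _) _; apply: ler_sum => j _.
apply: le_trans (ler_normD _ _) _; rewrite !normrM normrN.
by have [h1 h2] := mK i j x; apply: lerD; apply: ler_wpM2l.
Qed.

(** In finite dimension the integral is linear in [B], with coefficients independent of [B]. With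
    [B] the state at a nearby parameter, the mean becomes an explicit function of that parameter. *)
Lemma integral_dens_mul (h : Omega R -> R) B (A : set (Omega R)) : measurable A ->
  P.-integrable A (EFin \o h) ->
  (\int[P]_(x in A) (h x * dens mR mI B x)%:E =
   (\sum_i \sum_j (complex.Re (B j i) * fine (\int[P]_(x in A) (h x * mR i j x)%:E) +
     (- complex.Im (B j i)) * fine (\int[P]_(x in A) (h x * mI i j x)%:E)))%:E)%E.
Proof.
move=> mA hi.
have hm (g : Omega R -> R) : measurable_fun setT g -> (forall x, `|g x| <= K) ->
    P.-integrable A (fun x => (h x * g x)%:E).
  move=> mg gK.
  apply: (@eq_integrable _ _ _ P A mA ((EFin \o h) \* (EFin \o g))%E) => //.
  apply: integrableMl => //; first exact: measurable_funTS.
  exists K; split; first exact: num_real.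
  by move=> N KN x _; exact: le_trans (gK x) (ltW KN).
have hR i j : P.-integrable A (fun x => (h x * mR i j x)%:E).
  by apply: hm; [case: (mm i j) | move=> x; case: (mK i j x)].
have hI i j : P.-integrable A (fun x => (h x * mI i j x)%:E).
  by apply: hm; [case: (mm i j) | move=> x; case: (mK i j x)].
transitivity (\int[P]_(x in A) \sum_i \sum_j
  ((complex.Re (B j i))%:E * (h x * mR i j x)%:E + (- complex.Im (B j i))%:E * (h x * mI i j x)%:E))%E.
  apply: eq_integral => x _.
  rewrite /dens mulr_sumr -sumEFin; apply: eq_bigr => i _.
  rewrite mulr_sumr -sumEFin; apply: eq_bigr => j _.
  by rewrite -!EFinM -EFinD; congr (_%:E); ring.
rewrite -sumEFin integral_sum //; last first.
  move=> i; apply: integrable_sum => // j _.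
  by apply: integrableD => //; apply: integrableZl.
apply: eq_bigr => i _.
rewrite -sumEFin integral_sum //; last first.
  by move=> j; apply: integrableD => //; apply: integrableZl.
apply: eq_bigr => j _.
rewrite integralD //; [|exact: integrableZl|exact: integrableZl].
rewrite !integralZl // EFinD !EFinM.
by rewrite !fineK //; exact: integrable_fin_num.
Qed.

Lemma integral_dens B A : measurable A ->
  (\int[P]_(x in A) (dens mR mI B x)%:E = (pval M B A)%:E)%E.
Proof.
move=> mA; have := @integral_dens_mul (cst 1) B A mA.
under eq_integral do rewrite mul1r.
move=> ->; last first.
  apply: integrableS measurableT mA _ _ => //.
  by apply: (@bounded_integrable _ _ _ _ _ 1) => // x; rewrite normr1.
rewrite pvalE; congr (_%:E); apply: eq_bigr => i _; apply: eq_bigr => j _.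
have [e1 e2] := mE i j mA.
by congr (_ * _ + _ * _); under eq_integral do rewrite mul1r; rewrite ?e1 ?e2.
Qed.

End EntryDensities.
End Law.

(** * Lower bound *)

Section Quadratic.
Variable R : realType.

Lemma quad_rat (a b c : R) : (forall q : rat, 0 <= a * ratr q ^+ 2 + b * ratr q + c) ->
  forall x, 0 <= a * x ^+ 2 + b * x + c.
Proof.
move=> h x; rewrite leNgt; apply/negP => hx.
pose f := fun y : R => a * y ^+ 2 + b * y + c.
have fc : continuous f.
  move=> y; apply: cvgD; last exact: cvg_cst.
  apply: cvgD; apply: cvgMr; last exact: cvg_id.
  exact: exprn_continuous.
pose O := f @^-1` [set y | y < 0].
have Oo : open O by apply: open_comp => //; exact: open_lt.
have [y [Oy [q _ qy]]] := @dense_rat R O (ex_intro _ x hx) Oo.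
by have := h q; rewrite qy leNgt => /negP; apply.
Qed.

Definition row3 (a b c : R) : 'rV[R]_3 := \row_(i < 3) nth 0 [:: a; b; c] i.

Lemma row3E (u : 'rV[R]_3) : u = row3 (u 0 (Ordinal (isT : 0 < 3)%N))
  (u 0 (Ordinal (isT : 1 < 3)%N)) (u 0 (Ordinal (isT : 2 < 3)%N)).
Proof. by apply/rowP; elim/ord3P; rewrite mxE. Qed.

Lemma qformE (G : 'M[R]_3) u : qform G u = \sum_i \sum_j G i j * (u 0 i * u 0 j).
Proof.
rewrite /qform mxE exchange_big /=; apply: eq_bigr => j _; rewrite !mxE mulr_suml.
by apply: eq_bigr => i _; ring.
Qed.

(** The coordinates are freed from the rationals one at a time, the expression being a quadratic
    polynomial in each. *)
Lemma quad3_rat (G : 'M[R]_3) (s c : R) (L : 'I_3 -> R) :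
  (forall p q t : rat, 0 <= qform G (row3 (ratr p) (ratr q) (ratr t)) * s -
     \sum_j row3 (ratr p) (ratr q) (ratr t) 0 j * L j + c) ->
  forall u, 0 <= qform G u * s - \sum_j u 0 j * L j + c.
Proof.
pose f x y z := qform G (row3 x y z) * s - \sum_j row3 x y z 0 j * L j + c.
move=> h u; suff hf x y z : 0 <= f x y z by rewrite (row3E u); exact: hf.
pose o0 := Ordinal (isT : 0 < 3)%N; pose o1 := Ordinal (isT : 1 < 3)%N.
pose o2 := Ordinal (isT : 2 < 3)%N.
have fE a b e : f a b e = (G o0 o0 * a ^+ 2 + G o1 o1 * b ^+ 2 + G o2 o2 * e ^+ 2 +
   (G o0 o1 + G o1 o0) * a * b + (G o0 o2 + G o2 o0) * a * e +
   (G o1 o2 + G o2 o1) * b * e) * s - (a * L o0 + b * L o1 + e * L o2) + c.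
  by rewrite /f qformE !sum3E !mxE /=; ring.
have h1 (q t : rat) : 0 <= f x (ratr q) (ratr t).
  have e a : f a (ratr q) (ratr t) = (G o0 o0 * s) * a ^+ 2 +
     (((G o0 o1 + G o1 o0) * ratr q + (G o0 o2 + G o2 o0) * ratr t) * s - L o0) * a +
     f 0 (ratr q) (ratr t) by rewrite !fE; ring.
  by rewrite e; apply: quad_rat => p; rewrite -e; exact: h.
have h2 (t : rat) : 0 <= f x y (ratr t).
  have e b : f x b (ratr t) = (G o1 o1 * s) * b ^+ 2 +
     (((G o0 o1 + G o1 o0) * x + (G o1 o2 + G o2 o1) * ratr t) * s - L o1) * b +
     f x 0 (ratr t) by rewrite !fE; ring.
  by rewrite e; apply: quad_rat => p; rewrite -e; exact: h1.
have e b : f x y b = (G o2 o2 * s) * b ^+ 2 +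
   (((G o0 o2 + G o2 o0) * x + (G o1 o2 + G o2 o1) * y) * s - L o2) * b +
   f x y 0 by rewrite !fE; ring.
by rewrite e; apply: quad_rat => p; rewrite -e; exact: h2.
Qed.

End Quadratic.

(** * Integration of the operator inequality against a POVM *)

Section LowerCore.
Variable R : realType.
Local Notation C := R[i].

Lemma measurable_ovec (j : 'I_3) : measurable_fun setT (fun x : Omega R => ovec x 0 j).
Proof.
elim/ord3P: j; under eq_fun do rewrite mxE /=.
- by apply: measurableT_comp.
- by apply: measurableT_comp.
- exact: measurable_snd.
Qed.

Lemma measurable_ovecB (j : 'I_3) (th : 'rV[R]_3) :
  measurable_fun setT (fun x : Omega R => (ovec x - th) 0 j).
Proof.
under eq_fun do rewrite mxE [X in _ + X]mxE.
by apply: measurable_funB; [exact: measurable_ovec | exact: measurable_cst].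
Qed.

Lemma measurable_qform (G : 'M[R]_3) (th : 'rV[R]_3) :
  measurable_fun setT (fun x : Omega R => qform G (ovec x - th)).
Proof.
under eq_fun do rewrite qformE.
apply: measurable_sum => i; apply: measurable_sum => j.
apply: measurable_funM; first exact: measurable_cst.
by apply: measurable_funM; exact: measurable_ovecB.
Qed.

Variables (d : nat) (M : POVM R d) (rho0 : 'M[C]_d) (K : R).
Hypothesis rho0s : state rho0.
Variables mR mI : 'I_d -> 'I_d -> Omega R -> R.
Let P := law M rho0.
Hypothesis mm : forall i j, measurable_fun setT (mR i j) /\ measurable_fun setT (mI i j).
Hypothesis mK : forall i j x, `|mR i j x| <= K /\ `|mI i j x| <= K.
Hypothesis mE : forall i j A, measurable A ->
        (\int[P]_(x in A) (mR i j x)%:E = (complex.Re (M A i j))%:E)%E /\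
        (\int[P]_(x in A) (mI i j x)%:E = (complex.Im (M A i j))%:E)%E.
Local Notation den := (dens mR mI).

Lemma densD B B' x : den (B + B') x = den B x + den B' x.
Proof.
rewrite /dens -big_split; apply: eq_bigr => i _; rewrite -big_split.
by apply: eq_bigr => j _; rewrite /= mxE ReD ImD; ring.
Qed.

Lemma densZ (s : R) B x : den (s%:C%C *: B) x = s * den B x.
Proof.
rewrite /dens mulr_sumr; apply: eq_bigr => i _; rewrite mulr_sumr.
by apply: eq_bigr => j _; rewrite mxE ReM' ImM' /=; ring.
Qed.

Lemma integrable_mul_dens (h : Omega R -> R) B : P.-integrable setT (EFin \o h) ->
  P.-integrable setT (fun x => (h x * den B x)%:E).
Proof.
move=> hi; apply: (@eq_integrable _ _ _ P setT measurableT
   ((EFin \o h) \* (EFin \o den B))%E) => //.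
apply: integrableMl => //; first exact: measurable_dens mm B.
have [K' hK] := dens_bounded mK B.
exists K'; split; first exact: num_real.
by move=> N KN x _; exact: le_trans (hK x) (ltW KN).
Qed.

Lemma integrable_dens B : P.-integrable setT (EFin \o den B).
Proof.
have [K' hK] := dens_bounded mK B.
exact: bounded_integrable (measurable_dens mm B) hK.
Qed.

Variables (G : 'M[R]_3) (F : 'I_3 -> 'M[C]_d) (Gam : 'M[C]_d) (th0 : 'rV[R]_3).

Definition certificate (u : 'rV[R]_3) : 'M[C]_d :=
  (qform G u)%:C%C *: rho0 + \sum_j (- u 0 j)%:C%C *: F j + Gam.

Hypothesis cert_ge0 : forall u A, measurable A -> 0 <= pval M (certificate u) A.

Lemma dens_certificate u x :
  den (certificate u) x = qform G u * den rho0 x - \sum_j u 0 j * den (F j) x + den Gam x.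
Proof.
rewrite /certificate !densD densZ sum3E !densD !densZ sum3E; ring.
Qed.

(* Positivity at rational [u] holds outside one common null set, and extends to all [u] by
   continuity; this allows [u] to depend on the outcome. *)
Lemma certificate_ae : {ae P, forall x, forall u,
  0 <= qform G u * den rho0 x - \sum_j u 0 j * den (F j) x + den Gam x}.
Proof.
pose Q (n : nat) (x : Omega R) : Prop := match @unpickle (rat * rat * rat)%type n with
  | Some q => 0 <= den (certificate (row3 (ratr q.1.1) (ratr q.1.2) (ratr q.2))) x
  | None => True end.
have aeQ : {ae P, forall x, forall n, Q n x}.
  apply: ae_foralln => n; rewrite /Q; case: unpickle => [q|]; last exact: aeW.
  apply: ae_ge0_density; first exact: integrable_dens.
  move=> A mA; rewrite (integral_dens mm mK mE) // lee_fin; exact: cert_ge0.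
apply: filterS aeQ => x hx u; apply: quad3_rat => p q t.
by have := hx (pickle (p, q, t)); rewrite /Q pickleK dens_certificate.
Qed.

Hypothesis intU : forall j, P.-integrable setT (fun x => ((ovec x - th0) 0 j)%:E).

Lemma certificate_integral : (forall v, 0 <= qform G v) ->
  ((\sum_j fine (\int[P]_x ((ovec x - th0) 0 j * den (F j) x)%:E) -
    pval M Gam setT)%:E <= \int[P]_x (qform G (ovec x - th0))%:E)%E.
Proof.
move=> G0; set q := fun x : Omega R => qform G (ovec x - th0).
have mq : measurable_fun setT q by exact: measurable_qform.
(* An infinite risk makes the inequality trivial; a finite one makes the quadratic term integrable,
   so that the integral can be split. *)
have [qy|qy] := eqVneq (\int[P]_x (q x)%:E)%E +oo%E; first by rewrite qy leey.
have qi : P.-integrable setT (EFin \o q).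
  apply/integrableP; split; first exact/measurable_EFinP.
  rewrite (@eq_integral _ _ _ _ _ (EFin \o q)); first by rewrite ltey.
  by move=> x _; rewrite /= ger0_norm // /q G0.
(* The density of the law with respect to itself is inserted, so that all three terms have the shape
   occurring in [certificate_ae]. *)
have -> : (\int[P]_x (q x)%:E = \int[P]_x (q x * den rho0 x)%:E)%E.
  have [K' hK] := dens_bounded mK rho0.
  apply: (density_change (measurable_dens mm rho0) hK) => //.
  by move=> A mA; rewrite (integral_dens mm mK mE) // /P lawE.
have iU j := integrable_mul_dens (F j) (intU j).
have iq := integrable_mul_dens rho0 qi.
have iG := integrable_dens Gam.
pose w (x : Omega R) := (q x * den rho0 x - \sum_j (ovec x - th0) 0 j * den (F j) x + den Gam x).
have w0 : (0 <= \int[P]_x (w x)%:E)%E.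
  have -> : (\int[P]_x (w x)%:E = \int[P]_x `|(w x)%:E|)%E.
    have mw : measurable_fun setT w.
      apply: measurable_funD; last exact: measurable_dens.
      apply: measurable_funB.
        by apply: measurable_funM => //; exact: measurable_dens.
      apply: measurable_sum => j; apply: measurable_funM; last exact: measurable_dens.
      exact: measurable_ovecB.
    apply: ae_eq_integral => //; [exact/measurable_EFinP | exact/measurableT_comp/measurable_EFinP |].
    by apply: filterS certificate_ae => x hx _ /=; rewrite ger0_norm //; exact: hx.
  exact: integral_ge0.
have eS (x : Omega R) : ((\sum_j (ovec x - th0) 0 j * den (F j) x)%:E =
  \sum_j ((ovec x - th0) 0 j * den (F j) x)%:E)%E by rewrite sumEFin.
have iS : P.-integrable setT (fun x => (\sum_j (ovec x - th0) 0 j * den (F j) x)%:E).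
  under eq_fun do rewrite eS.
  by apply: integrable_sum => // j _.
have wE : (\int[P]_x (w x)%:E = \int[P]_x (q x * den rho0 x)%:E -
   (\sum_j fine (\int[P]_x ((ovec x - th0) 0 j * den (F j) x)%:E))%:E + (pval M Gam setT)%:E)%E.
  under eq_integral do rewrite /w EFinD EFinB.
  rewrite integralD //; last exact: integrableB.
  rewrite integralB //; congr (_ - _ + _)%E; last exact: (integral_dens mm mK mE).
  under eq_integral do rewrite eS.
  rewrite integral_sum // -sumEFin; apply: eq_bigr => j _.
  by rewrite fineK //; exact: integrable_fin_num.
move: w0; rewrite wE.
have : (\int[P]_x (q x * den rho0 x)%:E)%E \is a fin_num by exact: integrable_fin_num.
case: (integral _ _ _) => // a _.
by rewrite -EFinB -EFinD !lee_fin; lra.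
Qed.

End LowerCore.

(** * Differentiating the mean of the estimator *)

Section Derivatives.
Variable R : realType.
Local Notation C := R[i].

Definition cderiv (f : R -> C) (f' : C) :=
  is_derive (0 : R) (1 : R) (fun t => complex.Re (f t)) (complex.Re f') /\
  is_derive (0 : R) (1 : R) (fun t => complex.Im (f t)) (complex.Im f').

Lemma cderivM f g f' g' : cderiv f f' -> cderiv g g' ->
  cderiv (fun t => f t * g t) (f' * g 0 + f 0 * g').
Proof.
move=> [f1 f2] [g1 g2]; split.
  under eq_fun do rewrite ReM'.
  apply: is_derive_eq; rewrite ReD !ReM' /GRing.scale /=; ring.
under eq_fun do rewrite ImM'.
apply: is_derive_eq; rewrite ImD !ImM' /GRing.scale /=; ring.
Qed.

Lemma cderiv_affine (a b : C) : cderiv (fun t => a + t%:C%C * b) b.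
Proof.
split.
  under eq_fun do rewrite ReD ReM' /= mul0r subr0.
  apply: is_derive_eq; rewrite /GRing.scale /=; ring.
under eq_fun do rewrite ImD ImM' /= mul0r addr0.
apply: is_derive_eq; rewrite /GRing.scale /=; ring.
Qed.

(** The Leibniz rule along the line A + t A L: the collective operator of [L] is the right
    logarithmic derivative of the tensor power. *)
Lemma cderiv_ntens d (A L : 'M[C]_d) k i j :
  cderiv (fun t => ((A + t%:C%C *: (A *m L)) ^t k.+1) i j) ((A ^t k.+1 *m tsum L k) i j).
Proof.
elim: k i j => [|k IH] i j.
  under eq_fun do rewrite ntensmx1 addmxE scalemxE.
  exact: cderiv_affine.
have eD : (A ^t k.+2 *m tsum L k.+1) i j =
    (A *m L) (mxtens_unindex i).1 (mxtens_unindex j).1 *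
      (A ^t k.+1) (mxtens_unindex i).2 (mxtens_unindex j).2 +
    A (mxtens_unindex i).1 (mxtens_unindex j).1 *
      (A ^t k.+1 *m tsum L k) (mxtens_unindex i).2 (mxtens_unindex j).2.
  by rewrite tsumS ntensmxSr mulmxDr !tensmx_mul !mulmx1 [LHS]mxE; congr (_ + _); rewrite mxE.
rewrite eD.
have := cderivM (cderiv_affine (A (mxtens_unindex i).1 (mxtens_unindex j).1)
   ((A *m L) (mxtens_unindex i).1 (mxtens_unindex j).1))
   (IH (mxtens_unindex i).2 (mxtens_unindex j).2).
rewrite !mul0r addr0 scale0r addr0.
by congr cderiv; apply/funext => t; rewrite [in RHS]mxE addmxE scalemxE.
Qed.

End Derivatives.

Section AmatDensity.
Variable R : realType.
Local Notation C := R[i].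
Variables (th0 : 'rV[R]_3) (L : 'I_3 -> 'M[C]_2) (e : R).
Hypothesis e0 : 0 < e.
Hypothesis rhoL : forall k, rho th0 *m L k = sigma R k.
Hypothesis near_state : forall th, `|th - th0| < e -> state (rho th).
Variables (n : nat) (M : POVM R (2 ^ n.+1)) (K : R).
Hypothesis near_int : forall th, `|th - th0| < e -> forall j,
  (law M (rho_n th n.+1)).-integrable setT (fun x => (ovec x 0 j)%:E).
Let P := law M (rho_n th0 n.+1).
Variables mR mI : 'I_(2 ^ n.+1) -> 'I_(2 ^ n.+1) -> Omega R -> R.
Hypothesis mm : forall i j, measurable_fun setT (mR i j) /\ measurable_fun setT (mI i j).
Hypothesis mK : forall i j x, `|mR i j x| <= K /\ `|mI i j x| <= K.
Hypothesis mE : forall i j A, measurable A ->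
        (\int[P]_(x in A) (mR i j x)%:E = (complex.Re (M A i j))%:E)%E /\
        (\int[P]_(x in A) (mI i j x)%:E = (complex.Im (M A i j))%:E)%E.
Local Notation den := (dens mR mI).

Lemma rho_affine k t : rho (t *: delta_mx 0 k + th0) = rho th0 + t%:C%C *: (rho th0 *m L k).
Proof.
rewrite rhoL /rho -addrA; congr (_ + _).
transitivity (\sum_i ((th0 0 i)%:C%C *: sigma R i + ((t * (k == i)%:R)%:C%C *: sigma R i))).
  apply: eq_bigr => i _; rewrite !mxE /= -scalerDl; congr (_ *: _).
  by rewrite addrC eq_sym rmorphD.
rewrite big_split /=; congr (_ + _).
rewrite (bigD1 k) //= eqxx mulr1 big1 ?addr0 // => i ik.
by rewrite eq_sym (negbTE ik) mulr0 scale0r.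
Qed.

Lemma is_derive_sumr (I : finType) (h : I -> R -> R) (dh : I -> R) (x v : R) :
  (forall i, is_derive x v (h i) (dh i)) ->
  is_derive x v (fun t => \sum_i h i t) (\sum_i dh i).
Proof.
move=> hh; elim: (index_enum I) => [|i s IH].
  under eq_fun do rewrite big_nil; rewrite big_nil; exact: is_derive_cst.
under eq_fun do rewrite big_cons; rewrite big_cons; exact: is_deriveD.
Qed.

(** Close to [th0] the parameter still gives a state, and the mean there is a finite combination,
    [S] below, of entries of the tensor power with coefficients fixed at [th0]. Only those entries
    are differentiated. *)
Lemma Amat_dens j k : Amat M th0 j k =
  fine (\int[P]_x (ovec x 0 j * den (rho_n th0 n.+1 *m tsum (L k) n) x)%:E).
Proof.
pose v : 'rV[R]_3 := delta_mx 0 k.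
have st0 : `|th0 - th0| < e by rewrite subrr normr0.
have hP : P.-integrable setT (fun x => (ovec x 0 j)%:E) := near_int st0 j.
pose f (t : 'rV[R]_3) : R := Ehat M t 0 j.
have -> : Amat M th0 j k = 'D_v f th0 by rewrite mxE.
pose a i l := fine (\int[P]_(x in setT) (ovec x 0 j * mR i l x)%:E)%E.
pose b i l := fine (\int[P]_(x in setT) (ovec x 0 j * mI i l x)%:E)%E.
pose rt (t : R) := (rho th0 + t%:C%C *: (rho th0 *m L k)) ^t n.+1.
pose D := rho_n th0 n.+1 *m tsum (L k) n.
pose S t := \sum_i \sum_l (complex.Re (rt t l i) * a i l + (- complex.Im (rt t l i)) * b i l).
have fS : \forall t \near (0 : R), f (t *: v + th0) = S t.
  have : \forall t \near (0 : R), `|t * `|v| | < e.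
    have c : (fun t : R => t * `|v|) @ (0 : R) --> (0 : R).
      by rewrite -[X in _ --> X](mul0r `|v|); apply: cvgMl; exact: cvg_id.
    have /cvgr_dist_lt /(_ e e0) := c.
    by apply: filterS => t; rewrite sub0r normrN.
  apply: filterS => t ht.
  have ht' : `|(t *: v + th0) - th0| < e.
    by rewrite addrK normrZ; move: ht; rewrite normrM normr_id.
  have stt := near_state ht'; have stn := state_ntens n.+1 stt.
  rewrite /f mxE.
  have [K' hK] := dens_bounded mK (rho_n (t *: v + th0) n.+1).
  rewrite (density_change (P := P) (measurable_dens mm _) hK) //; first last.
  - exact: near_int.
  - by move=> A mA; rewrite (integral_dens mm mK mE) // lawE.
  by rewrite (integral_dens_mul mm mK _ measurableT hP) /= /rho_n rho_affine.
have dS : is_derive (0 : R) (1 : R) S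
    (\sum_i \sum_l (complex.Re (D l i) * a i l + (- complex.Im (D l i)) * b i l)).
  apply: is_derive_sumr => i; apply: is_derive_sumr => l.
  have [h1 h2] := cderiv_ntens (rho th0) (L k) l i.
  apply: is_derive_eq; rewrite /GRing.scale /=; ring.
have -> : 'D_v f th0 = 'D_1 (fun t : R => f (t *: v + th0)) 0.
  have fE : (fun h : R => h^-1 *: ((f \o shift th0) (h *: v) - f th0)) =
      (fun h : R => h^-1 *: (((fun t : R => f (t *: v + th0)) \o shift 0) (h *: (1 : R)) -
         (fun t : R => f (t *: v + th0)) 0)).
    apply/funext => h /=; rewrite scale0r add0r addr0.
    by have -> : h *: (1 : R) = h by rewrite /GRing.scale /= mulr1.
  exact: (congr1 (fun F : R -> R => lim (F @ 0^')) fE).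
rewrite (near_eq_derive _ fS) derive_val.
by rewrite (integral_dens_mul mm mK _ measurableT hP).
Qed.

End AmatDensity.

Section Intertwine.
Variable F : comNzRingType.

Lemma tsum_intertwine d (A B W : 'M[F]_d) k : A *m W = W *m B ->
  tsum A k *m W ^t k.+1 = W ^t k.+1 *m tsum B k.
Proof.
move=> AW; elim: k => [//|k IH]; rewrite !tsumS ntensmxSr.
by rewrite mulmxDl mulmxDr !tensmx_mul !mul1mx !mulmx1 AW IH.
Qed.

Lemma tsum_sum d (I : finType) (c : I -> F) (A : I -> 'M[F]_d) k :
  tsum (\sum_i c i *: A i) k = \sum_i c i *: tsum (A i) k.
Proof.
apply: (big_ind2 (fun X Y => tsum X k = Y)) => [|X Y X' Y' <- <-|i _].
- by rewrite -[in LHS](scale0r (1%:M)) tsumZ scale0r.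
- exact: tsumD.
- exact: tsumZ.
Qed.

End Intertwine.

(** * The positive operator built from the logarithmic derivatives *)

Section Certificate.
Variable R : realType.
Local Notation C := R[i].
Variables (th0 : 'rV[R]_3) (L : 'I_3 -> 'M[C]_2).
Hypothesis rhoL : forall k, rho th0 *m L k = sigma R k.
Hypothesis rho_st : state (rho th0).
Variables (G : 'M[R]_3) (cc yy : 'I_2 -> 'I_3 -> C).
Let gam a (u : 'rV[R]_3) := \sum_j cc a j * (u 0 j)%:C%C.
Hypothesis hG : forall u, (qform G u)%:C%C = \sum_a gam a u * (gam a u)^*.
Variable n : nat.
Let rn := rho_n th0 n.+1.
Let D k := rn *m tsum (L k) n.
Let Lam a := \sum_k yy a k *: L k.
(* The terms of [certificate] for c_a.u - Y_a^*: minus its part linear in u is F_j, its constant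
   part is Gam. *)
Definition cert_beta j k : R := 2 * complex.Re (\sum_a cc a j * yy a k).
Definition cert_F (j : 'I_3) : 'M[C]_(2 ^ n.+1) :=
  \sum_k (n.+1%:R^-1 * cert_beta j k)%:C%C *: (rho_n th0 n.+1 *m tsum (L k) n).
Definition cert_Gam : 'M[C]_(2 ^ n.+1) :=
  \sum_a (n.+1%:R^-1 ^+ 2)%:C%C *: (adjmx (tsum (\sum_k yy a k *: L k) n) *m
    (rho_n th0 n.+1 *m tsum (\sum_k yy a k *: L k) n)).

Lemma sigma_adj k : adjmx (sigma R k) = sigma R k.
Proof.
by elim/ord3P: k; rewrite ?sigma_o0 ?sigma_o1 ?sigma_o2 mx2_adj; congr mx2;
  apply/eqP; rewrite eq_complex /= ?opprK ?oppr0 !eqxx.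
Qed.

Lemma rho_adj : adjmx (rho th0) = rho th0.
Proof. by have [[V ->] _] := rho_st; rewrite adjmxM adjmxK. Qed.

Lemma rn_adj : adjmx rn = rn.
Proof. by rewrite /rn /rho_n adjmx_ntens rho_adj. Qed.

(** [L k] need not be Hermitian, but rho times it is: rho L_k equals the adjoint of L_k times rho.
    This intertwining passes to the collective operators. *)
Lemma D_adj k : adjmx (D k) = D k.
Proof.
rewrite /D adjmxM rn_adj adjmx_tsum; apply: tsum_intertwine.
by rewrite -{1}rho_adj -adjmxM rhoL sigma_adj.
Qed.

Lemma rn_Lam a : rn *m tsum (Lam a) n = \sum_k yy a k *: D k.
Proof.
by rewrite /Lam tsum_sum mulmx_sumr; apply: eq_bigr => k _; rewrite -scalemxAr.
Qed.

Lemma Lam_rn a : adjmx (tsum (Lam a) n) *m rn = \sum_k (yy a k)^* *: D k.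
Proof.
rewrite -{1}rn_adj -adjmxM rn_Lam adjmx_sum; apply: eq_bigr => k _.
by rewrite adjmxZ D_adj.
Qed.

Let W a u : 'M[C]_(2 ^ n.+1) := (gam a u)%:M - (n.+1%:R^-1)%:C%C *: adjmx (tsum (Lam a) n).

Lemma W_expand a u : W a u *m rn *m adjmx (W a u) =
  (gam a u * (gam a u)^*) *: rn
  - (n.+1%:R^-1)%:C%C *: \sum_k (gam a u * yy a k + (gam a u * yy a k)^*) *: D k
  + (n.+1%:R^-1 ^+ 2)%:C%C *: (adjmx (tsum (Lam a) n) *m (rn *m tsum (Lam a) n)).
Proof.
set g := gam a u; set s := (n.+1%:R^-1)%:C%C.
have sJ : s^* = s by exact: conjc_real.
have -> : \sum_k (g * yy a k + (g * yy a k)^*) *: D k =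
    g *: (rn *m tsum (Lam a) n) + g^* *: (adjmx (tsum (Lam a) n) *m rn).
  rewrite rn_Lam Lam_rn !scaler_sumr -big_split; apply: eq_bigr => k _ /=.
  by rewrite scalerDl !scalerA rmorphM.
rewrite /W -/g -/s adjmxB adjmxZ adjmxK sJ.
have -> : adjmx (g%:M : 'M[C]_(2 ^ n.+1)) = (g^*)%:M.
  by rewrite -scalemx1 adjmxZ adjmx1 scalemx1.
rewrite rmorphXn /= -/s.
set T := tsum (Lam a) n; set T' := adjmx T.
rewrite mulmxBl mul_scalar_mx -scalemxAl mulmxBr mul_mx_scalar -scalemxAr.
rewrite mulmxBl -!scalemxAl -(mulmxA T').
move: (rn *m T) (T' *m rn) (T' *m (rn *m T)) => X Y Z.
by apply/matrixP=> i j; rewrite !mxE; ring.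
Qed.

(** Each summand is a congruence of the state by [W a u], whence positivity. The two conjugate
    linear terms of a summand combine into twice a real part, which is why [cert_beta] is real. *)
Lemma certificateE u : certificate rn G cert_F cert_Gam u = \sum_a W a u *m rn *m adjmx (W a u).
Proof.
under eq_bigr do rewrite W_expand.
rewrite big_split big_split /= /certificate; congr (_ + _ + _).
  by rewrite hG scaler_suml.
rewrite sumrN -scaler_sumr exchange_big /=.
rewrite -scaleN1r scalerA scaler_sumr.
transitivity (\sum_j \sum_k (- u 0 j * (n.+1%:R^-1 * cert_beta j k))%:C%C *: D k).
  apply: eq_bigr => j _; rewrite /cert_F scaler_sumr; apply: eq_bigr => k _.
  by rewrite scalerA -rmorphM.
rewrite exchange_big /=; apply: eq_bigr => k _.
rewrite -!scaler_suml scalerA; congr (_ *: _).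
have -> : \sum_a (gam a u * yy a k + (gam a u * yy a k)^*) =
    (\sum_j u 0 j * cert_beta j k)%:C%C.
  rewrite big_split /= -rmorph_sum /=; set z := \sum_a _.
  have -> : z + z^* = (2 * complex.Re z)%:C%C by rewrite addcJ rmorphM rmorph_nat.
  congr (_%:C)%C; rewrite /z /gam.
  transitivity (\sum_j \sum_a 2 * complex.Re (cc a j * (u 0 j)%:C%C * yy a k)).
    rewrite exchange_big /= Re_sum mulr_sumr; apply: eq_bigr => a _.
    by rewrite mulr_suml Re_sum mulr_sumr.
  apply: eq_bigr => j _; rewrite /cert_beta Re_sum !mulr_sumr; apply: eq_bigr => a _.
  by rewrite !ReM' !ImM' /=; ring.
rewrite mulN1r -rmorphN -rmorphM /= -rmorph_sum /=; congr (_%:C)%C.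
by rewrite mulr_sumr; apply: eq_bigr => j _; ring.
Qed.

Lemma certificate_ge0 (M : POVM R (2 ^ n.+1)) u A : measurable A ->
  0 <= pval M (certificate rn G cert_F cert_Gam u) A.
Proof.
move=> mA; rewrite certificateE pval_sum; apply: sumr_ge0 => a _.
have [[V rV] _] := state_ntens n.+1 rho_st.
rewrite /pval /rn /rho_n rV.
have -> : W a u *m (V *m adjmx V) *m adjmx (W a u) = (W a u *m V) *m adjmx (W a u *m V).
  by rewrite adjmxM !mulmxA.
by have [] := ge0C (trace_psdC_ge0 (W a u *m V) (povm_psd M mA)).
Qed.

Lemma tr_sigma k : \tr (sigma R k) = 0.
Proof.
by elim/ord3P: k; rewrite ?sigma_o0 ?sigma_o1 ?sigma_o2 mx2_tr;
  apply/eqP; rewrite eq_complex /= ?addr0 ?subrr !eqxx.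
Qed.

Lemma tr_D k : \tr (D k) = 0.
Proof. by rewrite /D /rn /rho_n tr_tsum ?rho_st.2 // rhoL tr_sigma mulr0. Qed.

(** The correlations between distinct copies vanish because rho L_k is traceless, so the second
    moment grows like n instead of n^2; the factor 1 / n^2 leaves 1 / n. *)
Lemma tr_cert_Gam : \tr cert_Gam =
  (n.+1%:R^-1)%:C%C * \sum_a \tr (rho th0 *m (Lam a *m adjmx (Lam a))).
Proof.
rewrite /cert_Gam linear_sum mulr_sumr; apply: eq_bigr => a _ /=.
rewrite mxtraceZ -/(Lam a) mxtrace_mulC -mulmxA adjmx_tsum /rho_n tr_tsum2 ?rho_st.2 //.
have -> : \tr (rho th0 *m Lam a) = 0.
  rewrite /Lam mulmx_sumr linear_sum big1 // => k _ /=.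
  by rewrite -scalemxAr mxtraceZ rhoL tr_sigma mulr0.
rewrite mul0r mulr0 addr0 mulrA; congr (_ * _).
rewrite -(rmorph_nat (real_complex R)) -rmorphM; congr (_%:C)%C.
by rewrite expr2 -mulrA mulVf ?mulr1 ?pnatr_eq0.
Qed.

End Certificate.

(** * States near the given point and lower bounds for their tensor powers *)

Section LowerBound.
Variable R : realType.
Local Notation C := R[i].
Local Notation o0 := (Ordinal (isT : 0 < 3)%N).
Local Notation o1 := (Ordinal (isT : 1 < 3)%N).
Local Notation o2 := (Ordinal (isT : 2 < 3)%N).
Local Notation "x +i* y" := (Complex x y) : ring_scope.

Lemma rho_state (th : 'rV[R]_3) : 0 < 1 + th 0 o2 ->
  th 0 o0 ^+ 2 + th 0 o1 ^+ 2 + th 0 o2 ^+ 2 <= 1 -> state (rho th).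
Proof.
move=> h1 h2; rewrite rhoE; split; last first.
  by rewrite mx2_tr; apply/eqP; rewrite eq_complex /=; apply/andP; split; apply/eqP; field.
set x := th 0 o0 in h2 *; set y := th 0 o1 in h2 *; set z := th 0 o2 in h1 h2 *.
pose al := Num.sqrt ((1 + z) / 2).
have al0 : al != 0 by rewrite gt_eqF // sqrtr_gt0; apply: divr_gt0.
have al2 : al * al = (1 + z) / 2.
  by rewrite -expr2 sqr_sqrtr // ltW //; apply: divr_gt0.
pose de := Num.sqrt ((1 - (x ^+ 2 + y ^+ 2 + z ^+ 2)) / (2 * (1 + z))).
have de2 : de * de = (1 - (x ^+ 2 + y ^+ 2 + z ^+ 2)) / (2 * (1 + z)).
  rewrite -expr2 sqr_sqrtr //; apply: divr_ge0; first by rewrite subr_ge0.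
  by rewrite ltW //; apply: mulr_gt0.
(* The lower triangular Cholesky factor: [al ^+ 2] is the upper left entry of rho, and [de ^+ 2] is
   the determinant divided by that entry. *)
exists (mx2 (al +i* 0) 0 ((x / 2 / al) +i* (y / 2 / al)) (de +i* 0)).
have z0 : 1 + z != 0 by rewrite gt_eqF.
rewrite mx2_adj mx2_mul; congr mx2; apply/eqP; rewrite eq_complex /=; apply/andP; split; apply/eqP.
- by rewrite -al2; ring.
- ring.
- by field.
- by field.
- by field.
- by field.
- have -> : x / 2 / al * (x / 2 / al) - y / 2 / al * - (y / 2 / al) + (de * de - 0 * - 0) =
     (x ^+ 2 + y ^+ 2) / (4 * (al * al)) + de * de by field.
  by rewrite al2 de2; field.
- by field.
Qed.

Lemma theta_r_entry (r : R) : [/\ theta_r r 0 o0 = 0, theta_r r 0 o1 = 0 & theta_r r 0 o2 = r].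
Proof. by split; rewrite mxE. Qed.

Lemma entry_le_norm (u : 'rV[R]_3) (e : R) j : `|u| < e -> `|u 0 j| < e.
Proof.
move=> ue; have : ball u e 0.
  by rewrite mx_norm_ball /ball_ /= subr0.
by move=> [_ /(_ 0 j)]; rewrite -ball_normE /= mxE subr0.
Qed.

Lemma near_rho_state (r : R) : 0 <= r < 1 ->
  exists2 e : R, 0 < e & forall th, `|th - theta_r r| < e -> state (rho th).
Proof.
(* The norm bounds each coordinate separately. With e = (1 - r) / 4 the squared Bloch length stays
   below (1 - 3 e)^2 + 2 e^2, which is at most 1. *)
case/andP=> r0 r1; exists ((1 - r) / 4); first by apply: divr_gt0 => //; rewrite subr_gt0.
move=> th hth.
have [t0 t1 t2] := theta_r_entry r.
have h j := entry_le_norm j hth.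
have := h o0; have := h o1; have := h o2.
have E j : (th - theta_r r) 0 j = th 0 j - theta_r r 0 j by rewrite !mxE.
rewrite !E t0 t1 t2 !subr0 !ltr_norml => /andP[a1 a2] /andP[b1 b2] /andP[c1 c2].
apply: rho_state; first by lra.
nra.
Qed.

Lemma ntens_diag_ge (A : 'M[C]_2) (l : R) k : 0 <= l ->
  (forall i j, i != j -> A i j = 0) -> (forall i, l%:C%C <= A i i) ->
  (forall i j, i != j -> (A ^t k.+1) i j = 0) /\
  (forall i, (l ^+ k.+1)%:C%C <= (A ^t k.+1) i i).
Proof.
move=> l0 A0 Al; elim: k => [//|k [IH1 IH2]].
have lk : 0 <= l ^+ k.+1 by apply: exprn_ge0.
split=> [i j ij|i]; rewrite ntensmxSr mxE.
  have [e1|e1] := eqVneq (mxtens_unindex i).1 (mxtens_unindex j).1; last by rewrite A0 // mul0r.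
  have [e2|e2] := eqVneq (mxtens_unindex i).2 (mxtens_unindex j).2; last by rewrite IH1 // mulr0.
  case/eqP: ij; rewrite -[LHS]mxtens_unindexK -[RHS]mxtens_unindexK; congr mxtens_index.
  by move: e1 e2; case: (mxtens_unindex i) => ? ?; case: (mxtens_unindex j) => ? ? /= -> ->.
rewrite exprS rmorphM; apply: ler_pM => //; rewrite ler0c //.
Qed.

(** The least eigenvalue of rho is (1 - r) / 2, positive since r < 1, and the constant is the
    inverse of its power. Its growth with [n] is harmless: densities are used for one [n] at a
    time. *)
Lemma rho_n_dominates (r : R) n : 0 <= r < 1 -> exists K : R,
  forall (M : POVM R (2 ^ n.+1)) A, measurable A ->
  complex.Re (\tr (M A)) <= K * pval M (rho_n (theta_r r) n.+1) A.
Proof.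
case/andP=> r0 r1; pose l := (1 - r) / 2.
have l0 : 0 < l by apply: divr_gt0 => //; rewrite subr_gt0.
have [||H1 H2] := @ntens_diag_ge (rho (theta_r r)) l n (ltW l0).
- by rewrite rho_rE; do 2!elim/ord2P => //; rewrite !mxE.
- rewrite rho_rE; elim/ord2P; rewrite !mxE /= lecE /= eqxx /= /l; lra.
exists (l ^+ n.+1)^-1 => M A mA; have Mp := povm_psd M mA.
rewrite ler_pdivlMl ?exprn_gt0 // /pval /mxtrace !Re_sum mulr_sumr.
apply: ler_sum => i _; rewrite mxE (bigD1 i) //= big1 ?addr0; last first.
  by move=> j ji; rewrite H1 ?mulr0.
have [Mi Mi0] := ge0C (psdC_diag_ge0 i Mp).
have := H2 i; rewrite lecE => /andP[_ h].
rewrite ReM' Mi0 mul0r subr0 mulrC; exact: ler_wpM2l.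
Qed.

End LowerBound.

(** * Triangular factorisation of [G] *)

Section Cholesky.
Variable R : realType.
Local Notation o0 := (Ordinal (isT : 0 < 3)%N).
Local Notation o1 := (Ordinal (isT : 1 < 3)%N).
Local Notation o2 := (Ordinal (isT : 2 < 3)%N).

Lemma det_Gtilde (G : 'M[R]_3) : G^T = G ->
  \det (Gtilde G) = G o0 o0 * G o1 o1 - G o0 o1 ^+ 2.
Proof.
move=> Gsym; have Gs01 : G o1 o0 = G o0 o1 by rewrite -[in LHS]Gsym mxE.
rewrite (expand_det_row _ ord0) sum2E /cofactor !det_mx11 !mxE /=.
have w0 h : widen_ord h (Ordinal (isT : 0 < 2)%N) = o0 by apply: val_inj.
have w1 h : widen_ord h (Ordinal (isT : 1 < 2)%N) = o1 by apply: val_inj.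
have -> : ord0 = Ordinal (isT : 0 < 2)%N by apply: val_inj.
have l0 : lift (Ordinal (isT : 0 < 2)%N) 0 = Ordinal (isT : 1 < 2)%N by apply: val_inj.
have l1 : lift (Ordinal (isT : 1 < 2)%N) 0 = Ordinal (isT : 0 < 2)%N by apply: val_inj.
by rewrite l0 l1 !w0 !w1 Gs01 /=; ring.
Qed.

Lemma GsE (G : 'M[R]_3) : Gs G = G o2 o2.
Proof. by rewrite /Gs; congr (G _ _); apply: val_inj. Qed.

Lemma qform_row3 (G : 'M[R]_3) x y z : G^T = G -> qform G (row3 x y z) =
  G o0 o0 * x ^+ 2 + G o1 o1 * y ^+ 2 + G o2 o2 * z ^+ 2 +
  2 * G o0 o1 * x * y + 2 * G o0 o2 * x * z + 2 * G o1 o2 * y * z.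
Proof.
move=> Gsym; have Gs i j : G i j = G j i by rewrite -[in LHS]Gsym mxE.
by rewrite qformE !sum3E !mxE /= (Gs o1 o0) (Gs o2 o0) (Gs o2 o1); ring.
Qed.

Lemma row3_neq0 (x y z : R) : x != 0 \/ y != 0 \/ z != 0 -> row3 x y z != 0.
Proof.
move=> h; apply/eqP => /rowP e.
have := e o0; have := e o1; have := e o2; rewrite !mxE /= => e2 e1 e0.
by move: h; rewrite e0 e1 e2 eqxx => -[|[]].
Qed.

(** The rows (p, q, h), (0, w, z), (0, 0, m) form an upper triangular T with G = T^T T; its leading
    2 x 2 block factors [Gtilde], so p w is the root of that determinant. *)
Lemma posdef_cholesky (G : 'M[R]_3) : posdefR G -> exists p q h w z m : R,
  [/\ [/\ G o0 o0 = p ^+ 2, G o0 o1 = p * q & G o0 o2 = p * h],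
      [/\ G o1 o1 = q ^+ 2 + w ^+ 2, G o1 o2 = q * h + w * z & G o2 o2 = h ^+ 2 + z ^+ 2 + m ^+ 2] &
      p * w = Num.sqrt (\det (Gtilde G))].
Proof.
move=> [Gsym Gpos].
have pos x y z : x != 0 \/ y != 0 \/ z != 0 -> 0 < qform G (row3 x y z).
  by move=> h; apply: Gpos; exact: row3_neq0.
have g00 : 0 < G o0 o0.
  by have := pos 1 0 0 (or_introl (oner_neq0 _)); rewrite qform_row3 //; lra.
pose p : R := Num.sqrt (G o0 o0); have p0 : 0 < p by rewrite sqrtr_gt0.
have p2 : G o0 o0 = p ^+ 2 by rewrite sqr_sqrtr // ltW.
have pn : p != 0 by rewrite gt_eqF.
pose q := G o0 o1 / p; pose h := G o0 o2 / p.
have e01 : G o0 o1 = p * q by rewrite /q mulrC divfK.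
have e02 : G o0 o2 = p * h by rewrite /h mulrC divfK.
have w2pos : 0 < G o1 o1 - q ^+ 2.
  (* This vector is annihilated by the first row of T, so the form at it is the Schur complement.
     The vector used for [m2] is annihilated by the first two rows. *)
  have := pos (- q / p) 1 0 (or_intror (or_introl (oner_neq0 _))).
  rewrite qform_row3 // p2 e01 e02.
  have -> : p ^+ 2 * (- q / p) ^+ 2 + G o1 o1 * 1 ^+ 2 + G o2 o2 * 0 ^+ 2 +
    2 * (p * q) * (- q / p) * 1 + 2 * (p * h) * (- q / p) * 0 + 2 * G o1 o2 * 1 * 0 =
    G o1 o1 - q ^+ 2 by field.
  by [].
pose w : R := Num.sqrt (G o1 o1 - q ^+ 2); have w0 : 0 < w by rewrite sqrtr_gt0.
have w2 : G o1 o1 = q ^+ 2 + w ^+ 2 by rewrite sqr_sqrtr ?(ltW w2pos) // addrC subrK.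
have wn : w != 0 by rewrite gt_eqF.
pose z := (G o1 o2 - q * h) / w.
have e12 : G o1 o2 = q * h + w * z by rewrite /z [w * _]mulrC divfK // addrC subrK.
have m2 : 0 <= G o2 o2 - h ^+ 2 - z ^+ 2.
  have := pos (- (q * (- z / w) + h) / p) (- z / w) 1 (or_intror (or_intror (oner_neq0 _))).
  rewrite qform_row3 // p2 e01 e02 e12 w2.
  move/ltW; congr (_ <= _); by field; rewrite pn wn.
exists p, q, h, w, z, (Num.sqrt (G o2 o2 - h ^+ 2 - z ^+ 2)); split; first by split.
  by split=> //; rewrite sqr_sqrtr //; ring.
rewrite det_Gtilde // p2 e01 w2.
have -> : p ^+ 2 * (q ^+ 2 + w ^+ 2) - (p * q) ^+ 2 = (p * w) ^+ 2 by ring.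
by rewrite sqrtr_sqr ger0_norm // ltW // mulr_gt0.
Qed.

End Cholesky.

Section LowerBoundN.
Variable R : realType.
Local Notation C := R[i].
Local Notation "x +i* y" := (Complex x y) : ring_scope.
Variables (r : R) (G : 'M[R]_3).
Hypothesis r01 : 0 <= r < 1.
Hypothesis Gp : posdefR G.

Let bound := \tr G - r ^+ 2 * Gs G + 2 * r * Num.sqrt (\det (Gtilde G)).

Lemma rho_Ltilde k : rho (theta_r r) *m Ltilde (theta_r r) k = sigma R k.
Proof. by rewrite /Ltilde mulmxA (invmx_rho r01) (rho_mul_inv r01) mul1mx. Qed.

(* With G = T^T T, T upper triangular, the rows of [cc] are T_1 - i T_2 and T_3; the rows of
   [yy] are the images of the conjugates under the inverse RLD Fisher matrix. *)
Lemma rld_certificate : exists cc yy : 'I_2 -> 'I_3 -> C,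
  [/\ forall u, (qform G u)%:C%C = \sum_a (\sum_j cc a j * (u 0 j)%:C%C) * (\sum_j cc a j * (u 0 j)%:C%C)^*,
      \sum_j cert_beta cc yy j j = 2 * bound &
      complex.Re (\sum_a \tr (rho (theta_r r) *m ((\sum_k yy a k *: Ltilde (theta_r r) k) *m
         adjmx (\sum_k yy a k *: Ltilde (theta_r r) k)))) = bound].
Proof.
have [p [q [h [w [z [m [[e00 e01 e02] [e11 e12 e22] epw]]]]]]] := posdef_cholesky Gp.
have bE : bound = p ^+ 2 + q ^+ 2 + w ^+ 2 + (1 - r ^+ 2) * (h ^+ 2 + z ^+ 2 + m ^+ 2) + 2 * r * (p * w).
  by rewrite /bound GsE /mxtrace sum3E e00 e11 e22 -epw; ring.
(* The sign of the imaginary unit matters: with T_1 + i T_2 the term 2 r p w would enter with a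
   minus sign, giving a weaker bound. *)
pose cc (a : 'I_2) (j : 'I_3) : C := if a == 0 :> nat
  then nth 0 [:: p +i* 0; q +i* - w; h +i* - z] j else nth 0 [:: 0; 0; m +i* 0] j.
pose yy (a : 'I_2) (j : 'I_3) : C := if a == 0 :> nat
  then nth 0 [:: (p + r * w) +i* - (r * q); q +i* (r * p + w); ((1 - r ^+ 2) * h) +i* ((1 - r ^+ 2) * z)] j
  else nth 0 [:: 0; 0; ((1 - r ^+ 2) * m) +i* 0] j.
exists cc, yy; split.
- move=> u; rewrite (row3E u) qform_row3 ?Gp.1 // sum2E !sum3E !mxE /=.
  rewrite e00 e01 e02 e11 e12 e22; move: (u 0 _) (u 0 _) (u 0 _) => x y t.
  by apply/eqP; rewrite eq_complex /=; apply/andP; split; apply/eqP; ring.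
- by rewrite sum3E /cert_beta !sum2E !ReD !ReM' /= bE; ring.
- have SE a : \sum_k yy a k *: Ltilde (theta_r r) k = rho_inv r *m (\sum_k yy a k *: sigma R k).
    rewrite mulmx_sumr; apply: eq_bigr => k _.
    by rewrite -scalemxAr /Ltilde (invmx_rho r01).
  have e a : rho (theta_r r) *m ((\sum_k yy a k *: Ltilde (theta_r r) k) *m
         adjmx (\sum_k yy a k *: Ltilde (theta_r r) k)) =
     (\sum_k yy a k *: sigma R k) *m adjmx (rho_inv r *m \sum_k yy a k *: sigma R k).
    by rewrite !SE !mulmxA (rho_mul_inv r01) mul1mx.
  have [r2 r1] : (1 + r != 0) /\ (1 - r != 0).
    by case/andP: r01 => *; split; apply/eqP; lra.
  rewrite sum2E !e !sum3E sigma_o0 sigma_o1 sigma_o2 !mx2_scale !mx2_add /rho_inv !mx2_mul !mx2_adj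
    !mx2_mul !mx2_tr /=.
  by rewrite bE /=; field; rewrite r1 r2.
Qed.

End LowerBoundN.

Lemma le_limn_einf (R : realType) (u : R^nat) (X : (\bar R)^nat) (l : R) :
  u @ \oo --> l -> (\forall n \near \oo, ((u n)%:E <= X n)%E) -> (l%:E <= limn_einf X)%E.
Proof.
move=> ul [N _ uX]; rewrite limn_einf_lim.
apply/lee_subgt0Pr => e e0.
apply: lime_ge; first exact: is_cvg_einfs.
have [N' _ hN'] : \forall n \near \oo, l - e <= u n.
  have /cvgr_dist_lt /(_ e e0) := ul.
  by apply: filterS => n; rewrite ltr_distlC => /andP[/ltW].
exists (maxn N N') => // m /=; rewrite geq_max => /andP[Nm N'm].
apply: le_ereal_inf_tmp => _ [k /= mk <-].
apply: le_trans (uX k (leq_trans Nm mk)).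
by rewrite -EFinB lee_fin; apply: hN'; exact: leq_trans mk.
Qed.

Section LowerBoundTheorem.
Variable R : realType.
Local Notation C := R[i].
Variables (r : R) (G : 'M[R]_3).
Hypothesis r01 : 0 <= r < 1.
Hypothesis Gp : posdefR G.
Let bound := \tr G - r ^+ 2 * Gs G + 2 * r * Num.sqrt (\det (Gtilde G)).

Lemma qform_ge0 v : 0 <= qform G v.
Proof.
have [->|v0] := eqVneq v 0; first by rewrite /qform !mul0mx mxE.
exact/ltW/Gp.2.
Qed.

Lemma fine_integral_dens_sum d (M : POVM R d) (rho0 : 'M[C]_d) (K : R)
  (mR mI : 'I_d -> 'I_d -> Omega R -> R) (h : Omega R -> R)
  (s : 'I_3 -> R) (B : 'I_3 -> 'M[C]_d) :
  (forall i j, measurable_fun setT (mR i j) /\ measurable_fun setT (mI i j)) ->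
  (forall i j x, `|mR i j x| <= K /\ `|mI i j x| <= K) ->
  (law M rho0).-integrable setT (EFin \o h) ->
  fine (\int[law M rho0]_x (h x * dens mR mI (\sum_k (s k)%:C%C *: B k) x)%:E) =
  \sum_k s k * fine (\int[law M rho0]_x (h x * dens mR mI (B k) x)%:E).
Proof.
move=> mm mK hi.
have iB k := integrable_mul_dens mm mK (B k) hi.
have e x : ((h x * dens mR mI (\sum_k (s k)%:C%C *: B k) x)%:E =
    \sum_k (s k)%:E * (h x * dens mR mI (B k) x)%:E)%E.
  under [RHS]eq_bigr do rewrite -EFinM; rewrite sumEFin; congr (_%:E).
  by rewrite !sum3E !densD !densZ; ring.
under eq_integral do rewrite e.
rewrite integral_sum //; last by move=> k; apply: integrableZl.
rewrite (eq_bigr (fun k => (s k * fine (\int[law M rho0]_x (h x * dens mR mI (B k) x)%:E))%:E)).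
  by rewrite sumEFin.
by move=> k _; rewrite integralZl // EFinM fineK //; exact: integrable_fin_num.
Qed.

Section Finite.
Variables (cc yy : 'I_2 -> 'I_3 -> C).
Hypothesis hG : forall u, (qform G u)%:C%C =
  \sum_a (\sum_j cc a j * (u 0 j)%:C%C) * (\sum_j cc a j * (u 0 j)%:C%C)^*.
Hypothesis htr : complex.Re (\sum_a \tr (rho (theta_r r) *m
  ((\sum_k yy a k *: Ltilde (theta_r r) k) *m
    adjmx (\sum_k yy a k *: Ltilde (theta_r r) k)))) = bound.

(** Multiplication by the number of copies cancels the factor 1 / n in [cert_F] and in the trace of
    [cert_Gam]; what remains depends on the estimator only through the matrix of derivatives of its
    mean. *)
Lemma lower_bound_n n (M : POVM R (2 ^ n.+1)) (e : R) : 0 < e ->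
  (forall th, `|th - theta_r r| < e -> forall j,
     (law M (rho_n th n.+1)).-integrable setT (fun x => (ovec x 0 j)%:E)) ->
  ((\sum_j \sum_k cert_beta cc yy j k * Amat M (theta_r r) j k - bound)%:E <=
   n.+1%:R%:E * trGV M (theta_r r) G)%E.
Proof.
move=> e0 hint.
have [e' e'0 hst] := near_rho_state r01.
have [K hK] := rho_n_dominates n r01.
set th0 := theta_r r in hint hst *.
have st0' : `|th0 - th0| < Num.min e e' by rewrite subrr normr0 lt_min e0 e'0.
have st0 : state (rho th0) by apply: hst; move: st0'; rewrite lt_min => /andP[].
have stn : state (rho_n th0 n.+1) := state_ntens n.+1 st0.
have [mR [mI [mm mK mE]]] := entry_density stn (hK M).
have i0 j : (law M (rho_n th0 n.+1)).-integrable setT (fun x => (ovec x 0 j)%:E).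
  by apply: hint; move: st0'; rewrite lt_min => /andP[].
have rhoL := rho_Ltilde r01.
have emin0 : 0 < Num.min e e' by rewrite lt_min e0 e'0.
have AE j k : Amat M th0 j k =
    fine (\int[law M (rho_n th0 n.+1)]_x
      (ovec x 0 j * dens mR mI (rho_n th0 n.+1 *m tsum (Ltilde th0 k) n) x)%:E).
  apply: (Amat_dens emin0 rhoL _ _ mm mK mE) => th; rewrite lt_min => /andP[h1 h2].
    exact: hst.
  exact: hint.
have iU j : (law M (rho_n th0 n.+1)).-integrable setT (fun x => ((ovec x - th0) 0 j)%:E).
  have -> : (fun x : Omega R => ((ovec x - th0) 0 j)%:E) =
     ((fun x => (ovec x 0 j)%R%:E) \- (EFin \o cst (th0 0 j)%R))%E.
    by apply/funext => x; rewrite mxE [X in _ + X]mxE.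
  apply: integrableB => //.
  by apply: (@bounded_integrable _ _ _ _ _ `|th0 0 j|) => //; exact: measurable_cst.
have main := certificate_integral stn mm mK mE
   (certificate_ge0 rhoL st0 yy hG M) iU qform_ge0.
have trF j : \tr (cert_F th0 (Ltilde th0) cc yy n j) = 0.
  rewrite /cert_F linear_sum big1 // => k _ /=.
  by rewrite mxtraceZ (tr_D rhoL st0) mulr0.
have UF j : fine (\int[law M (rho_n th0 n.+1)]_x
    ((ovec x - th0) 0 j * dens mR mI (cert_F th0 (Ltilde th0) cc yy n j) x)%:E) =
    \sum_k n.+1%:R^-1 * (cert_beta cc yy j k * Amat M th0 j k).
  set F := cert_F _ _ _ _ _ _.
  (* Centring at [th0] costs nothing: it adds a multiple of the trace of [cert_F], which is a
     combination of derivatives of a state of constant trace. *)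
  transitivity (fine (\int[law M (rho_n th0 n.+1)]_x (ovec x 0 j * dens mR mI F x)%:E)).
    have ex x : ((((ovec x - th0) 0 j * dens mR mI F x)%R)%:E =
      (ovec x 0 j * dens mR mI F x)%R%:E - (th0 0 j)%R%:E * (dens mR mI F x)%:E)%E.
      by rewrite -EFinM -EFinB mxE [X in _ + X]mxE mulrDl mulNr.
    under eq_integral do rewrite ex.
    rewrite integralB //; [|exact: (@integrable_mul_dens _ _ M _ K mR mI mm mK (fun x => ovec x 0
      j) F (i0 j))|by apply: integrableZl => //; exact: (integrable_dens M (rho_n th0 n.+1) mm mK F)].
    rewrite integralZl //; last exact: (integrable_dens M (rho_n th0 n.+1) mm mK F).
    rewrite (integral_dens mm mK mE) // /pval povm_total mul1mx trF.
    by rewrite mule0 sube0.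
  rewrite /F /cert_F (fine_integral_dens_sum _ _ mm mK (i0 j)).
  by apply: eq_bigr => k _; rewrite AE [RHS]mulrA.
have GamT : pval M (cert_Gam th0 (Ltilde th0) yy n) setT = n.+1%:R^-1 * bound.
  rewrite /pval povm_total mul1mx (tr_cert_Gam rhoL st0) ReM' /= mul0r subr0.
  by congr (_ * _).
move: main; rewrite GamT.
have -> : \sum_j fine (\int[law M (rho_n th0 n.+1)]_x
    ((ovec x - th0) 0 j * dens mR mI (cert_F th0 (Ltilde th0) cc yy n j) x)%:E) =
   n.+1%:R^-1 * \sum_j \sum_k cert_beta cc yy j k * Amat M th0 j k.
  rewrite mulr_sumr; apply: eq_bigr => j _.
  by rewrite mulr_sumr -UF.
rewrite -mulrBr => main.
have N0 : (0 : R) < n.+1%:R by rewrite ltr0n.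
have := lee_wpmul2l (_ : (0 <= n.+1%:R%:E)%E) main.
rewrite -EFinM mulrA divff ?gt_eqF // mul1r => h.
by apply: h; rewrite lee_fin ltW.
Qed.

End Finite.

Theorem lower_bound (M : forall n, POVM R (2 ^ n)) : asym_unbiased M (theta_r r) ->
  (bound%:E <= limn_einf (fun n => n%:R%:E * trGV (M n) (theta_r r) G))%E.
Proof.
move=> [hnear [_ hA]].
have [cc [yy [hG hbeta htr]]] := rld_certificate r01 Gp.
(* At the identity matrix the linear part contributes twice the bound and the constant part
   subtracts it once, as at the maximum of a linear term minus a square. *)
have limE : \sum_j \sum_k cert_beta cc yy j k * (j == k)%:R - bound = bound.
  rewrite (eq_bigr (fun j => cert_beta cc yy j j)) ?hbeta; first by rewrite /bound; ring.
  move=> j _; rewrite (bigD1 j) //= eqxx mulr1 big1 ?addr0 // => k kj.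
  by rewrite eq_sym (negbTE kj) mulr0.
have c j : (fun n => \sum_k cert_beta cc yy j k * Amat (M n) (theta_r r) j k) @ \oo -->
     \sum_k cert_beta cc yy j k * (j == k)%:R.
  under eq_cvg => n do rewrite sum3E.
  by rewrite sum3E; apply: cvgD; [apply: cvgD|]; apply: cvgMr; exact: hA.
have hlim : (fun n => \sum_j \sum_k cert_beta cc yy j k * Amat (M n) (theta_r r) j k - bound) @ \oo
    --> \sum_j \sum_k cert_beta cc yy j k * (j == k)%:R - bound.
  apply: cvgB; last exact: cvg_cst.
  under eq_cvg => n do rewrite sum3E.
  by rewrite sum3E; apply: cvgD; [apply: cvgD|]; exact: c.
rewrite limE in hlim; apply: le_limn_einf hlim _.
(* Starting from [N.+1] leaves out zero copies, for which there is no collective operator. *)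
have [N _ hN] := hnear; exists N.+1 => // -[//|n] /= Nn.
have [[e e0 hint] _] := hN n.+1 (ltnW Nn).
have h := lower_bound_n hG htr e0 hint. exact: h.
Qed.

End LowerBoundTheorem.

(** * Unsharp spin measurements *)

Section BinomialWindow.
Variable R : realType.

(** The amplitude of outcome [m] at weight [a], before normalisation. The guard is needed because
    truncated subtraction would give 'C(p, 0) = 1 for every m < a. *)
Definition window p m a : nat := if (a <= m)%N then 'C(p, m - a) else 0.

Lemma window_sum (g : nat -> R) p n a d : (a + d <= n)%N ->
  \sum_(m < (n + p).+1) g m * (window p m a * window p m (a + d))%:R =
  \sum_(k < p.+1) g (a + d + k)%N * ('C(p, k + d) * 'C(p, k))%:R.
Proof.
move=> adn; have e : (n + p).+1 = ((a + d) + (p.+1 + (n - (a + d))))%N by lia.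
rewrite -(big_mkord xpredT (fun m => g m * (window p m a * window p m (a + d))%:R)) e.
rewrite (big_cat_nat (n := (a + d)%N)) ?leq_addr //= big_nat_cond big1 ?add0r; last first.
  move=> m /andP[/andP[_ h] _]; rewrite /window [(a + d <= m)%N]leqNgt h /=.
  by rewrite muln0 mulr0.
rewrite -{1}[(a + d)%N]add0n big_addn addKn (big_cat_nat (n := p.+1)) ?leq_addr //=.
rewrite [X in _ + X]big_nat_cond [X in _ + X]big1 ?addr0; last first.
  move=> m /andP[/andP[h _] _]; rewrite /window leq_addl addnK (bin_small h).
  by rewrite muln0 mulr0.
rewrite big_mkord; apply: eq_bigr => k _; rewrite /window.
have -> : (a <= k + (a + d))%N by lia.
rewrite leq_addl addnK addnC; congr (_ * ('C(_, _) * _)%:R); lia.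
Qed.

(** The reflection k -> p - d - k exchanges the two binomials, so the overlap of two shifted windows
    is symmetric about its midpoint. *)
Lemma binomial_corr_sym (g : nat -> R) p d : (d <= p)%N ->
  \sum_(k < p.+1) g k * ('C(p, k + d) * 'C(p, k))%:R =
  \sum_(k < (p - d).+1) g (p - d - k)%N * ('C(p, k + d) * 'C(p, k))%:R.
Proof.
move=> dp; have e : p.+1 = ((p - d).+1 + d)%N by lia.
rewrite -(big_mkord xpredT (fun k => g k * ('C(p, k + d) * 'C(p, k))%:R)) e.
rewrite (big_cat_nat (n := (p - d).+1)) ?leq_addr //= addrC big_nat_cond big1 ?add0r; last first.
  by move=> k /andP[/andP[h _] _]; rewrite bin_small ?mul0n ?mulr0 //; lia.
rewrite big_mkord (reindex_inj rev_ord_inj); apply: eq_bigr => k _ /=.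
have kp := ltn_ord k.
have -> : ((p - d).+1 - k.+1 = p - d - k)%N by lia.
have -> : 'C(p, p - d - k + d) = 'C(p, k).
  by rewrite -bin_sub; [congr ('C(_, _)); lia | lia].
have -> : 'C(p, p - d - k) = 'C(p, k + d).
  by rewrite -bin_sub; [congr ('C(_, _)); lia | lia].
by rewrite mulnC.
Qed.

Lemma binomial_corr_trunc (g : nat -> R) p d : (d <= p)%N ->
  \sum_(k < p.+1) g k * ('C(p, k + d) * 'C(p, k))%:R =
  \sum_(k < (p - d).+1) g k * ('C(p, k + d) * 'C(p, k))%:R.
Proof.
move=> dp; have e : p.+1 = ((p - d).+1 + d)%N by lia.
rewrite -(big_mkord xpredT (fun k => g k * ('C(p, k + d) * 'C(p, k))%:R)) e.
rewrite (big_cat_nat (n := (p - d).+1)) ?leq_addr //= addrC big_nat_cond big1 ?add0r ?big_mkord //.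
by move=> k /andP[/andP[h _] _]; rewrite bin_small ?mul0n ?mulr0 //; lia.
Qed.

(** Reversing one binomial turns the correlation into a Vandermonde convolution. Its ratio to the
    value at d = 0 is the damping between weights that differ by [d]. *)
Lemma binomial_corr p d : (\sum_(k < p.+1) 'C(p, k + d) * 'C(p, k) = 'C(p + p, p + d))%N.
Proof.
have [pd|dp] := ltnP p d.
  rewrite big1 ?bin_small //; first lia.
  by move=> k _; rewrite bin_small //; lia.
have := @binomial_corr_trunc (fun=> 1) p d dp.
under eq_bigr do rewrite /= mul1r.
under [RHS]eq_bigr do rewrite /= mul1r.
rewrite -!natr_sum => /eqP; rewrite eqr_nat => /eqP ->.
have -> : 'C(p + p, p + d) = 'C(p + p, p - d).
  by rewrite -[LHS]bin_sub; [congr ('C(_, _)); lia | lia].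
rewrite -binomial.Vandermonde; apply: eq_bigr => k _; have kp := ltn_ord k.
rewrite mulnC; congr (_ * _)%N; rewrite -[LHS]bin_sub; last by lia.
by congr ('C(_, _)); lia.
Qed.

(** The summand is odd under the reflection of the overlap. The mean outcome between two weights
    therefore lies halfway, which produces anticommutators with the measured spin. *)
Lemma binomial_corr1 p d :
  \sum_(k < p.+1) (2 * k%:R + d%:R - p%:R : R) * ('C(p, k + d) * 'C(p, k))%:R = 0.
Proof.
have [pd|dp] := ltnP p d.
  by rewrite big1 // => k _; rewrite bin_small ?mul0n ?mulr0 //; lia.
have h1 := binomial_corr_sym (fun k => 2 * k%:R + d%:R - p%:R) dp.
have h2 := binomial_corr_trunc (fun k => 2 * k%:R + d%:R - p%:R) dp.
rewrite [LHS]h2 /=; have := etrans (esym h1) h2 => /=.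
rewrite (eq_bigr (fun k : 'I_(p - d).+1 =>
  - ((2 * k%:R + d%:R - p%:R) * ('C(p, k + d) * 'C(p, k))%:R))).
  by rewrite sumrN; set s := \sum_(k < _) _ => ?; lra.
move=> k _; have kp := ltn_ord k; by rewrite !natrB //; ring.
Qed.

(** Normalised by C(2p, p), the weights C(p, k)^2 form a hypergeometric law, whose variance is the
    noise added by the instrument. The identity k C(p, k) = p C(p - 1, k - 1) reduces the second
    moment to a Vandermonde sum at p - 1. *)
Lemma binomial_corr2 p :
  \sum_(k < p.+1) (k%:R - p%:R / 2 : R) ^+ 2 * ('C(p, k) * 'C(p, k))%:R =
  p%:R ^+ 2 / (4 * (2 * p%:R - 1)) * ('C(p + p, p))%:R.
Proof.
case: p => [|p].
  by rewrite big_ord_recl big_ord0 /= !mul0r subr0 expr0n /= !mul0r addr0.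
have S0 : \sum_(k < p.+2) ('C(p.+1, k) * 'C(p.+1, k))%:R = ('C(p.+1 + p.+1, p.+1))%:R :> R.
  rewrite -natr_sum; congr (_%:R); have := binomial_corr p.+1 0; rewrite addn0 => <-.
  by apply: eq_bigr => k _; rewrite addn0.
have S1 : \sum_(k < p.+2) k%:R * ('C(p.+1, k) * 'C(p.+1, k))%:R =
    p.+1%:R / 2 * ('C(p.+1 + p.+1, p.+1))%:R :> R.
  have := binomial_corr1 p.+1 0.
  under eq_bigr do rewrite addr0 mulrBl -mulrA addn0.
  rewrite sumrB -!mulr_sumr S0 => h; lra.
have S2 : \sum_(k < p.+2) k%:R ^+ 2 * ('C(p.+1, k) * 'C(p.+1, k))%:R =
    p.+1%:R ^+ 2 * ('C(p + p, p))%:R :> R.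
  rewrite big_ord_recl /= expr0n mul0r add0r.
  have := binomial_corr p 0; rewrite addn0 => <-.
  rewrite natr_sum mulr_sumr; apply: eq_bigr => k _; rewrite addn0.
  have e : ((bump 0 k)%:R * 'C(p.+1, bump 0 k)%:R = p.+1%:R * 'C(p, k)%:R :> R).
    by rewrite -!natrM mul_bin_diag.
  rewrite !natrM [LHS](_ : _ = ((bump 0 k)%:R * 'C(p.+1, bump 0 k)%:R) ^+ 2); last by ring.
  by rewrite e; ring.
have C2 : (p.+1%:R * ('C(p.+1 + p.+1, p.+1))%:R = 2 * (2 * p%:R + 1) * ('C(p + p, p))%:R :> R).
  have h1 := mul_bin_left (p + p).+2 p; have h2 := mul_bin_down (p + p).+2 p.
  have h3 := mul_bin_down (p + p).+1 p.
  have -> : (p.+1 + p.+1 = (p + p).+2)%N by lia.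
  rewrite /= in h2 h3.
  have e1 : ((p + p).+2 - p = p.+2)%N by lia.
  have e2 : ((p + p).+1 - p = p.+1)%N by lia.
  rewrite e1 in h1 h2; rewrite e2 in h3.
  have {}h1 := congr1 (fun n => n%:R : R) h1; have {}h2 := congr1 (fun n => n%:R : R) h2.
  have {}h3 := congr1 (fun n => n%:R : R) h3; rewrite !natrM in h1 h2 h3.
  have p2 : (p.+1%:R : R) != 0 by rewrite pnatr_eq0.
  apply: (mulfI p2); rewrite h1 -h2 mulrA [p.+1%:R * _]mulrC mulrA.
  rewrite [RHS](_ : _ = 2 * p.+1%:R * ((p + p).+1%:R * ('C(p + p, p))%:R)); last first.
    by rewrite -!natr1 natrD; ring.
  by rewrite h3 -!natr1 natrD; ring.
rewrite (eq_bigr (fun k : 'I_p.+2 => k%:R ^+ 2 * ('C(p.+1, k) * 'C(p.+1, k))%:R -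
   p.+1%:R * (k%:R * ('C(p.+1, k) * 'C(p.+1, k))%:R) +
   (p.+1%:R / 2) ^+ 2 * ('C(p.+1, k) * 'C(p.+1, k))%:R)); last by move=> k _; field.
rewrite big_split /= sumrB -!mulr_sumr S0 S1 S2.
have d0 : 2 * p.+1%:R - 1 != 0 :> R.
  by rewrite -natr1; apply/eqP; have : 0 <= p%:R :> R by []; lra.
have -> : ('C(p + p, p))%:R = p.+1%:R * ('C(p.+1 + p.+1, p.+1))%:R / (2 * (2 * p.+1%:R - 1)) :> R.
  by rewrite C2 -natr1; field; move: d0; rewrite -natr1 => d0; apply: contraNneq d0 => h; apply/eqP; lra.
by field.
Qed.

Lemma binomial_ratio1 p : ('C(p + p, p + 1))%:R = p%:R / p.+1%:R * ('C(p + p, p))%:R :> R.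
Proof.
have h := congr1 (fun n => n%:R : R) (mul_bin_left (p + p) p).
rewrite addnK !natrM in h; have p1 : (p.+1%:R : R) != 0 by rewrite pnatr_eq0.
by apply: (mulfI p1); rewrite addn1 h; field.
Qed.

Lemma binomial_ratio2 p : ('C(p + p, p + 2))%:R =
  p%:R * (p%:R - 1) / (p.+1%:R * p.+2%:R) * ('C(p + p, p))%:R :> R.
Proof.
have h := congr1 (fun n => n%:R : R) (mul_bin_left (p + p) p.+1).
rewrite !natrM in h; have p1 : (p.+2%:R : R) != 0 by rewrite pnatr_eq0.
have p0 : (p.+1%:R : R) != 0 by rewrite pnatr_eq0.
apply: (mulfI p1); have br := binomial_ratio1 p; rewrite addn1 in br.
rewrite addn2 h br {h br}.
case: p p1 p0 => [|p] p1 p0; first by rewrite !mul0r !mulr0.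
have -> : (p.+1 + p.+1 - p.+2 = p)%N by lia.
move: p1 p0; rewrite -!natr1; have : 0 <= p%:R :> R by [].
move: (p%:R : R) => x x0 p1 p0; field.
by apply/andP; split; apply/eqP; lra.
Qed.

End BinomialWindow.

(** * Instruments with binomial windows for a diagonal spin *)

Section FuzzyMeasurement.
Variable R : realType.
Local Notation C := R[i].

Definition ad N (X B : 'M[C]_N) := X *m B - B *m X.

(* Unsharp measurement of [J] with Kraus operators [K] and outcomes [y]: operators of weight 1 (2)
   for [J] are damped by [c1] ([c2]), and [s2] is the added variance. *)
Definition fuzzy N (J : 'M[C]_N) q (K : 'I_q -> 'M[C]_N) (y : 'I_q -> R) (c1 c2 s2 : R) : Prop :=
  [/\ forall m, adjmx (K m) = K m,
      forall B, ad J B = 0 -> \sum_m K m *m B *m K m = B,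
      forall B, ad J (ad J B) = B -> \sum_m K m *m B *m K m = c1%:C%C *: B /\
        \sum_m (y m)%:C%C *: (K m *m B *m K m) = (c1 / 2)%:C%C *: (J *m B + B *m J),
      forall B, ad J (ad J B) = 4 *: B -> \sum_m K m *m B *m K m = c2%:C%C *: B &
      \sum_m (y m)%:C%C *: (K m *m K m) = J /\
      \sum_m (y m ^+ 2)%:C%C *: (K m *m K m) = J *m J + (s2%:C%C)%:M].

Lemma fuzzy_conj N (J U V : 'M[C]_N) q (K : 'I_q -> 'M[C]_N) y c1 c2 s2 :
  U *m V = 1%:M -> V *m U = 1%:M -> adjmx U = V -> fuzzy J K y c1 c2 s2 ->
  fuzzy (U *m J *m V) (fun m => U *m K m *m V) y c1 c2 s2.
Proof.
move=> UV VU UA [hK h0 h1 h2 [h3 h4]].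
have VA : adjmx V = U by rewrite -UA adjmxK.
pose g (B : 'M[C]_N) := U *m B *m V; pose f (B : 'M[C]_N) := V *m B *m U.
have gf B : g (f B) = B by rewrite /g /f !mulmxA UV mul1mx -mulmxA UV mulmx1.
have fg B : f (g B) = B by rewrite /g /f !mulmxA VU mul1mx -mulmxA VU mulmx1.
have gM B B' : g B *m g B' = g (B *m B').
  by rewrite /g -!mulmxA (mulmxA V U) VU mul1mx.
have gD B B' : g (B + B') = g B + g B' by rewrite /g mulmxDr mulmxDl.
have gB B B' : g (B - B') = g B - g B' by rewrite /g mulmxBr mulmxBl.
have gZ a B : g (a *: B) = a *: g B by rewrite /g -scalemxAr -scalemxAl.
have gS (B : 'I_q -> 'M[C]_N) : g (\sum_m B m) = \sum_m g (B m).
  by rewrite /g mulmx_sumr mulmx_suml.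
have gad B : ad (g J) B = g (ad J (f B)) by rewrite /ad gB -2!gM gf.
have gK B : \sum_m g (K m) *m B *m g (K m) = g (\sum_m K m *m f B *m K m).
  by rewrite gS; apply: eq_bigr => m _; rewrite -2!gM gf.
split.
- by move=> m; rewrite !adjmxM hK UA VA mulmxA.
- move=> B; rewrite -/(g J) gad => e; rewrite gK h0 ?gf //.
  by rewrite -[LHS]fg e /f mulmx0 mul0mx.
- move=> B; rewrite -/(g J) !gad fg => e.
  have e' : ad J (ad J (f B)) = f B by rewrite -[LHS]fg e.
  have [e1 e2] := h1 _ e'; split; first by rewrite gK e1 gZ gf.
  transitivity (g (\sum_m (y m)%:C%C *: (K m *m f B *m K m))).
    by rewrite gS; apply: eq_bigr => m _; rewrite gZ -2!gM gf.
  by rewrite e2 gZ gD -2!gM gf.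
- move=> B; rewrite -/(g J) !gad fg => e.
  have e' : ad J (ad J (f B)) = 4 *: f B.
    by rewrite -[LHS]fg e /f -scalemxAr -scalemxAl.
  by rewrite gK (h2 _ e') gZ gf.
- split.
    by rewrite -[in RHS]h3 -/(g _) gS; apply: eq_bigr => m _; rewrite gZ -gM.
  have -> : U *m J *m V *m (U *m J *m V) + (s2%:C%C)%:M = g (J *m J + (s2%:C%C)%:M).
    by rewrite gD -gM -scalemx1 gZ /g mulmx1 UV scalemx1.
  by rewrite -h4 gS; apply: eq_bigr => m _; rewrite gZ -gM.
Qed.

Section Diagonal.
Variables (N n p : nat) (d : 'I_N -> nat).
Hypothesis dn : forall i, (d i <= n)%N.
(** The outcome is centred: [p / 2] is the middle of the window and [n / 2] the middle of the range
    of weights. *)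
Let y (m : nat) : R := m%:R - p%:R / 2 - n%:R / 2.
Let c0 : R := ('C(p + p, p))%:R.
Let kap (m : nat) i : R := (window p m (d i))%:R / Num.sqrt c0.
Let D (i : 'I_N) : R := (d i)%:R - n%:R / 2.
Let J : 'M[C]_N := diag_mx (\row_i (D i)%:C%C).
Let K (m : 'I_(n + p).+1) : 'M[C]_N := diag_mx (\row_i (kap m i)%:C%C).

Let c0_gt0 : 0 < c0.
Proof. by rewrite ltr0n bin_gt0 leq_addr. Qed.

Let wsum (g : nat -> R) a b := \sum_(m < (n + p).+1) g m * (window p m a * window p m b)%:R.

Lemma kap_sum (g : nat -> R) i j :
  \sum_(m < (n + p).+1) g m * (kap m i * kap m j) = wsum g (d i) (d j) / c0.
Proof.
rewrite /wsum mulr_suml; apply: eq_bigr => m _; rewrite /kap natrM.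
have s0 : Num.sqrt c0 != 0 by rewrite gt_eqF // sqrtr_gt0.
rewrite -[in RHS](sqr_sqrtr (ltW c0_gt0)).
by move: (Num.sqrt c0 : R) s0 => s s0; field.
Qed.

Lemma wsumC g a b : wsum g a b = wsum g b a.
Proof. by apply: eq_bigr => m _; rewrite mulnC. Qed.

Lemma wsum0 a e : (a + e <= n)%N -> wsum (fun=> 1) a (a + e) = ('C(p + p, p + e))%:R.
Proof.
move=> h; rewrite /wsum (window_sum (fun=> 1)) // -(binomial_corr R p e) natr_sum.
by apply: eq_bigr => k _; rewrite mul1r.
Qed.

Lemma wsum1 a e : (a + e <= n)%N ->
  wsum y a (a + e) = (a%:R + e%:R / 2 - n%:R / 2) * ('C(p + p, p + e))%:R.
Proof.
move=> h; rewrite /wsum window_sum // -(binomial_corr R p e) natr_sum mulr_sumr.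
apply/eqP; rewrite -subr_eq0 -sumrB.
rewrite (eq_bigr (fun k : 'I_p.+1 =>
  2^-1 * ((2 * k%:R + e%:R - p%:R) * ('C(p, k + e) * 'C(p, k))%:R))).
  by rewrite -mulr_sumr binomial_corr1 mulr0.
by move=> k _; rewrite /y !natrD; field.
Qed.

Lemma wsum2 a : (a <= n)%N -> wsum (fun m => y m ^+ 2) a a =
  ((a%:R - n%:R / 2) ^+ 2 + p%:R ^+ 2 / (4 * (2 * p%:R - 1))) * c0.
Proof.
move=> h; have -> : wsum (fun m => y m ^+ 2) a a = wsum (fun m => y m ^+ 2) a (a + 0) by rewrite addn0.
rewrite /wsum (window_sum (fun m => y m ^+ 2)) ?addn0 //.
rewrite mulrDl -binomial_corr2 /c0.
have e0 := binomial_corr R p 0; rewrite addn0 in e0; rewrite -e0 natr_sum mulr_sumr -big_split /=.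
apply/eqP; rewrite -subr_eq0 -sumrB.
rewrite (eq_bigr (fun k : 'I_p.+1 =>
  (a%:R - n%:R / 2) * ((2 * k%:R + 0%:R - p%:R) * ('C(p, k + 0) * 'C(p, k))%:R))).
  by rewrite -mulr_sumr binomial_corr1 mulr0.
by move=> k _; rewrite /y !addn0 natrD; field.
Qed.

Lemma diagKBK m B i j : (K m *m B *m K m) i j = (kap m i * kap m j)%:C%C * B i j.
Proof.
rewrite mul_mx_diag mxE mul_diag_mx !mxE (rmorphM (real_complex R) (kap m i) (kap m j)) /=; ring.
Qed.

Lemma ad_diag B i j : ad J B i j = ((d i)%:R - (d j)%:R) * B i j.
Proof.
rewrite /ad mul_diag_mx mul_mx_diag !mxE /D !rmorphB /= !rmorph_nat; ring.
Qed.

Lemma diag_sum (g : nat -> R) B i j :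
  (\sum_(m < (n + p).+1) (g m)%:C%C *: (K m *m B *m K m)) i j = (wsum g (d i) (d j) / c0)%:C%C * B i j.
Proof.
rewrite summxE -kap_sum rmorph_sum mulr_suml; apply: eq_bigr => m _.
by rewrite scalemxE diagKBK mulrA -rmorphM.
Qed.

(* [B i j] vanishes unless the weights of [i] and [j] differ by exactly [e]. *)
Lemma wsum_shift e B i j : ad J (ad J B) = (e%:R ^+ 2) *: B ->
  B i j = 0 \/ [/\ wsum (fun=> 1) (d i) (d j) = ('C(p + p, p + e))%:R &
    wsum y (d i) (d j) = ((D i + D j) / 2) * ('C(p + p, p + e))%:R].
Proof.
move=> h; have := congr1 (fun M : 'M[C]_N => M i j) h.
rewrite !ad_diag scalemxE mulrA => /eqP; rewrite -subr_eq0 -mulrBl mulf_eq0.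
case/orP => [|/eqP ->]; last by left.
rewrite -expr2 subr_eq0 eqf_sqr => de; right.
have [dij|dji] : d i = (d j + e)%N \/ d j = (d i + e)%N.
  case/orP: de => /eqP de; [left|right]; apply/eqP.
    by rewrite -(eqr_nat C) natrD -de addrC subrK.
  by rewrite -(eqr_nat C) natrD -[e%:R]opprK -de opprB addrC subrK.
- rewrite wsumC [wsum y _ _]wsumC /D !dij wsum0 ?wsum1 -?dij //; split=> //.
  by rewrite dij natrD; field.
- rewrite /D !dji wsum0 ?wsum1 -?dji //; split=> //.
  by rewrite dji natrD; field.
Qed.

(** Summed over outcomes, conjugation by the diagonal Kraus operators multiplies each entry by a
    window overlap, which depends only on the difference of the two weights. The equations for
    [ad J] force this difference to be 0, 1 or 2 on nonzero entries, so each of these classes is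
    multiplied by one constant. *)
Lemma fuzzy_diag : fuzzy J K y (p%:R / p.+1%:R)
  (p%:R * (p%:R - 1) / (p.+1%:R * p.+2%:R)) (p%:R ^+ 2 / (4 * (2 * p%:R - 1))).
Proof.
have c0n : c0 != 0 by rewrite gt_eqF.
have sum1 B : \sum_m K m *m B *m K m =
    \sum_(m < (n + p).+1) ((fun=> 1 : R) (m : nat))%:C%C *: (K m *m B *m K m).
  by apply: eq_bigr => m _; rewrite scale1r.
have sumKK (g : nat -> R) : \sum_(m < (n + p).+1) (g m)%:C%C *: (K m *m K m) =
    \sum_(m < (n + p).+1) (g m)%:C%C *: (K m *m 1%:M *m K m).
  by apply: eq_bigr => m _; rewrite mulmx1.
have id0 : ad J (ad J 1%:M) = (0%:R ^+ 2) *: 1%:M.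
  by rewrite /ad mulmx1 mul1mx subrr mulmx0 mul0mx subrr expr0n scale0r.
split.
- by move=> m; rewrite /K /adjmx map_diag_mx tr_diag_mx; congr diag_mx; apply/rowP => i;
    rewrite !mxE; exact: conjc_real.
- move=> B h; apply/matrixP => i j; rewrite sum1 (diag_sum (fun=> 1)).
  have h' : ad J (ad J B) = (0%:R ^+ 2) *: B.
    by rewrite h /ad mulmx0 mul0mx subrr expr0n scale0r.
  have [->|[-> _]] := wsum_shift i j h'; first by rewrite mulr0.
  by rewrite addn0 divff // mul1r.
- move=> B h; have h' : ad J (ad J B) = (1%:R ^+ 2) *: B by rewrite expr1n scale1r.
  split; apply/matrixP => i j.
    rewrite sum1 (diag_sum (fun=> 1)) scalemxE.
    have [->|[-> _]] := wsum_shift i j h'; first by rewrite !mulr0.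
    by rewrite binomial_ratio1 mulfK.
  rewrite diag_sum scalemxE addmxE mul_diag_mx mul_mx_diag !mxE.
  have [->|[_ ->]] := wsum_shift i j h'; first by rewrite !(mulr0, mul0r, addr0).
  rewrite binomial_ratio1 mulrA mulfK // [B i j * _]mulrC -mulrDl mulrA -rmorphD -rmorphM /=.
  have p1 : p.+1%:R != 0 :> R by rewrite pnatr_eq0.
  by congr (_%:C%C * _); move: (p.+1%:R : R) p1 => x x0; field.
- move=> B h; have h' : ad J (ad J B) = (2%:R ^+ 2) *: B by rewrite h -natrX.
  apply/matrixP => i j; rewrite sum1 (diag_sum (fun=> 1)) scalemxE.
  have [->|[-> _]] := wsum_shift i j h'; first by rewrite !mulr0.
  by rewrite binomial_ratio2 mulfK.
- have DJ i : J i i = (D i)%:C%C by rewrite !mxE eqxx mulr1n.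
  split; apply/matrixP => i j.
    rewrite (sumKK y) diag_sum; have [ij|ij] := eqVneq i j; last first.
      by rewrite !mxE (negbTE ij) mulr0n mulr0.
    have dd : d j = (d j + 0)%N by rewrite addn0.
    rewrite ij DJ {1 2}dd /= [wsum y _ _](_ : _ = D j * c0).
      by rewrite mulfK // mxE eqxx mulr1.
    by rewrite addn0 {2}dd wsum1 ?addn0 // /D /c0; field.
  rewrite (sumKK (fun m => y m ^+ 2)) (diag_sum (fun m => y m ^+ 2)); have [ij|ij] := eqVneq i j; last first.
    by rewrite mul_diag_mx !mxE (negbTE ij) !mulr0n !mulr0 addr0.
  rewrite ij wsum2 // mulfK // mul_diag_mx addmxE !mxE eqxx !mulr1n mulr1.
  by rewrite (rmorphD (real_complex R)) /= (expr2 (_ - _)) (rmorphM (real_complex R)).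
Qed.

End Diagonal.

End FuzzyMeasurement.

(** * Collective spins along arbitrary axes and their su(2) relations *)

Section Axes.
Variable R : realType.
Local Notation C := R[i].
Local Notation o0 := (Ordinal (isT : 0 < 3)%N).
Local Notation o1 := (Ordinal (isT : 1 < 3)%N).
Local Notation o2 := (Ordinal (isT : 2 < 3)%N).
Local Notation "x +i* y" := (Complex x y) : ring_scope.

(** [d i] is the number of factors in which the basis vector [i] has the eigenvalue 1/2. *)
Lemma tsum_sigma3_diag k : exists d : 'I_(2 ^ k.+1) -> nat, (forall i, (d i <= k.+1)%N) /\
  tsum (sigma R o2) k = diag_mx (\row_i ((d i)%:R - k.+1%:R / 2)%:C%C).
Proof.
elim: k => [|k [d [dk IH]]].
  exists (fun i : 'I_2 => (i == 0 :> nat) : nat); split; first by move=> i; case: eqP.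
  rewrite /= sigma_o2; apply/matrixP; do 2!elim/ord2P; rewrite !mxE //= ?mulr1n ?mulr0n //;
    by apply/eqP; rewrite eq_complex /=; apply/andP; split; apply/eqP; lra.
exists (fun i => ((mxtens_unindex i).1 == 0 :> nat) + d (mxtens_unindex i).2)%N.
split=> [i|]; first by rewrite -[k.+2]add1n leq_add ?leq_b1.
rewrite tsumS IH sigma_o2; apply/matrixP => i j.
case: (mxtens_indexP i) => i0 i1; case: (mxtens_indexP j) => j0 j1.
rewrite mxE !tensmxE !mxE !mxtens_indexK /=.
rewrite (can_eq (@mxtens_indexK 2 (2 ^ k.+1))) xpair_eqE.
have [_|_] := eqVneq i1 j1; last by rewrite andbF !mulr0n !mulr0 addr0.
have [<-|ij0] := eqVneq i0 j0; last first.
  rewrite /= !mulr0n mul0r addr0 mulr1n mulr1.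
  by elim/ord2P: i0 ij0; elim/ord2P: j0.
rewrite /= !mulr1n mul1r mulr1 natrD.
elim/ord2P: i0 => /=; apply/eqP; rewrite eq_complex /=; apply/andP; split; apply/eqP;
  by rewrite -?[k.+2%:R]natr1; lra.
Qed.

Definition sigma_axis (u1 u2 : R) : 'M[C]_2 := u1%:C%C *: sigma R o0 + u2%:C%C *: sigma R o1.

Lemma fuzzy_z k p : exists (K : 'I_(k.+1 + p).+1 -> 'M[C]_(2 ^ k.+1)) (y : 'I_(k.+1 + p).+1 -> R),
  fuzzy (tsum (sigma R o2) k) K y (p%:R / p.+1%:R)
    (p%:R * (p%:R - 1) / (p.+1%:R * p.+2%:R)) (p%:R ^+ 2 / (4 * (2 * p%:R - 1))).
Proof.
have [d [dk ->]] := tsum_sigma3_diag k.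
by do 2!eexists; exact: (fuzzy_diag R p dk).
Qed.

Lemma sigma_axis_conj (u1 u2 : R) : u1 ^+ 2 + u2 ^+ 2 = 1 -> exists U V : 'M[C]_2,
  [/\ U *m V = 1%:M, V *m U = 1%:M, adjmx U = V & sigma_axis u1 u2 = U *m sigma R o2 *m V].
Proof.
move=> u12.
have [s ss] : exists s : R, s * s = 2^-1.
  by exists (Num.sqrt 2^-1); rewrite -expr2 sqr_sqrtr // invr_ge0.
have e1 : u1 * u1 = 1 - u2 * u2 by rewrite -u12; ring.
(* The columns are the normalised eigenvectors (1, u1 + i u2) and (1, - u1 - i u2) of the axis
   operator, and [s] is 1 / sqrt 2. *)
pose U : 'M[C]_2 := mx2 (s +i* 0) (s +i* 0) ((s * u1) +i* (s * u2)) (- (s * u1) +i* - (s * u2)).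
pose V : 'M[C]_2 := mx2 (s +i* 0) ((s * u1) +i* - (s * u2)) (s +i* 0) (- (s * u1) +i* (s * u2)).
have mul4 (x y z t : R) : x * y * (z * t) = x * z * (y * t) by ring.
exists U, V; split.
- rewrite /U /V mx2_mul mx2_1; congr mx2; apply/eqP; rewrite eq_complex /=; apply/andP; split; apply/eqP;
    try ring.
  + by rewrite mulr0 subr0 ss; field.
  + rewrite [LHS](_ : _ = 2 * (s * s) * (u1 * u1 + u2 * u2)); last by ring.
    by rewrite ss e1; field.
- rewrite /U /V mx2_mul mx2_1; congr mx2; apply/eqP; rewrite eq_complex /=; apply/andP; split; apply/eqP;
    try ring.
  + rewrite [LHS](_ : _ = (s * s) * (1 + (u1 * u1 + u2 * u2))); last by ring.
    by rewrite ss e1; field.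
  + rewrite [LHS](_ : _ = (s * s) * (1 - (u1 * u1 + u2 * u2))); last by ring.
    by rewrite e1; ring.
  + rewrite [LHS](_ : _ = (s * s) * (1 - (u1 * u1 + u2 * u2))); last by ring.
    by rewrite e1; ring.
  + rewrite [LHS](_ : _ = (s * s) * (1 + (u1 * u1 + u2 * u2))); last by ring.
    by rewrite ss e1; field.
- by rewrite /U /V mx2_adj; congr mx2; apply/eqP; rewrite eq_complex /= ?oppr0 ?opprK !eqxx.
- rewrite /sigma_axis sigma_o0 sigma_o1 sigma_o2 /U /V !mx2_scale mx2_add !mx2_mul.
  congr mx2; apply/eqP; rewrite eq_complex /=; apply/andP; split; apply/eqP; try ring.
  + rewrite [RHS](_ : _ = (s * s) * u1); last by field.
    by rewrite ss; field.
  + rewrite [RHS](_ : _ = - (s * s) * u2); last by field.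
    by rewrite ss; field.
  + rewrite [RHS](_ : _ = (s * s) * u1); last by field.
    by rewrite ss; field.
  + rewrite [RHS](_ : _ = (s * s) * u2); last by field.
    by rewrite ss; field.
Qed.

Lemma fuzzy_axis (u1 u2 : R) k p : u1 ^+ 2 + u2 ^+ 2 = 1 ->
  exists (K : 'I_(k.+1 + p).+1 -> 'M[C]_(2 ^ k.+1)) (y : 'I_(k.+1 + p).+1 -> R),
  fuzzy (tsum (sigma_axis u1 u2) k) K y (p%:R / p.+1%:R)
    (p%:R * (p%:R - 1) / (p.+1%:R * p.+2%:R)) (p%:R ^+ 2 / (4 * (2 * p%:R - 1))).
Proof.
move=> /sigma_axis_conj [U [V [UV VU UA ->]]].
have [K [y Kf]] := fuzzy_z k p.
rewrite (tsum_conj _ _ UV).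
do 2!eexists; apply: fuzzy_conj Kf.
- by rewrite ntensmx_mul UV ntensmx_id.
- by rewrite ntensmx_mul VU ntensmx_id.
- by rewrite adjmx_ntens UA.
Qed.

Section Su2.
Variables (N : nat) (X Y Z : 'M[C]_N).
Local Notation ii := ('i%C : C).
Hypotheses (XY : ad X Y = ii *: Z) (ZX : ad Z X = ii *: Y).

Lemma adD (A B B' : 'M[C]_N) : ad A (B + B') = ad A B + ad A B'.
Proof. by rewrite /ad mulmxDr mulmxDl opprD addrACA. Qed.

Lemma adZ a (A B : 'M[C]_N) : ad A (a *: B) = a *: ad A B.
Proof. by rewrite /ad -scalemxAr -scalemxAl scalerBr. Qed.

Lemma adC (A B : 'M[C]_N) : ad A B = - ad B A.
Proof. by rewrite /ad opprB. Qed.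

Lemma adM (A B B' : 'M[C]_N) : ad A (B *m B') = ad A B *m B' + B *m ad A B'.
Proof. by rewrite /ad mulmxBl mulmxBr !mulmxA addrA subrK. Qed.

Lemma mulii : ii * ii = -1.
Proof. by rewrite -expr2 sqr_i. Qed.

Let XZ : ad X Z = - ii *: Y.
Proof. by rewrite adC ZX scaleNr. Qed.

Lemma su2_ad2_Y : ad X (ad X Y) = Y.
Proof. by rewrite XY adZ XZ scalerA mulrN mulii opprK scale1r. Qed.

Lemma su2_ad2_Z : ad X (ad X Z) = Z.
Proof. by rewrite XZ adZ XY scalerA mulNr mulii opprK scale1r. Qed.

(** Invariance of Y^2 + Z^2 under rotations about the X axis: an instrument for X leaves it
    unchanged. *)
Lemma su2_ad_sum : ad X (Y *m Y + Z *m Z) = 0.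
Proof.
rewrite adD !adM XY XZ -!scalemxAl -!scalemxAr.
move: (Z *m Y) (Y *m Z) => P Q; apply/matrixP => i j; rewrite !mxE; ring.
Qed.

(** Y and Z have weights plus or minus 1 for X, and in the difference of their squares only the
    weights plus or minus 2 survive. *)
Lemma su2_ad2_diff : ad X (ad X (Y *m Y - Z *m Z)) = 4 *: (Y *m Y - Z *m Z).
Proof.
have e : ad X (Y *m Y - Z *m Z) = (2 * ii) *: (Z *m Y + Y *m Z).
  rewrite -scaleN1r adD adZ !adM XY XZ -!scalemxAl -!scalemxAr.
  move: (Z *m Y) (Y *m Z) => P Q; apply/matrixP => i j; rewrite !mxE; ring.
rewrite e adZ adD !adM XY XZ -!scalemxAl -!scalemxAr.
move: (Z *m Z) (Y *m Y) => P Q; apply/matrixP => i j; rewrite !mxE.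
have := mulii; move: ii => z zz.
transitivity (4 * (z * z) * (P i j - Q i j)); first by ring.
by rewrite zz; ring.
Qed.

End Su2.
End Axes.

(** * Sequential estimator *)

Section FiniteLaw.
Context (d : measure_display) (T : measurableType d) (R : realType).
Variables (P : probability T R) (I : finType) (x0 : I) (p : I -> R) (pt : I -> T).
Hypothesis p0 : forall x, 0 <= p x.
Hypothesis PE : forall A, measurable A -> P A = (\sum_x p x * (pt x \in A)%:R)%:E.

Let pn (n : nat) : {nonneg R} := NngNum (p0 (nth x0 (enum I) n)).
Let ms (n : nat) : {measure set T -> \bar R} := mscale (pn n) (dirac (pt (nth x0 (enum I) n))).

Lemma sum_enum (V : nmodType) (f : I -> V) : \sum_x f x = \sum_(n < size (enum I)) f (nth x0 (enum I) n).
Proof. by rewrite -big_enum /= (big_nth x0) big_mkord. Qed.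

Lemma ge0_finite_law_integral (h : T -> R) : measurable_fun setT h -> (forall x, 0 <= h x) ->
  (\int[P]_x (h x)%:E = (\sum_x p x * h (pt x))%:E)%E.
Proof.
move=> mh h0; have mh' : measurable_fun setT (EFin \o h) by exact/measurable_EFinP.
rewrite (@eq_measure_integral _ _ _ setT (msum ms (size (enum I)))); last first.
  move=> A mA _; apply: (etrans (PE mA)).
  rewrite /msum -sumEFin (sum_enum (fun x => (p x * (pt x \in A)%:R)%:E)).
  by apply: eq_bigr => n _; rewrite /= /mscale /= diracE EFinM.
rewrite ge0_integral_measure_sum //; last by move=> x _; rewrite lee_fin h0.
rewrite -sumEFin (sum_enum (fun x => (p x * h (pt x))%:E)); apply: eq_bigr => n _.
transitivity ((pn n)%:num%:E * \int[dirac (pt (nth x0 (enum I) n))]_x (EFin \o h) x)%E.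
  by apply: ge0_integral_mscale => // x _; rewrite lee_fin.
by rewrite integral_dirac // diracT mul1e EFinM.
Qed.

Lemma finite_law_integrable (h : T -> R) : measurable_fun setT h ->
  P.-integrable setT (EFin \o h).
Proof.
move=> mh; apply/integrableP; split; first exact/measurable_EFinP.
rewrite (@eq_integral _ _ _ _ _ (fun x => (`|h x|)%:E)) //.
rewrite ge0_finite_law_integral ?ltry //; exact: measurableT_comp.
Qed.

Lemma finite_law_integral (h : T -> R) : measurable_fun setT h ->
  (\int[P]_x (h x)%:E = (\sum_x p x * h (pt x))%:E)%E.
Proof.
move=> mh.
have mM : measurable_fun setT (fun x => Num.max (h x) 0).
  by apply: measurable_maxr => //; exact: measurable_cst.
have mm : measurable_fun setT (fun x => Num.max (- h x) 0).
  by apply: measurable_maxr; [exact: measurable_funN | exact: measurable_cst].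
have hE x : h x = Num.max (h x) 0 - Num.max (- h x) 0.
  have [h0|h0] : 0 <= h x \/ h x <= 0 by case: (ltP (h x) 0) => ?; [right; apply: ltW | left].
    by rewrite max_l // max_r ?oppr_le0 // subr0.
  by rewrite max_r // max_l ?oppr_ge0 // sub0r opprK.
under eq_integral do rewrite hE EFinB.
rewrite integralB //; [|exact: (finite_law_integrable mM)|exact: (finite_law_integrable mm)].
rewrite !ge0_finite_law_integral //; try by move=> x; rewrite le_max lexx orbT.
rewrite -EFinB -sumrB; congr (_%:E); apply: eq_bigr => x _.
by rewrite [in RHS]hE mulrBr.
Qed.

End FiniteLaw.

(** * POVMs with finitely many outcomes *)

Section FinitePOVM.
Variable R : realType.
Local Notation C := R[i].
Variables (N : nat) (I : finType) (x0 : I) (E : I -> 'M[C]_N) (pt : I -> Omega R).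
Hypothesis Epsd : forall x, psdC (E x).
Hypothesis Esum : \sum_x E x = 1%:M.

Definition fin_povm_fun (A : set (Omega R)) : 'M[C]_N :=
  \sum_x ((pt x \in A)%:R : R)%:C%C *: E x.

Lemma psdC_add d (A B : 'M[C]_d) : psdC A -> psdC B -> psdC (A + B).
Proof.
move=> [Ah Ap] [Bh Bp]; split; first by rewrite adjmxD Ah Bh.
by move=> v; rewrite mulmxDr mulmxDl addmxE addr_ge0.
Qed.

Lemma psdC_scale d (s : R) (A : 'M[C]_d) : 0 <= s -> psdC A -> psdC (s%:C%C *: A).
Proof.
move=> s0 [Ah Ap]; split; first by rewrite adjmxZ Ah; congr (_ *: _); exact: conjc_real.
by move=> v; rewrite -scalemxAr -scalemxAl scalemxE mulr_ge0 // ler0c.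
Qed.

Lemma psdC_0 d : psdC (0 : 'M[C]_d).
Proof.
split; first by apply/matrixP => i j; rewrite adjmxE !mxE rmorph0.
by move=> v; rewrite mulmx0 mul0mx mxE.
Qed.

Lemma fin_povm_psd A : measurable A -> psdC (fin_povm_fun A).
Proof.
move=> _; apply: (big_ind (@psdC R N)); [exact: psdC_0 | exact: psdC_add |].
by move=> x _; apply: psdC_scale.
Qed.

Lemma fin_povm_total : fin_povm_fun setT = 1%:M.
Proof.
by rewrite -Esum; apply: eq_bigr => x _; rewrite in_setT scale1r.
Qed.

Lemma sadd_indic (a : Omega R) : sadd (fun A => (a \in A)%:R : R).
Proof. exact: (@measure_semi_sigma_additive _ _ _ (dirac a)). Qed.

Lemma fin_povm_additive i j :
  semi_sigma_additive (fun A => (complex.Re (fin_povm_fun A i j))%:E) /\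
  semi_sigma_additive (fun A => (complex.Im (fin_povm_fun A i j))%:E).
Proof.
have h (c : I -> R) : sadd (fun A => \sum_x c x * (pt x \in A)%:R).
  by apply: sadd_sum => x; apply: saddZ; exact: sadd_indic.
split.
- have := h (fun x => complex.Re (E x i j)); rewrite /sadd.
  congr semi_sigma_additive; apply/funext => A /=; congr (_%:E).
  rewrite summxE Re_sum; apply: eq_bigr => x _.
  by rewrite scalemxE ReM' /= mul0r subr0 mulrC.
- have := h (fun x => complex.Im (E x i j)); rewrite /sadd.
  congr semi_sigma_additive; apply/funext => A /=; congr (_%:E).
  rewrite summxE (big_morph _ (@ImD R) (erefl _)); apply: eq_bigr => x _.
  by rewrite scalemxE ImM' /= mul0r addr0 mulrC.
Qed.

Definition fin_povm : POVM R N :=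
  Build_POVM fin_povm_psd fin_povm_total fin_povm_additive.

Section Law.
Variable B : 'M[C]_N.
Hypothesis Bst : state B.
Let p x := complex.Re (\tr (E x *m B)).

Lemma fin_povm_prob_ge0 x : 0 <= p x.
Proof.
have [[V BV] _] := Bst; rewrite /p BV.
by have [] := ge0C (trace_psdC_ge0 V (Epsd x)).
Qed.

Lemma fin_povm_law A : measurable A -> law fin_povm B A = (\sum_x p x * (pt x \in A)%:R)%:E.
Proof.
move=> mA; rewrite lawE // /pval /= /fin_povm_fun mulmx_suml (big_morph (@mxtrace C N) (@mxtraceD C
  N) (@mxtrace0 C N)) Re_sum; congr (_%:E).
apply: eq_bigr => x _.
by rewrite -scalemxAl mxtraceZ ReM' /= mul0r subr0 mulrC.
Qed.

Lemma fin_povm_integral (h : Omega R -> R) : measurable_fun setT h ->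
  (\int[law fin_povm B]_x (h x)%:E = (\sum_x p x * h (pt x))%:E)%E.
Proof. exact: (finite_law_integral x0 fin_povm_prob_ge0 fin_povm_law). Qed.

Lemma fin_povm_integrable (h : Omega R -> R) : measurable_fun setT h ->
  (law fin_povm B).-integrable setT (fun x => (h x)%:E).
Proof. exact: (finite_law_integrable x0 fin_povm_prob_ge0 fin_povm_law). Qed.

End Law.
End FinitePOVM.

(** * Moments of three successive unsharp measurements *)

Section SequentialMeasurement.
Variable R : realType.
Local Notation C := R[i].
Local Notation ii := ('i%C : C).
Variables (N : nat) (X Y Z : 'M[C]_N).
Hypotheses (XY : ad X Y = ii *: Z) (YZ : ad Y Z = ii *: X) (ZX : ad Z X = ii *: Y).
Variables (q3 q1 q2 : nat) (K3 : 'I_q3 -> 'M[C]_N) (K1 : 'I_q1 -> 'M[C]_N) (K2 : 'I_q2 -> 'M[C]_N).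
Variables (y3 : 'I_q3 -> R) (y1 : 'I_q1 -> R) (y2 : 'I_q2 -> R).
Variables (c3 e3 s3 c1 e1 s1 c2 e2 : R).
Hypotheses (F3 : fuzzy Z K3 y3 c3 e3 s3) (F1 : fuzzy X K1 y1 c1 e1 s1) (F2 : fuzzy Y K2 y2 c2 e2 0).

(** The Kraus operators are Hermitian and [K3] acts on the state first, so it is the outermost
    factor of the effect. *)
Definition seq_effect (x : 'I_q3 * 'I_q1 * 'I_q2) : 'M[C]_N :=
  (K3 x.1.1 *m K1 x.1.2 *m K2 x.2) *m adjmx (K3 x.1.1 *m K1 x.1.2 *m K2 x.2).

(** A product weight is summed from the inside out, the last measurement first, so each moment
    passes through one instrument at a time. *)
Lemma seq_effect_sum (g3 : 'I_q3 -> R) (g1 : 'I_q1 -> R) (g2 : 'I_q2 -> R) :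
  \sum_x (g3 x.1.1 * g1 x.1.2 * g2 x.2)%:C%C *: seq_effect x =
  \sum_m (g3 m)%:C%C *: (K3 m *m (\sum_l (g1 l)%:C%C *: (K1 l *m
     (\sum_j (g2 j)%:C%C *: (K2 j *m K2 j)) *m K1 l)) *m K3 m).
Proof.
have [h3 _ _ _ _] := F3; have [h1 _ _ _ _] := F1; have [h2 _ _ _ _] := F2.
rewrite -(pair_bigA _ (fun ml j => (g3 ml.1 * g1 ml.2 * g2 j)%:C%C *: seq_effect (ml, j))) /=.
rewrite -(pair_bigA _ (fun m l => \sum_j (g3 m * g1 l * g2 j)%:C%C *: seq_effect ((m, l), j))) /=.
apply: eq_bigr => m _; rewrite mulmx_sumr mulmx_suml scaler_sumr; apply: eq_bigr => l _.
rewrite mulmx_sumr mulmx_suml !scaler_sumr mulmx_sumr mulmx_suml scaler_sumr.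
apply: eq_bigr => j _; rewrite /seq_effect /= !adjmxM h3 h1 h2.
rewrite -!scalemxAr -!scalemxAl -!scalemxAr -!scalemxAl !scalerA !mulmxA.
by congr (_ *: _); rewrite -!rmorphM /=; congr (_%:C)%C; ring.
Qed.

Let T3 B := \sum_m K3 m *m B *m K3 m.
Let T1 B := \sum_m K1 m *m B *m K1 m.

Let T3D B B' : T3 (B + B') = T3 B + T3 B'.
Proof. by rewrite /T3 -big_split; apply: eq_bigr => m _; rewrite mulmxDr mulmxDl. Qed.
Let T3Z a B : T3 (a *: B) = a *: T3 B.
Proof. by rewrite /T3 scaler_sumr; apply: eq_bigr => m _; rewrite -scalemxAr -scalemxAl. Qed.
Let T1D B B' : T1 (B + B') = T1 B + T1 B'.
Proof. by rewrite /T1 -big_split; apply: eq_bigr => m _; rewrite mulmxDr mulmxDl. Qed.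
Let T1Z a B : T1 (a *: B) = a *: T1 B.
Proof. by rewrite /T1 scaler_sumr; apply: eq_bigr => m _; rewrite -scalemxAr -scalemxAl. Qed.

Let half_split (A B : 'M[C]_N) :
  A = (2^-1 : R)%:C%C *: (A + B) + (2^-1 : R)%:C%C *: (A - B).
Proof.
rewrite scalerDr scalerBr addrACA subrr addr0 -scalerDl -rmorphD /=.
by rewrite (_ : 2^-1 + 2^-1 = 1 :> R) ?scale1r //; field.
Qed.

Let scaleC (a b : R) (B : 'M[C]_N) : a%:C%C *: (b%:C%C *: B) = (a * b)%:C%C *: B.
Proof. by rewrite scalerA -rmorphM. Qed.

(** X^2 is half the sum of X^2 + Y^2, which is invariant under rotations about Z, and X^2 - Y^2,
    which has weight two and is damped by [e3]. *)
Lemma T3_XX : T3 (X *m X) = (2^-1 : R)%:C%C *: (X *m X + Y *m Y) + (e3 / 2)%:C%C *: (X *m X - Y *m Y).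
Proof.
have [_ h0 _ h4 _] := F3.
rewrite {1}(half_split (X *m X) (Y *m Y)) T3D !T3Z.
have t1 : T3 (X *m X + Y *m Y) = X *m X + Y *m Y := h0 _ (su2_ad_sum ZX YZ).
have t2 : T3 (X *m X - Y *m Y) = e3%:C%C *: (X *m X - Y *m Y) := h4 _ (su2_ad2_diff ZX YZ).
by rewrite t1 t2 scaleC [_ * e3]mulrC.
Qed.

Lemma T3_YY : T3 (Y *m Y) = (2^-1 : R)%:C%C *: (X *m X + Y *m Y) - (e3 / 2)%:C%C *: (X *m X - Y *m Y).
Proof.
have [_ h0 _ _ _] := F3.
have : T3 (X *m X + Y *m Y) = X *m X + Y *m Y := h0 _ (su2_ad_sum ZX YZ).
rewrite T3D T3_XX => /(canRL (addKr _)) ->.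
have hh : (2^-1 : R)%:C%C + (2^-1 : R)%:C%C = 1.
  by rewrite -rmorphD /= (_ : 2^-1 + 2^-1 = 1 :> R) //; field.
move: (X *m X + Y *m Y) (X *m X - Y *m Y) => A B; apply/matrixP => i j; rewrite !mxE.
by rewrite -[X in _ + X]mul1r -hh; ring.
Qed.

Lemma T1_YY : T1 (Y *m Y) = (2^-1 : R)%:C%C *: (Y *m Y + Z *m Z) + (e1 / 2)%:C%C *: (Y *m Y - Z *m Z).
Proof.
have [_ h0 _ h4 _] := F1.
rewrite {1}(half_split (Y *m Y) (Z *m Z)) T1D !T1Z.
have t1 : T1 (Y *m Y + Z *m Z) = Y *m Y + Z *m Z := h0 _ (su2_ad_sum XY ZX).
have t2 : T1 (Y *m Y - Z *m Z) = e1%:C%C *: (Y *m Y - Z *m Z) := h4 _ (su2_ad2_diff XY ZX).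
by rewrite t1 t2 scaleC [_ * e1]mulrC.
Qed.

Lemma T3_ZZ : T3 (Z *m Z) = Z *m Z.
Proof. by have [_ h0 _ _ _] := F3; apply: h0; rewrite /ad mulmxA subrr. Qed.

Lemma T3_1 : T3 1%:M = 1%:M.
Proof. by have [_ h0 _ _ _] := F3; apply: h0; rewrite /ad mulmx1 mul1mx subrr. Qed.

Lemma T1_1 : T1 1%:M = 1%:M.
Proof. by have [_ h0 _ _ _] := F1; apply: h0; rewrite /ad mulmx1 mul1mx subrr. Qed.

Let one2 : \sum_j ((1 : R)%:C%C *: (K2 j *m K2 j)) = 1%:M.
Proof.
have [_ h0 _ _ _] := F2; rewrite -[RHS]h0 ?/ad ?mulmx1 ?mul1mx ?subrr //.
by apply: eq_bigr => j _; rewrite scale1r mulmx1.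
Qed.

Let sum1_K1 B : \sum_l ((1 : R)%:C%C *: (K1 l *m B *m K1 l)) = T1 B.
Proof. by apply: eq_bigr => l _; rewrite scale1r. Qed.

Let sum1_K3 B : \sum_l ((1 : R)%:C%C *: (K3 l *m B *m K3 l)) = T3 B.
Proof. by apply: eq_bigr => l _; rewrite scale1r. Qed.

Let weight_K1 (g : 'I_q1 -> R) :
  \sum_l (g l)%:C%C *: (K1 l *m 1%:M *m K1 l) = \sum_l (g l)%:C%C *: (K1 l *m K1 l).
Proof. by apply: eq_bigr => l _; rewrite mulmx1. Qed.

Let weight_K3 (g : 'I_q3 -> R) :
  \sum_l (g l)%:C%C *: (K3 l *m 1%:M *m K3 l) = \sum_l (g l)%:C%C *: (K3 l *m K3 l).
Proof. by apply: eq_bigr => l _; rewrite mulmx1. Qed.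

Let adad_X : ad Z (ad Z X) = X. Proof. exact: su2_ad2_Y ZX YZ. Qed.
Let adad_Y : ad Z (ad Z Y) = Y. Proof. exact: su2_ad2_Z ZX YZ. Qed.
Let adadX_Y : ad X (ad X Y) = Y. Proof. exact: su2_ad2_Y XY ZX. Qed.

Lemma seq_effect_total : \sum_x seq_effect x = 1%:M.
Proof.
have := seq_effect_sum (fun=> 1) (fun=> 1) (fun=> 1).
rewrite one2 sum1_K1 T1_1 sum1_K3 T3_1 => <-.
by apply: eq_bigr => x _; rewrite !mulr1 scale1r.
Qed.

Lemma seq_moment3 : \sum_x (y3 x.1.1)%:C%C *: seq_effect x = Z.
Proof.
have := seq_effect_sum y3 (fun=> 1) (fun=> 1).
rewrite one2 sum1_K1 T1_1 weight_K3; have [_ _ _ _ [-> _]] := F3 => <-.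
by apply: eq_bigr => x _; rewrite !mulr1.
Qed.

Lemma seq_moment33 : \sum_x (y3 x.1.1 ^+ 2)%:C%C *: seq_effect x = Z *m Z + (s3%:C%C)%:M.
Proof.
have := seq_effect_sum (fun m => y3 m ^+ 2) (fun=> 1) (fun=> 1).
rewrite one2 sum1_K1 T1_1 weight_K3; have [_ _ _ _ [_ ->]] := F3 => <-.
by apply: eq_bigr => x _; rewrite !mulr1.
Qed.

Lemma seq_moment1 : \sum_x (y1 x.1.2)%:C%C *: seq_effect x = c3%:C%C *: X.
Proof.
have := seq_effect_sum (fun=> 1) y1 (fun=> 1).
rewrite one2 weight_K1; have [_ _ _ _ [-> _]] := F1.
rewrite sum1_K3; have [_ _ h _ _] := F3; have [e _] := h _ adad_X.
have {}e : T3 X = c3%:C%C *: X := e.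
rewrite e => <-.
by apply: eq_bigr => x _; rewrite mul1r mulr1.
Qed.

Lemma seq_moment11 : \sum_x (y1 x.1.2 ^+ 2)%:C%C *: seq_effect x =
  (2^-1 : R)%:C%C *: (X *m X + Y *m Y) + (e3 / 2)%:C%C *: (X *m X - Y *m Y) + (s1%:C%C)%:M.
Proof.
have := seq_effect_sum (fun=> 1) (fun m => y1 m ^+ 2) (fun=> 1).
rewrite one2 weight_K1; have [_ _ _ _ [_ ->]] := F1.
rewrite sum1_K3 T3D T3_XX -[(s1%:C%C)%:M]scalemx1 T3Z T3_1 => <-.
by apply: eq_bigr => x _; rewrite mul1r mulr1.
Qed.

Lemma seq_moment2 : \sum_x (y2 x.2)%:C%C *: seq_effect x = (c1 * c3)%:C%C *: Y.
Proof.
have := seq_effect_sum (fun=> 1) (fun=> 1) y2.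
have [_ _ _ _ [-> _]] := F2.
rewrite sum1_K1 sum1_K3; have [_ _ h _ _] := F1; have [e _] := h _ adadX_Y.
have {}e : T1 Y = c1%:C%C *: Y := e.
rewrite e T3Z; have [_ _ h' _ _] := F3; have [e' _] := h' _ adad_Y.
have {}e' : T3 Y = c3%:C%C *: Y := e'.
rewrite e' scaleC => <-.
by apply: eq_bigr => x _; rewrite !mul1r.
Qed.

(** The last instrument adds no noise, but the one for X mixes Y^2 with Z^2. The coefficient of Z^2
    is about 2 / p1 and its mean at [theta_r] has order n^2 when r > 0, which forces p1 to be of
    order n. *)
Lemma seq_moment22 : \sum_x (y2 x.2 ^+ 2)%:C%C *: seq_effect x =
  ((1 + e1) / 2)%:C%C *: ((2^-1 : R)%:C%C *: (X *m X + Y *m Y) - (e3 / 2)%:C%C *: (X *m X - Y *m Y))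
  + ((1 - e1) / 2)%:C%C *: (Z *m Z).
Proof.
have := seq_effect_sum (fun=> 1) (fun=> 1) (fun m => y2 m ^+ 2).
have [_ _ _ _ [_ ->]] := F2; rewrite -[(_)%:M]scalemx1 rmorph0 scale0r addr0.
rewrite sum1_K1 sum1_K3 T1_YY.
have -> : (2^-1 : R)%:C%C *: (Y *m Y + Z *m Z) + (e1 / 2)%:C%C *: (Y *m Y - Z *m Z) =
    ((1 + e1) / 2)%:C%C *: (Y *m Y) + ((1 - e1) / 2)%:C%C *: (Z *m Z).
  rewrite scalerDr scalerBr addrACA -scalerBl -scalerDl -rmorphD -rmorphB /=.
  by congr (_%:C%C *: _ + _%:C%C *: _); field.
rewrite T3D !T3Z T3_YY T3_ZZ => <-.
by apply: eq_bigr => x _; rewrite !mul1r.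
Qed.

(** The correlation is a multiple of an anticommutator. Its mean vanishes at [theta_r], where the
    spin matrices of orthogonal axes anticommute and the mean transverse spin is zero. *)
Lemma seq_moment31 : \sum_x (y3 x.1.1 * y1 x.1.2)%:C%C *: seq_effect x =
  (c3 / 2)%:C%C *: (Z *m X + X *m Z).
Proof.
have := seq_effect_sum y3 y1 (fun=> 1).
rewrite one2 weight_K1; have [_ _ _ _ [-> _]] := F1.
have [_ _ h _ _] := F3; have [_ ->] := h _ adad_X => <-.
by apply: eq_bigr => x _; rewrite mulr1.
Qed.

Lemma seq_moment32 : \sum_x (y3 x.1.1 * y2 x.2)%:C%C *: seq_effect x =
  (c1 * (c3 / 2))%:C%C *: (Z *m Y + Y *m Z).
Proof.
have := seq_effect_sum y3 (fun=> 1) y2.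
have [_ _ _ _ [-> _]] := F2.
rewrite sum1_K1; have [_ _ h _ _] := F1; have [e _] := h _ adadX_Y.
have {}e : T1 Y = c1%:C%C *: Y := e.
rewrite e.
rewrite (eq_bigr (fun m => c1%:C%C *: ((y3 m)%:C%C *: (K3 m *m Y *m K3 m)))); last first.
  by move=> m _; rewrite -scalemxAr -scalemxAl !scalerA mulrC.
rewrite -scaler_sumr; have [_ _ h' _ _] := F3; have [_ ->] := h' _ adad_Y.
rewrite scaleC => <-; by apply: eq_bigr => x _; rewrite mulr1.
Qed.

End SequentialMeasurement.

(** * Means of the collective spins in product states *)

Section QubitExpectations.
Variable R : realType.
Local Notation C := R[i].
Local Notation o0 := (Ordinal (isT : 0 < 3)%N).
Local Notation o1 := (Ordinal (isT : 1 < 3)%N).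
Local Notation o2 := (Ordinal (isT : 2 < 3)%N).
Local Notation "x +i* y" := (Complex x y) : ring_scope.
Local Notation ii := ('i%C : C).
Variables (u1 u2 : R).
Hypothesis u12 : u1 ^+ 2 + u2 ^+ 2 = 1.
Let sx := sigma_axis u1 u2.
Let sy := sigma_axis (- u2) u1.
Let sz := sigma R o2.

Lemma sigma_axisE (v1 v2 : R) : sigma_axis v1 v2 =
  mx2 0 ((v1 / 2) +i* - (v2 / 2)) ((v1 / 2) +i* (v2 / 2)) 0.
Proof.
rewrite /sigma_axis sigma_o0 sigma_o1 !mx2_scale mx2_add; congr mx2; apply/eqP;
  rewrite eq_complex /=; apply/andP; split; apply/eqP; ring.
Qed.

Let u1E : u1 * u1 = 1 - u2 * u2. Proof. by rewrite -u12; ring. Qed.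

Lemma sigma_comm_xy : sx *m sy - sy *m sx = ii *: sz.
Proof.
rewrite /sx /sy /sz !sigma_axisE sigma_o2 !mx2_mul mx2_opp mx2_add mx2_scale; congr mx2; apply/eqP;
  rewrite eq_complex /=; apply/andP; split; apply/eqP; try ring.
  rewrite [LHS](_ : _ = (u1 * u1 + u2 * u2) / 2); last by field.
  by rewrite u1E; field.
rewrite [LHS](_ : _ = - (u1 * u1 + u2 * u2) / 2); last by field.
by rewrite u1E; field.
Qed.

Lemma sigma_comm_yz : sy *m sz - sz *m sy = ii *: sx.
Proof.
rewrite /sx /sy /sz !sigma_axisE sigma_o2 !mx2_mul mx2_opp mx2_add mx2_scale; congr mx2; apply/eqP;
  rewrite eq_complex /=; apply/andP; split; apply/eqP; by field.
Qed.

Lemma sigma_comm_zx : sz *m sx - sx *m sz = ii *: sy.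
Proof.
rewrite /sx /sy /sz !sigma_axisE sigma_o2 !mx2_mul mx2_opp mx2_add mx2_scale; congr mx2; apply/eqP;
  rewrite eq_complex /=; apply/andP; split; apply/eqP; by field.
Qed.

Lemma tr_rho_axis (th : 'rV[R]_3) (v1 v2 : R) :
  \tr (rho th *m sigma_axis v1 v2) = ((v1 * th 0 o0 + v2 * th 0 o1) / 2)%:C%C.
Proof.
rewrite rhoE sigma_axisE mx2_mul mx2_tr; apply/eqP; rewrite eq_complex /=.
by apply/andP; split; apply/eqP; field.
Qed.

Lemma tr_rho_z (th : 'rV[R]_3) : \tr (rho th *m sz) = (th 0 o2 / 2)%:C%C.
Proof.
rewrite rhoE /sz sigma_o2 mx2_mul mx2_tr; apply/eqP; rewrite eq_complex /=.
by apply/andP; split; apply/eqP; field.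
Qed.

Lemma sigma_axis_sqr (v1 v2 : R) : v1 ^+ 2 + v2 ^+ 2 = 1 ->
  sigma_axis v1 v2 *m sigma_axis v1 v2 = (4^-1 : R)%:C%C *: 1%:M.
Proof.
move=> v12; rewrite sigma_axisE mx2_mul mx2_1 mx2_scale; congr mx2; apply/eqP;
  rewrite eq_complex /=; apply/andP; split; apply/eqP; try ring.
  rewrite [LHS](_ : _ = (v1 ^+ 2 + v2 ^+ 2) / 4); last by field.
  by rewrite v12; field.
rewrite [LHS](_ : _ = (v1 ^+ 2 + v2 ^+ 2) / 4); last by field.
by rewrite v12; field.
Qed.

Lemma sigma_z_sqr : sz *m sz = (4^-1 : R)%:C%C *: 1%:M.
Proof.
rewrite /sz sigma_o2 mx2_mul mx2_1 mx2_scale; congr mx2; apply/eqP;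
  rewrite eq_complex /=; apply/andP; split; apply/eqP; by field.
Qed.

Lemma sigma_z_axis (v1 v2 : R) : sz *m sigma_axis v1 v2 + sigma_axis v1 v2 *m sz = 0.
Proof.
rewrite /sz sigma_axisE sigma_o2 !mx2_mul mx2_add mx2_0; congr mx2; apply/eqP;
  rewrite eq_complex /=; apply/andP; split; apply/eqP; by field.
Qed.

Section Collective.
Variables (k : nat) (th : 'rV[R]_3).
Hypothesis st : state (rho th).

Definition ev (B : 'M[C]_(2 ^ k.+1)) : R := complex.Re (\tr (B *m rho_n th k.+1)).

Lemma evD A B : ev (A + B) = ev A + ev B.
Proof. by rewrite /ev mulmxDl mxtraceD ReD. Qed.

Lemma evZ (s : R) A : ev (s%:C%C *: A) = s * ev A.
Proof. by rewrite /ev -scalemxAl mxtraceZ ReM' /= mul0r subr0. Qed.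

Lemma evB A B : ev (A - B) = ev A - ev B.
Proof. by rewrite /ev mulmxBl raddfB ReD ReN. Qed.

Lemma ev_sum (I : finType) (s : I -> R) (B : I -> 'M[C]_(2 ^ k.+1)) :
  \sum_x complex.Re (\tr (B x *m rho_n th k.+1)) * s x = ev (\sum_x (s x)%:C%C *: B x).
Proof.
rewrite (big_morph ev evD (_ : ev 0 = 0)); last by rewrite /ev mul0mx mxtrace0.
by apply: eq_bigr => x _; rewrite evZ mulrC.
Qed.

Lemma ev1 : ev 1%:M = 1.
Proof. by rewrite /ev mul1mx (state_ntens _ st).2. Qed.

Lemma ev_scalar (s : R) : ev (s%:C%C)%:M = s.
Proof. by rewrite -scalemx1 evZ ev1 mulr1. Qed.

Lemma ev_tsum A : ev (tsum A k) = k.+1%:R * complex.Re (\tr (rho th *m A)).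
Proof.
rewrite /ev mxtrace_mulC /rho_n tr_tsum ?st.2 //.
by rewrite -(rmorph_nat (real_complex R)) ReM' /= mul0r subr0.
Qed.

Lemma ev_tsum2 A B : ev (tsum A k *m tsum B k) = k.+1%:R * complex.Re (\tr (rho th *m (A *m B))) +
  (k.+1 * k)%:R * complex.Re (\tr (rho th *m A) * \tr (rho th *m B)).
Proof.
rewrite /ev mxtrace_mulC /rho_n tr_tsum2 ?st.2 // ReD.
by rewrite -!(rmorph_nat (real_complex R)) [X in X + _ = _]ReM' [X in _ + X = _]ReM' /= !mul0r !subr0.
Qed.

End Collective.
End QubitExpectations.

(** * The unbiased estimator for given widths *)

Section Estimator.
Variable R : realType.
Local Notation C := R[i].
Local Notation o0 := (Ordinal (isT : 0 < 3)%N).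
Local Notation o1 := (Ordinal (isT : 1 < 3)%N).
Local Notation o2 := (Ordinal (isT : 2 < 3)%N).

Definition damp1 (p : nat) : R := p%:R / p.+1%:R.
Definition damp2 (p : nat) : R := p%:R * (p%:R - 1) / (p.+1%:R * p.+2%:R).
Definition noise (p : nat) : R := p%:R ^+ 2 / (4 * (2 * p%:R - 1)).

Lemma weighted_quadratic (I : finType) (p y1 y2 y3 : I -> R) (a1 a2 a3 d1 d2 t : R)
  (m1 m2 m3 m11 m22 m33 m31 m32 : R) :
  \sum_x p x = 1 -> \sum_x p x * y1 x = m1 -> \sum_x p x * y2 x = m2 ->
  \sum_x p x * y3 x = m3 -> \sum_x p x * y1 x ^+ 2 = m11 -> \sum_x p x * y2 x ^+ 2 = m22 ->
  \sum_x p x * y3 x ^+ 2 = m33 -> \sum_x p x * (y3 x * y1 x) = m31 ->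
  \sum_x p x * (y3 x * y2 x) = m32 ->
  \sum_x p x * (a1 * y1 x ^+ 2 + a2 * y2 x ^+ 2 + a3 * (y3 x - t) ^+ 2 +
    d1 * (y1 x * (y3 x - t)) + d2 * (y2 x * (y3 x - t))) =
  a1 * m11 + a2 * m22 + a3 * (m33 - 2 * t * m3 + t ^+ 2) + d1 * (m31 - t * m1) + d2 * (m32 - t * m2).
Proof.
move=> h0 h1 h2 h3 h11 h22 h33 h31 h32.
rewrite (eq_bigr (fun x => a1 * (p x * y1 x ^+ 2) + a2 * (p x * y2 x ^+ 2) +
  a3 * (p x * y3 x ^+ 2) + (- (2 * t * a3)) * (p x * y3 x) + (a3 * t ^+ 2) * p x +
  d1 * (p x * (y3 x * y1 x)) + (- (d1 * t)) * (p x * y1 x) +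
  d2 * (p x * (y3 x * y2 x)) + (- (d2 * t)) * (p x * y2 x))); last by move=> x _; ring.
rewrite !big_split /= -!mulr_sumr h0 h1 h2 h3 h11 h22 h33 h31 h32; ring.
Qed.

(** The mixed coefficients [k1] and [k2] do not appear in the risk because the z outcome is
    uncorrelated with both transverse outcomes at [theta_r]. Only the transverse block of [G] has to
    be diagonalised. *)
Lemma estimator_exists (r u1 u2 : R) (k p3 p1 : nat) : u1 ^+ 2 + u2 ^+ 2 = 1 ->
  (0 < p3)%N -> (0 < p1)%N -> exists M : POVM R (2 ^ k.+1),
  [/\ forall th j, state (rho th) ->
        (law M (rho_n th k.+1)).-integrable setT (fun x => (ovec x 0 j)%:E),
      forall th, state (rho th) -> Ehat M th = th &
      forall (G : 'M[R]_3) (l1 l2 k1 k2 s : R),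
        (forall x y z, qform G (row3 (u1 * x - u2 * y) (u2 * x + u1 * y) z) =
           l1 * x ^+ 2 + l2 * y ^+ 2 + s * z ^+ 2 + k1 * (x * z) + k2 * (y * z)) ->
        state (rho (theta_r r)) -> let N : R := k.+1%:R in
        trGV M (theta_r r) G = (l1 * ((2 / N / damp1 p3) ^+ 2 * (N / 4 + noise p1)) +
          l2 * ((2 / N / (damp1 p1 * damp1 p3)) ^+ 2 *
             ((1 + damp2 p1) / 2 * (N / 4) + (1 - damp2 p1) / 2 * (N / 4 + N * k%:R * r ^+ 2 / 4))) +
          s * ((2 / N) ^+ 2 * (N / 4 + N * k%:R * r ^+ 2 / 4 + noise p3) - r ^+ 2))%:E ].
Proof.
move=> u12 p30 p10.
have v12 : (- u2) ^+ 2 + u1 ^+ 2 = 1 by rewrite sqrrN addrC.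
have [K3 [y3 F3]] := fuzzy_z R k p3.
have [K1 [y1 F1]] := fuzzy_axis k p1 u12.
(* Width 0 is the sharp measurement: nothing is measured afterwards, so its disturbance is free, and
   its noise is zero. *)
have [K2 [y2 F2]] := fuzzy_axis k 0 v12.
rewrite -/(damp1 p3) -/(damp2 p3) -/(noise p3) in F3.
rewrite -/(damp1 p1) -/(damp2 p1) -/(noise p1) in F1.
have n0 : (0%:R ^+ 2 / (4 * (2 * 0%:R - 1)) : R) = 0 by rewrite expr0n mul0r.
rewrite n0 in F2.
(* The spins are hidden behind equations so that the rewriting below treats them as atoms. *)
have [X XE] : {X | X = tsum (sigma_axis u1 u2) k} by exists (tsum (sigma_axis u1 u2) k).
have [Y YE] : {Y | Y = tsum (sigma_axis (- u2) u1) k} by exists (tsum (sigma_axis (- u2) u1) k).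
have [Z ZE] : {Z | Z = tsum (sigma R o2) k} by exists (tsum (sigma R o2) k).
rewrite -XE in F1; rewrite -YE in F2; rewrite -ZE in F3.
have XY : ad X Y = 'i%C *: Z by rewrite XE YE ZE /ad tsum_comm (sigma_comm_xy u12) tsumZ.
have YZ : ad Y Z = 'i%C *: X by rewrite XE YE ZE /ad tsum_comm (sigma_comm_yz u1 u2) tsumZ.
have ZX : ad Z X = 'i%C *: Y by rewrite XE YE ZE /ad tsum_comm (sigma_comm_zx u1 u2) tsumZ.
pose I := ('I_(k.+1 + p3).+1 * 'I_(k.+1 + p1).+1 * 'I_(k.+1 + 0).+1)%type.
pose E : I -> 'M[C]_(2 ^ k.+1) := seq_effect K3 K1 K2.
have Epsd x : psdC (E x) by exact: psdC_mul_adj.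
have Esum : \sum_x E x = 1%:M := seq_effect_total F3 F1 F2.
have c30 : damp1 p3 != 0 by rewrite mulf_neq0 ?invr_eq0 ?pnatr_eq0 // -lt0n.
have c10 : damp1 p1 != 0 by rewrite mulf_neq0 ?invr_eq0 ?pnatr_eq0 // -lt0n.
have [N NE] : {N : R | N = k.+1%:R} by exists k.+1%:R.
have N0 : N != 0 by rewrite NE pnatr_eq0.
(* A collective spin has mean N / 2 times the Bloch coordinate; the first transverse one is damped
   by the z instrument, the second by both earlier instruments. Dividing by these factors gives
   unbiasedness at every state, not only at [theta_r]. *)
pose xa (x : I) : R := 2 / N / damp1 p3 * y1 x.1.2.
pose xb (x : I) : R := 2 / N / (damp1 p1 * damp1 p3) * y2 x.2.
pose xc (x : I) : R := 2 / N * y3 x.1.1.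
pose pt (x : I) : Omega R := ((u1 * xa x - u2 * xb x, u2 * xa x + u1 * xb x), xc x).
pose M := fin_povm pt Epsd Esum; exists M.
pose x0 : I := ((ord0, ord0), ord0).
have int th (st : state (rho th)) := fin_povm_integral x0 pt Epsd Esum (state_ntens k.+1 st).
have ma th : state (rho th) -> \sum_x complex.Re (\tr (E x *m rho_n th k.+1)) * xa x =
    u1 * th 0 o0 + u2 * th 0 o1.
  move=> st; under eq_bigr do rewrite /xa mulrCA; rewrite -mulr_sumr ev_sum.
  rewrite (seq_moment1 YZ ZX F3 F1 F2) evZ XE (ev_tsum k st) tr_rho_axis /=.
  by rewrite -NE; field; rewrite ?N0 ?c30.
have mb th : state (rho th) -> \sum_x complex.Re (\tr (E x *m rho_n th k.+1)) * xb x =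
    - u2 * th 0 o0 + u1 * th 0 o1.
  move=> st; under eq_bigr do rewrite /xb mulrCA; rewrite -mulr_sumr ev_sum.
  rewrite (seq_moment2 XY YZ ZX F3 F1 F2) evZ YE (ev_tsum k st) tr_rho_axis /=.
  by rewrite -NE; field; rewrite ?N0 ?c30 ?c10.
have mc th : state (rho th) -> \sum_x complex.Re (\tr (E x *m rho_n th k.+1)) * xc x = th 0 o2.
  move=> st; under eq_bigr do rewrite /xc mulrCA; rewrite -mulr_sumr ev_sum.
  rewrite (seq_moment3 F3 F1 F2) ZE (ev_tsum k st) tr_rho_z /=.
  by rewrite -NE; field; rewrite N0.
split.
- move=> th j st.
  exact: (fin_povm_integrable x0 pt Epsd Esum (state_ntens k.+1 st) (measurable_ovec j)).
- move=> th st; rewrite [RHS]row3E; apply/rowP => j; rewrite mxE (int th st _ (measurable_ovec j)) /=.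
  have e : u1 * u1 = 1 - u2 * u2 by rewrite -u12; ring.
  have lin (a b : R) : \sum_x complex.Re (\tr (E x *m rho_n th k.+1)) * (a * xa x + b * xb x) =
     a * (u1 * th 0 o0 + u2 * th 0 o1) + b * (- u2 * th 0 o0 + u1 * th 0 o1).
    rewrite -(ma th st) -(mb th st) !mulr_sumr -big_split; apply: eq_bigr => x _ /=; ring.
  elim/ord3P: j; rewrite mxE /=.
  + under eq_bigr do rewrite mxE /= -mulNr.
    rewrite lin [LHS](_ : _ = (u1 * u1 + u2 * u2) * th 0 o0); last by ring.
    by rewrite e; ring.
  + under eq_bigr do rewrite mxE /=.
    rewrite lin [LHS](_ : _ = (u1 * u1 + u2 * u2) * th 0 o1); last by ring.
    by rewrite e; ring.
  + under eq_bigr do rewrite mxE /=.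
    exact: mc.
- move=> G l1 l2 k1 k2 s hG st; rewrite -NE.
  rewrite /trGV (int _ st _ (measurable_qform G _)); congr (_%:E).
  have [t0 t1 t2] := theta_r_entry r.
  have pq x : qform G (ovec (pt x) - theta_r r) = l1 * xa x ^+ 2 + l2 * xb x ^+ 2 + s * (xc x - r) ^+ 2 +
      k1 * (xa x * (xc x - r)) + k2 * (xb x * (xc x - r)).
    rewrite -hG; congr qform; apply/rowP; elim/ord3P; rewrite !mxE /= ?subr0 //.
  under eq_bigr do rewrite pq.
  have tot : \sum_x complex.Re (\tr (E x *m rho_n (theta_r r) k.+1)) = 1.
    rewrite -(ev1 k st) -Esum /ev mulmx_suml.
    by rewrite (big_morph (@mxtrace C _) (@mxtraceD C _) (@mxtrace0 C _)) Re_sum.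
  have zz : ev (theta_r r) (Z *m Z) = N / 4 + N * k%:R * r ^+ 2 / 4.
    rewrite ZE (ev_tsum2 k st) sigma_z_sqr -scalemxAr mulmx1 mxtraceZ st.2 !tr_rho_z t2.
    by rewrite natrM -NE /=; field.
  have sq v1 v2 : v1 ^+ 2 + v2 ^+ 2 = 1 ->
      ev (theta_r r) (tsum (sigma_axis v1 v2) k *m tsum (sigma_axis v1 v2) k) = N / 4.
    move=> v; rewrite (ev_tsum2 k st) (sigma_axis_sqr v) -scalemxAr mulmx1 mxtraceZ st.2 !tr_rho_axis.
    by rewrite t0 t1 -NE /=; field.
  have sqX := sq _ _ u12; have sqY := sq _ _ v12; rewrite -XE -YE in sqX sqY.
  have cross v1 v2 : ev (theta_r r) (Z *m tsum (sigma_axis v1 v2) k + tsum (sigma_axis v1 v2) k *m Z) = 0.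
    rewrite ZE evD !(ev_tsum2 k st) addrACA -mulrDr -ReD -mxtraceD -mulmxDr sigma_z_axis mulmx0 mxtrace0.
    by rewrite !tr_rho_axis t0 t1 !mulr0 addr0 mul0r rmorph0 mulr0 mul0r /= !mulr0 !addr0.
  have crossX := cross u1 u2; have crossY := cross (- u2) u1; rewrite -XE -YE in crossX crossY.
  have m11 : \sum_x complex.Re (\tr (E x *m rho_n (theta_r r) k.+1)) * xa x ^+ 2 =
     (2 / N / damp1 p3) ^+ 2 * (N / 4 + noise p1).
    under eq_bigr do rewrite /xa exprMn mulrCA; rewrite -mulr_sumr ev_sum.
    rewrite (seq_moment11 YZ ZX F3 F1 F2) !evD !evZ evB evD sqX sqY (ev_scalar k st).
    by congr (_ * _); field.
  have m22 : \sum_x complex.Re (\tr (E x *m rho_n (theta_r r) k.+1)) * xb x ^+ 2 =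
     (2 / N / (damp1 p1 * damp1 p3)) ^+ 2 * ((1 + damp2 p1) / 2 * (N / 4) +
        (1 - damp2 p1) / 2 * (N / 4 + N * k%:R * r ^+ 2 / 4)).
    under eq_bigr do rewrite /xb exprMn mulrCA; rewrite -mulr_sumr ev_sum.
    rewrite (seq_moment22 XY YZ ZX F3 F1 F2) evD !evZ evB !evZ evB evD sqX sqY zz.
    by congr (_ * (_ * _ + _)); field.
  have m33 : \sum_x complex.Re (\tr (E x *m rho_n (theta_r r) k.+1)) * xc x ^+ 2 =
     (2 / N) ^+ 2 * (N / 4 + N * k%:R * r ^+ 2 / 4 + noise p3).
    under eq_bigr do rewrite /xc exprMn mulrCA; rewrite -mulr_sumr ev_sum.
    by rewrite (seq_moment33 F3 F1 F2) evD zz (ev_scalar k st).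
  have m31 : \sum_x complex.Re (\tr (E x *m rho_n (theta_r r) k.+1)) * (xc x * xa x) = 0.
    have ex x : complex.Re (\tr (E x *m rho_n (theta_r r) k.+1)) * (xc x * xa x) =
       2 / N * (2 / N / damp1 p3) * (complex.Re (\tr (E x *m rho_n (theta_r r) k.+1)) * (y3 x.1.1 *
         y1 x.1.2)).
      by rewrite /xc /xa; ring.
    under eq_bigr do rewrite ex; rewrite -mulr_sumr ev_sum.
    by rewrite (seq_moment31 YZ ZX F3 F1 F2) evZ crossX !mulr0.
  have m32 : \sum_x complex.Re (\tr (E x *m rho_n (theta_r r) k.+1)) * (xc x * xb x) = 0.
    have ex x : complex.Re (\tr (E x *m rho_n (theta_r r) k.+1)) * (xc x * xb x) =
       2 / N * (2 / N / (damp1 p1 * damp1 p3)) * (complex.Re (\tr (E x *m rho_n (theta_r r) k.+1))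
         * (y3 x.1.1 * y2 x.2)).
      by rewrite /xc /xb; ring.
    under eq_bigr do rewrite ex; rewrite -mulr_sumr ev_sum.
    by rewrite (seq_moment32 XY YZ ZX F3 F1 F2) evZ crossY !mulr0.
  rewrite (weighted_quadratic _ _ _ _ _ _ tot (ma _ st) (mb _ st) (mc _ st) m11 m22 m33 m31 m32).
  by rewrite t0 t1 t2; ring.
Qed.

End Estimator.

(** * Rotation of the transverse plane *)

Section Diagonalisation.
Variable R : realType.
Local Notation o0 := (Ordinal (isT : 0 < 3)%N).
Local Notation o1 := (Ordinal (isT : 1 < 3)%N).
Local Notation o2 := (Ordinal (isT : 2 < 3)%N).

(** For (p, q) = (cos t, sin t) the pair is the cosine and sine of t / 2. The sine is found by
    division by 2 cos (t / 2), so p = -1 is treated apart. *)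
Lemma half_angle (p q : R) : p ^+ 2 + q ^+ 2 = 1 ->
  exists u1 u2 : R, [/\ u1 ^+ 2 + u2 ^+ 2 = 1, u1 ^+ 2 - u2 ^+ 2 = p & 2 * u1 * u2 = q].
Proof.
move=> pq; have [p1|p1] := eqVneq (1 + p) 0.
  have pE : p = -1 by lra.
  have q0 : q = 0 by apply/eqP; rewrite -sqrf_eq0; apply/eqP; rewrite -[LHS](addKr (p ^+ 2)) pq pE; ring.
  by exists 0, 1; split; rewrite ?pE ?q0; ring.
have h : 0 < (1 + p) / 2.
  have : 0 <= 1 + p by have := sqr_ge0 q; nra.
  by rewrite le_eqVlt eq_sym (negbTE p1) /= => ?; apply: divr_gt0.
pose u := Num.sqrt ((1 + p) / 2).
have u0 : u != 0 by rewrite gt_eqF // sqrtr_gt0.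
have u2 : u ^+ 2 = (1 + p) / 2 by rewrite sqr_sqrtr // ltW.
have v2 : (q / (2 * u)) ^+ 2 = (1 - p) / 2.
  rewrite expr_div_n exprMn u2; have -> : q ^+ 2 = (1 - p) * (1 + p) by rewrite -[LHS](addKr (p ^+
    2)) pq; ring.
  by field.
exists u, (q / (2 * u)); split; [rewrite u2 v2|rewrite u2 v2|]; by field.
Qed.

(** The traceless part of the form is a vector (d, b) that turns by twice the angle of rotation;
    half its angle aligns it with the first axis, and [h] is its length. *)
Lemma binary_form_diag (a b c : R) : exists u1 u2 h : R,
  [/\ u1 ^+ 2 + u2 ^+ 2 = 1, h ^+ 2 = ((a - c) / 2) ^+ 2 + b ^+ 2 &
   forall x y, a * (u1 * x - u2 * y) ^+ 2 + c * (u2 * x + u1 * y) ^+ 2 +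
     2 * b * (u1 * x - u2 * y) * (u2 * x + u1 * y) =
     ((a + c) / 2 + h) * x ^+ 2 + ((a + c) / 2 - h) * y ^+ 2].
Proof.
pose d := (a - c) / 2; pose h := Num.sqrt (d ^+ 2 + b ^+ 2).
have h2 : h ^+ 2 = d ^+ 2 + b ^+ 2 by rewrite sqr_sqrtr // addr_ge0 ?sqr_ge0.
have [p [q [pq hd hb]]] : exists p q : R, [/\ p ^+ 2 + q ^+ 2 = 1, d = h * p & b = h * q].
  have [h0|h0] := eqVneq h 0.
    have : d ^+ 2 + b ^+ 2 == 0 by rewrite -h2 h0 expr0n.
    rewrite paddr_eq0 ?sqr_ge0 // !sqrf_eq0 => /andP[/eqP d0 /eqP b0].
    by exists 1, 0; split; rewrite ?h0 ?mul0r //; ring.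
  exists (d / h), (b / h); split; [|by rewrite mulrC divfK|by rewrite mulrC divfK].
  have -> : (d / h) ^+ 2 + (b / h) ^+ 2 = (d ^+ 2 + b ^+ 2) / h ^+ 2 by field.
  by rewrite -h2 divff // sqrf_eq0.
have [u1 [u2 [e1 e2 e3]]] := half_angle pq.
exists u1, u2, h; split=> // x y.
pose m := (a + c) / 2; rewrite -/m.
have -> : a * (u1 * x - u2 * y) ^+ 2 + c * (u2 * x + u1 * y) ^+ 2 +
   2 * b * (u1 * x - u2 * y) * (u2 * x + u1 * y) =
  m * (u1 ^+ 2 + u2 ^+ 2) * (x ^+ 2 + y ^+ 2) +
  d * ((u1 ^+ 2 - u2 ^+ 2) * (x ^+ 2 - y ^+ 2) - 2 * (2 * u1 * u2) * x * y) +
  b * ((2 * u1 * u2) * (x ^+ 2 - y ^+ 2) + 2 * (u1 ^+ 2 - u2 ^+ 2) * x * y) by rewrite /m /d; field.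
rewrite e1 e2 e3 hd hb.
have -> : m * 1 * (x ^+ 2 + y ^+ 2) + h * p * (p * (x ^+ 2 - y ^+ 2) - 2 * q * x * y) +
   h * q * (q * (x ^+ 2 - y ^+ 2) + 2 * p * x * y) =
   m * (x ^+ 2 + y ^+ 2) + h * (p ^+ 2 + q ^+ 2) * (x ^+ 2 - y ^+ 2) by ring.
by rewrite pq; ring.
Qed.

Lemma posdef_diag (G : 'M[R]_3) : posdefR G -> exists u1 u2 l1 l2 k1 k2 : R,
  [/\ u1 ^+ 2 + u2 ^+ 2 = 1, 0 < l1 /\ 0 < l2,
      \tr G = l1 + l2 + Gs G, l1 * l2 = \det (Gtilde G) &
      forall x y z, qform G (row3 (u1 * x - u2 * y) (u2 * x + u1 * y) z) =
        l1 * x ^+ 2 + l2 * y ^+ 2 + Gs G * z ^+ 2 + k1 * (x * z) + k2 * (y * z)].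
Proof.
move=> [Gsym Gpos].
have [u1 [u2 [h [u12 h2 hd]]]] := binary_form_diag (G o0 o0) (G o0 o1) (G o1 o1).
set l1 := (_ + _) / 2 + h in hd; set l2 := (_ + _) / 2 - h in hd.
have hq x y z : qform G (row3 (u1 * x - u2 * y) (u2 * x + u1 * y) z) =
    l1 * x ^+ 2 + l2 * y ^+ 2 + Gs G * z ^+ 2 + 2 * (u1 * G o0 o2 + u2 * G o1 o2) * (x * z) +
    2 * (- u2 * G o0 o2 + u1 * G o1 o2) * (y * z).
  by rewrite qform_row3 // GsE -hd; ring.
have pos x y : x ^+ 2 + y ^+ 2 = 1 -> 0 < qform G (row3 x y 0).
  move=> xy; apply: Gpos; apply: row3_neq0; have [x0|] := eqVneq x 0; last by left.
  right; left; apply/eqP => y0; have := oner_neq0 R; rewrite -xy x0 y0 => /eqP; apply; ring.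
exists u1, u2, l1, l2, (2 * (u1 * G o0 o2 + u2 * G o1 o2)), (2 * (- u2 * G o0 o2 + u1 * G o1 o2)).
split=> //.
- split.
    have := hq 1 0 0; rewrite !mulr1 !mulr0 !subr0 !addr0 => e.
    by have := pos _ _ u12; rewrite e; lra.
  have := hq 0 1 0; rewrite !mulr1 !mulr0 !add0r => e.
  have v12 : (- u2) ^+ 2 + u1 ^+ 2 = 1 by rewrite -u12; ring.
  by have := pos _ _ v12; rewrite e; lra.
- by rewrite /mxtrace sum3E GsE /l1 /l2; field.
- rewrite det_Gtilde // /l1 /l2.
  have -> : ((G o0 o0 + G o1 o1) / 2 + h) * ((G o0 o0 + G o1 o1) / 2 - h) =
     ((G o0 o0 + G o1 o1) / 2) ^+ 2 - h ^+ 2 by ring.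
  by rewrite h2; field.
Qed.

End Diagonalisation.

(** * Asymptotics *)

Section Limits.
Variable R : realType.

Lemma cvg_sqrt_harmonic : (fun k => Num.sqrt (k.+1%:R^-1 : R)) @ \oo --> (0 : R).
Proof.
by rewrite -(sqrtr0 R); apply: continuous_cvg; [exact: sqrt_continuous|exact: cvg_harmonic].
Qed.

(** The added square root sends the width to infinity even when a = 0, without changing the limiting
    ratio; the successor keeps every width positive. *)
Lemma window_size (a : R) : 0 <= a -> exists p : nat -> nat,
  [/\ forall k, (0 < p k)%N, (fun k => (p k)%:R / k.+1%:R) @ \oo --> a &
      (fun k => (p k)%:R^-1 : R) @ \oo --> (0 : R)].
Proof.
move=> a0; pose x k : R := k.+1%:R * a + Num.sqrt k.+1%:R.
have x0 k : 0 <= x k by rewrite addr_ge0 ?sqrtr_ge0 // mulr_ge0.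
exists (fun k => (Num.truncn (x k)).+1); split=> //.
  apply: (@squeeze_cvgr _ _ _ _ (fun=> a) (fun k => a + (Num.sqrt (k.+1%:R^-1) + k.+1%:R^-1))).
  - near=> k; have /andP[h1 h2] := truncn_itv (x0 k).
    have N0 : (0 : R) < k.+1%:R by rewrite ltr0n.
    rewrite ler_pdivlMr // ler_pdivrMr //; apply/andP; split.
      by rewrite (le_trans _ (ltW h2)) // /x mulrC lerDl sqrtr_ge0.
    rewrite !mulrDl mulVf ?gt_eqF // sqrtrV ?(ltW N0) // -[in X in _ + (_^-1 * X + _)](sqr_sqrtr (ltW N0)).
    rewrite expr2 mulKf ?gt_eqF ?sqrtr_gt0 // -natr1 addrA [a * _]mulrC.
    by rewrite lerD2r.
  - exact: cvg_cst.
  - rewrite -[X in _ --> X]addr0; apply: cvgD; first exact: cvg_cst.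
    rewrite -[X in _ --> X]addr0; apply: cvgD; [exact: cvg_sqrt_harmonic|exact: cvg_harmonic].
apply: (@squeeze_cvgr _ _ _ _ (fun=> 0) (fun k => Num.sqrt (k.+1%:R^-1))).
- near=> k; have /andP[h1 h2] := truncn_itv (x0 k).
  rewrite invr_ge0 ler0n /= sqrtrV ?ler0n // lef_pV2 ?posrE ?ltr0n ?sqrtr_gt0 ?ltr0n //.
  by rewrite (le_trans _ (ltW h2)) // /x lerDr mulr_ge0.
- exact: cvg_cst.
- exact: cvg_sqrt_harmonic.
Unshelve. all: by end_near. Qed.

(* n times the risk of [estimator_exists]; [q], [w], [v] stand for 1/p, p/n, 1/n, and [g] for
   n r^2 / p1. *)
Definition scaled_risk (l1 l2 s r q3 w3 q1 w1 g v : R) : R :=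
  l1 * (1 + w1 / (2 - q1)) * (1 + q3) ^+ 2 +
  l2 * (1 + (1 - v) * g * (2 + q1) / ((1 + q1) * (1 + 2 * q1))) * ((1 + q1) * (1 + q3)) ^+ 2 +
  s * (1 - r ^+ 2 + w3 / (2 - q3)).

Lemma scaled_riskE (l1 l2 s r : R) (k p3 p1 : nat) : (0 < p3)%N -> (0 < p1)%N ->
  let N : R := k.+1%:R in
  N * (l1 * ((2 / N / damp1 R p3) ^+ 2 * (N / 4 + noise R p1)) +
    l2 * ((2 / N / (damp1 R p1 * damp1 R p3)) ^+ 2 *
       ((1 + damp2 R p1) / 2 * (N / 4) + (1 - damp2 R p1) / 2 * (N / 4 + N * k%:R * r ^+ 2 / 4))) +
    s * ((2 / N) ^+ 2 * (N / 4 + N * k%:R * r ^+ 2 / 4 + noise R p3) - r ^+ 2)) =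
  scaled_risk l1 l2 s r p3%:R^-1 (p3%:R / N) p1%:R^-1 (p1%:R / N) (N / p1%:R * r ^+ 2) N^-1.
Proof.
move=> h3 h1 /=; rewrite /scaled_risk /damp1 /damp2 /noise.
have a1 : 1 <= p1%:R :> R by rewrite ler1n.
have a3 : 1 <= p3%:R :> R by rewrite ler1n.
have N1 : 1 <= k.+1%:R :> R by rewrite ler1n.
have -> : k%:R = k.+1%:R - 1 :> R by rewrite -natr1 addrK.
rewrite -!(natr1 p1.+1) -!(natr1 p1) -!(natr1 p3).
move: a1 a3 N1; move: (p1%:R : R) (p3%:R : R) (k.+1%:R : R) => x y n hx hy hn.
field; do ?[apply/andP; split]; apply/eqP; lra.
Qed.

End Limits.

Section OptimalSequence.
Variable R : realType.

Lemma scaled_risk_cvg (l1 l2 s r W w : R) (q3 w3 q1 w1 g v : nat -> R) :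
  q3 @ \oo --> (0 : R) -> w3 @ \oo --> (0 : R) -> q1 @ \oo --> (0 : R) -> w1 @ \oo --> W ->
  g @ \oo --> w -> v @ \oo --> (0 : R) ->
  (fun k => scaled_risk l1 l2 s r (q3 k) (w3 k) (q1 k) (w1 k) (g k) (v k)) @ \oo -->
    l1 * (1 + W / 2) + l2 * (1 + w * 2) + s * (1 - r ^+ 2).
Proof.
move=> hq3 hw3 hq1 hw1 hg hv.
have -> : l1 * (1 + W / 2) + l2 * (1 + w * 2) + s * (1 - r ^+ 2) = scaled_risk l1 l2 s r 0 0 0 W w 0.
  rewrite /scaled_risk !subr0 mulr0 !addr0 mul0r addr0 !mul1r divr1; ring.
have cst (c : R) : (fun=> c) @ \oo --> c by exact: cvg_cst.
have n2 : (2 - 0 : R) != 0 by rewrite subr0.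
have n1 : ((1 + 0) * (1 + 2 * 0) : R) != 0 by rewrite mulr0 !addr0 mul1r oner_neq0.
have d3 : (fun k => 1 + q3 k) @ \oo --> (1 + 0 : R)
  by exact: (cvgD (cst 1) hq3).
have d1 : (fun k => 1 + q1 k) @ \oo --> (1 + 0 : R)
  by exact: (cvgD (cst 1) hq1).
have t1 : (fun k => (2 - q1 k)^-1) @ \oo --> (2 - 0 : R)^-1
  by exact: (cvgV n2 (cvgB (cst 2) hq1)).
have t3 : (fun k => (2 - q3 k)^-1) @ \oo --> (2 - 0 : R)^-1
  by exact: (cvgV n2 (cvgB (cst 2) hq3)).
have a1 : (fun k => l1 * (1 + w1 k / (2 - q1 k))) @ \oo --> l1 * (1 + W / (2 - 0))
  by exact: (cvgM (cst l1) (cvgD (cst 1) (cvgM hw1 t1))).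
have b1 : (fun k => (1 - v k) * g k * (2 + q1 k)) @ \oo --> (1 - 0) * w * (2 + 0)
  by exact: (cvgM (cvgM (cvgB (cst 1) hv) hg) (cvgD (cst 2) hq1)).
have b2 : (fun k => ((1 + q1 k) * (1 + 2 * q1 k))^-1) @ \oo --> ((1 + 0) * (1 + 2 * 0) : R)^-1
  by exact: (cvgV n1 (cvgM d1 (cvgD (cst 1) (cvgM (cst 2) hq1)))).
have d : (fun k => (1 + q1 k) * (1 + q3 k)) @ \oo --> ((1 + 0) * (1 + 0) : R)
  by exact: (cvgM d1 d3).
have d32 : (fun k => (1 + q3 k) ^+ 2) @ \oo --> (1 + 0 : R) ^+ 2
  by exact: (cvgM d3 d3).
have d2 : (fun k => ((1 + q1 k) * (1 + q3 k)) ^+ 2) @ \oo --> ((1 + 0) * (1 + 0) : R) ^+ 2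
  by exact: (cvgM d d).
exact: (cvgD (cvgD (cvgM a1 d32) (cvgM (cvgM (cst l2) (cvgD (cst 1) (cvgM b1 b2))) d2))
  (cvgM (cst s) (cvgD (cst (1 - r ^+ 2)) (cvgM hw3 t3)))).
Qed.

Lemma optimal_sequence (r : R) (G : 'M[R]_3) : 0 <= r < 1 -> posdefR G ->
  exists2 M : forall k, POVM R (2 ^ k.+1),
    forall k, (forall th j, state (rho th) -> (law (M k) (rho_n th k.+1)).-integrable setT
       (fun x => (ovec x 0 j)%:E)) /\ (forall th, state (rho th) -> Ehat (M k) th = th) &
    (fun k => k.+1%:R%:E * trGV (M k) (theta_r r) G)%E @ \oo -->
       (\tr G - r ^+ 2 * Gs G + 2 * r * Num.sqrt (\det (Gtilde G)))%:E.
Proof.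
move=> r01 Gp; have /andP[r0 _] := r01.
have [u1 [u2 [l1 [l2 [k1 [k2 [u12 [l10 l20] trG detG hq]]]]]]] := posdef_diag Gp.
pose x : R := Num.sqrt l1; pose y : R := Num.sqrt l2.
have x0 : 0 < x by rewrite sqrtr_gt0.
have y0 : 0 < y by rewrite sqrtr_gt0.
have xE : l1 = x ^+ 2 by rewrite sqr_sqrtr // ltW.
have yE : l2 = y ^+ 2 by rewrite sqr_sqrtr // ltW.
(* This ratio of width to number of copies minimises l1 W / 2 + 2 l2 r^2 / W when r > 0. *)
have W0 : 0 <= 2 * (r * (y / x)) by rewrite !mulr_ge0 // ltW // invr_gt0.
have [p3 [p30 w3 q3]] := window_size (lexx (0 : R)).
have [p1 [p10 w1 q1]] := window_size W0.
have ex k := estimator_exists r k u12 (p30 k) (p10 k).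
pose M k := projT1 (cid (ex k)); have Mp k := projT2 (cid (ex k)); rewrite -/(M _) in Mp.
have st : state (rho (theta_r r)).
  by have [e e0] := near_rho_state r01; apply; rewrite subrr normr0.
exists M; first by move=> k; have [] := Mp k.
have hg : (fun k => k.+1%:R / (p1 k)%:R * r ^+ 2) @ \oo --> r * x / (2 * y).
  (* For r = 0 the ratio is zero and n / p1 need not converge, but the factor r^2 removes it. *)
  have [->|rn] := eqVneq r 0.
    by rewrite !mul0r; under eq_cvg do rewrite expr0n mulr0; exact: cvg_cst.
  have -> : r * x / (2 * y) = (2 * (r * (y / x)))^-1 * r ^+ 2.
    by field; rewrite rn !gt_eqF.
  apply: cvgM; last exact: cvg_cst.
  under eq_cvg do rewrite -invf_div.
  by apply: cvgV => //; rewrite !mulf_neq0 // ?invr_eq0 gt_eqF.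
have := @scaled_risk_cvg l1 l2 (Gs G) r _ _ _ _ _ _ _ _ q3 w3 q1 w1 hg (@cvg_harmonic R).
have -> : l1 * (1 + 2 * (r * (y / x)) / 2) + l2 * (1 + r * x / (2 * y) * 2) + Gs G * (1 - r ^+ 2) =
   \tr G - r ^+ 2 * Gs G + 2 * r * Num.sqrt (\det (Gtilde G)).
  rewrite trG -detG sqrtrM ?(ltW l10) // -/x -/y {1 2}xE {1 2}yE; field; by rewrite !gt_eqF.
move=> h.
have E k : (k.+1%:R%:E * trGV (M k) (theta_r r) G)%E = (scaled_risk l1 l2 (Gs G) r (p3 k)%:R^-1
    ((p3 k)%:R / k.+1%:R) (p1 k)%:R^-1 ((p1 k)%:R / k.+1%:R) (k.+1%:R / (p1 k)%:R * r ^+ 2) k.+1%:R^-1)%:E.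
  have [_ _ /(_ _ _ _ _ _ _ hq st) ->] := Mp k.
  by rewrite -EFinM -scaled_riskE.
under eq_cvg do rewrite E.
by apply: cvg_EFin => //; apply: nearW.
Qed.

End OptimalSequence.

(** * From exact unbiasedness to an asymptotically unbiased sequence *)

Section Attainment.
Variable R : realType.
Local Notation C := R[i].

(** The mean is the identity map near [th0], so every difference quotient with a small step already
    equals the limit. *)
Lemma unbiased_derivative n (M : POVM R (2 ^ n)) (th0 v : 'rV[R]_3) (e : R) (j : 'I_3) : 0 < e ->
  (forall th, `|th - th0| < e -> Ehat M th = th) ->
  derivable (fun t => Ehat M t 0 j) th0 v /\ derive (fun t => Ehat M t 0 j) th0 v = v 0 j.
Proof.
move=> e0 hE.
have nearE : \forall h \near (0 : R)^',
    h^-1 *: (((fun t => Ehat M t 0 j) \o shift th0) (h *: v) - Ehat M th0 0 j) = v 0 j.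
  have v0 : 0 < `|v| + 1 by rewrite ltr_wpDl.
  near=> h.
  have hn : h != 0 by near: h; exact: nbhs_dnbhs_neq.
  have hs : `|h| < e / (`|v| + 1).
    near: h; apply: dnbhs0_lt; exact: divr_gt0.
  rewrite /= !hE ?subrr ?normr0 //; first by rewrite !mxE addrK scalerA mulVf // scale1r.
  rewrite addrK normrZ; rewrite ltr_pdivlMr // in hs.
  by apply: le_lt_trans hs; rewrite ler_wpM2l // lerDl.
split; first by rewrite /derivable; apply: is_cvg_near_cst; exact: nearE.
exact: (lim_near_cst (@norm_hausdorff _ _) nearE).
Unshelve. all: by end_near. Qed.

Lemma psdC1 n : psdC (1%:M : 'M[C]_n).
Proof. by have := psdC_mul_adj (1%:M : 'M[C]_n); rewrite adjmx1 mulmx1. Qed.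

Lemma bound_attained (r : R) (G : 'M[R]_3) : 0 <= r < 1 -> posdefR G ->
  exists2 M : forall n, POVM R (2 ^ n), asym_unbiased M (theta_r r) &
  (fun n => (n%:R%:E * trGV (M n) (theta_r r) G)%E) @ \oo -->
     (\tr G - r ^+ 2 * Gs G + 2 * r * Num.sqrt (\det (Gtilde G)))%:E.
Proof.
move=> r01 Gp; have [M hM hlim] := optimal_sequence r01 Gp.
have [e e0 he] := near_rho_state r01.
have Esum : \sum_(x : unit) (1%:M : 'M[C]_(2 ^ 0)) = 1%:M by rewrite big_const card_unit /= addr0.
(* A constant estimator fills the place of zero copies; limits in [n] do not see it. *)
pose M0 : POVM R (2 ^ 0) := fin_povm (fun=> (0, 0, 0)) (fun=> psdC1 (2 ^ 0)) Esum.
pose M' n : POVM R (2 ^ n) := if n is k.+1 then M k else M0.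
have near1 (P : nat -> Prop) : (forall k, P k.+1) -> \forall n \near \oo, P n.
  by move=> h; exists 1%N => // -[|n] //=.
have Ek k th : `|th - theta_r r| < e -> Ehat (M k) th = th by move=> /he; apply: (hM k).2.
have th0 : `|theta_r r - theta_r r| < e by rewrite subrr normr0.
exists M'; first (split; last split).
- apply: near1 => k; split; last by move=> j l; have [] := unbiased_derivative (delta_mx 0 l) j e0 (Ek k).
  by exists e => // th /he st j; apply: (hM k).1.
- by move=> j; apply: cvg_near_cst; apply: near1 => k; rewrite /= Ek.
- move=> j l; apply: cvg_near_cst; apply: near1 => k; rewrite mxE.
  by have [_ ->] := unbiased_derivative (delta_mx 0 l) j e0 (Ek k); rewrite mxE eqxx.
by rewrite -cvg_shiftS.
Qed.

End Attainment.

Unset Implicit Arguments.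

Theorem mainTheorem8 (R : realType) (r : R) (G : 'M[R]_3) :
  0 <= r < 1 -> posdefR G ->
  let bound := \tr G - r ^+ 2 * Gs G + 2 * r * Num.sqrt (\det (Gtilde G)) in
  CR_bound (theta_r r) G = bound /\
  (forall M : forall n, POVM R (2 ^ n),
     asym_unbiased M (theta_r r) ->
     (bound%:E <= limn_einf (fun n => n%:R%:E * trGV (M n) (theta_r r) G))%E) /\
  (exists2 M : forall n, POVM R (2 ^ n),
     asym_unbiased M (theta_r r) &
     (fun n => (n%:R%:E * trGV (M n) (theta_r r) G)%E) @ \oo --> bound%:E).
Proof.
move=> r01 Gp bound; split; first exact: CR_boundE.
by split; [exact: lower_bound|exact: bound_attained].
Qed.
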